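(* Let $D\in\mathcal H^\infty_+\setminus\{0\}$ and $\varphi\in\mathcal G_{>0}$, $\varphi(s)=c_0s+\sum_{n\ge1}c_nn^{-s}$, and assume that $\varphi$ is not an automorphism of $\mathbb C_0$. Let $W_{D,\varphi}$ be the weighted composition operator $f\mapsto D\cdot(f\circ\varphi)$ on $\mathcal H^\infty_+$, with spectrum $\sigma(W_{D,\varphi})$. (a) If $c_0\ge2$ and $D(\infty)\ne0$, then $\sigma(W_{D,\varphi})=\{0,D(\infty)\}$. (b) If $c_0=1$ and $D(\infty)\neq0$, then $\sigma(W_{D,\varphi})=\{0\}\cup\{D(\infty)m^{-c_1}:m\in\mathbb N\}$. (c) If $D(\infty)=0$, then $\sigma(W_{D,\varphi})=\{0\}$.
   Context: $\mathbb N=\{1,2,\dots\}$; for $\theta\in\mathbb R$, $\mathbb C_\theta=\{s:\mathrm{Re}\,s>\theta\}$. $\mathcal G_{>0}$ is the set of maps $\varphi(s)=c_0s+\psi(s)$ where $c_0\ge1$ is an integer (the characteristic), $\psi$ is a Dirichlet series $\sum_{n\ge1}c_nn^{-s}$ converging uniformly in $\mathbb C_\varepsilon$ for every $\varepsilon>0$, and either $\psi\equiv i\tau$ for some $\tau\in\mathbb R$ or $\psi(\mathbb C_0)\subset\mathbb C_0$; such $\varphi$ is a self-map of $\mathbb C_0$. $\mathcal H^\infty_+$ is the Fr\'echet algebra of analytic functions on $\mathbb C_0$ that are bounded on $\mathbb C_\varepsilon$ for all $\varepsilon>0$ and can be represented as a convergent Dirichlet series in $\mathbb C_0$, with seminorms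 $P_\varepsilon(f)=\sup_{\mathbb C_\varepsilon}|f|$. For $D(s)=\sum_{n\ge1}a_nn^{-s}$ in $\mathcal H^\infty_+$, $D(\infty)=a_1=\lim_{\mathrm{Re}\,s\to+\infty}D(s)$. The spectrum of a continuous operator $T$ on $\mathcal H^\infty_+$ is the set of $\lambda\in\mathbb C$ such that $T-\lambda I$ is not invertible. *)

(* Defs.v *)
From Stdlib Require Import Reals.
From Coquelicot Require Import Coquelicot.
Open Scope R_scope.

(* Functions on the half-plane C_0 are represented by total functions C -> C
   of which only the values on C_0 are ever used; two such functions denote the
   same function on C_0 when they are related by [eq_C0]. *)
Definition half_plane (theta : R) (s : C) : Prop := theta < Re s.

Definition eq_C0 (f g : C -> C) : Prop :=
  forall s : C, half_plane 0 s -> f s = g s.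

Definition holomorphic_C0 (f : C -> C) : Prop :=
  forall s : C, half_plane 0 s ->
    ex_derive (K := C_AbsRing) (V := C_NormedModule) f s.

Definition Cexp (z : C) : C :=
  Cmult (RtoC (exp (Re z))) (cos (Im z), sin (Im z)).

(* n^{-s}, used for n >= 1 only. *)
Definition npow_opp (n : nat) (s : C) : C :=
  Cexp (Copp (Cmult s (RtoC (ln (INR n))))).

(* Coefficients are indexed from 1 as in sum_{n >= 1} a_n n^{-s}: the index is
   shifted because Coquelicot's series start at 0, and [a 0] is never used. *)
Definition dirichlet_term (a : nat -> C) (s : C) (k : nat) : C :=
  Cmult (a (S k)) (npow_opp (S k) s).

Definition dirichlet_rep (a : nat -> C) (f : C -> C) : Prop :=
  forall s : C, half_plane 0 s ->
    is_series (K := C_AbsRing) (V := C_NormedModule) (dirichlet_term a s) (f s).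

Definition dirichlet_unif_cv (a : nat -> C) (f : C -> C) (theta : R) : Prop :=
  forall eta : R, 0 < eta ->
    exists N : nat, forall n : nat, (N <= n)%nat ->
      forall s : C, half_plane theta s ->
        Cmod (Cminus (sum_n (G := C_NormedModule) (dirichlet_term a s) n) (f s))
          < eta.

(* The algebra H^infty_+. *)
Definition Hinf_plus (f : C -> C) : Prop :=
  holomorphic_C0 f /\
  (forall eps : R, 0 < eps ->
     exists M : R, forall s : C, half_plane eps s -> Cmod (f s) <= M) /\
  (exists a : nat -> C, dirichlet_rep a f).

(* P_eps(f), in the extended reals so that it is a genuine supremum for every f. *)
Definition seminorm (eps : R) (f : C -> C) : Rbar :=
  Lub_Rbar (fun x : R => exists s : C, half_plane eps s /\ x = Cmod (f s)).

Definition fsub (f g : C -> C) : C -> C := fun s => Cminus (f s) (g s).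

(* The seminorms increase as eps decreases to 0, so the sets
   {g | seminorm delta (g - f) < rho} form a base of neighbourhoods of f for the
   Frechet topology. *)
Definition continuous_Hinf (T : (C -> C) -> (C -> C)) : Prop :=
  forall f : C -> C, Hinf_plus f ->
  forall eps eta : R, 0 < eps -> 0 < eta ->
  exists delta rho : R, 0 < delta /\ 0 < rho /\
    forall g : C -> C, Hinf_plus g ->
      Rbar_lt (seminorm delta (fsub g f)) rho ->
      Rbar_lt (seminorm eps (fsub (T g) (T f))) eta.

(* Continuity forces T to be compatible with [eq_C0] on H^infty_+. *)
Definition continuous_operator (T : (C -> C) -> (C -> C)) : Prop :=
  (forall f : C -> C, Hinf_plus f -> Hinf_plus (T f)) /\
  (forall f g : C -> C, Hinf_plus f -> Hinf_plus g ->
     eq_C0 (T (fun s => Cplus (f s) (g s)))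
           (fun s => Cplus (T f s) (T g s))) /\
  (forall (k : C) (f : C -> C), Hinf_plus f ->
     eq_C0 (T (fun s => Cmult k (f s))) (fun s => Cmult k (T f s))) /\
  continuous_Hinf T.

(* Invertibility in the algebra of continuous operators on H^infty_+. *)
Definition invertible_operator (T : (C -> C) -> (C -> C)) : Prop :=
  continuous_operator T /\
  exists U : (C -> C) -> (C -> C), continuous_operator U /\
    forall f : C -> C, Hinf_plus f -> eq_C0 (U (T f)) f /\ eq_C0 (T (U f)) f.

Definition spectrum (T : (C -> C) -> (C -> C)) (lambda : C) : Prop :=
  ~ invertible_operator (fun f s => Cminus (T f s) (Cmult lambda (f s))).

(* phi belongs to G_{>0}, with characteristic c0 and Dirichlet coefficients c. *)
Definition G_pos (c0 : nat) (c : nat -> C) (phi : C -> C) : Prop :=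
  (1 <= c0)%nat /\
  exists psi : C -> C,
    (forall s : C, half_plane 0 s ->
       phi s = Cplus (Cmult (RtoC (INR c0)) s) (psi s)) /\
    (forall eps : R, 0 < eps -> dirichlet_unif_cv c psi eps) /\
    ((exists tau : R, forall s : C, half_plane 0 s ->
        psi s = Cmult Ci (RtoC tau)) \/
     (forall s : C, half_plane 0 s -> half_plane 0 (psi s))).

Definition automorphism_C0 (phi : C -> C) : Prop :=
  (forall s : C, half_plane 0 s -> half_plane 0 (phi s)) /\
  holomorphic_C0 phi /\
  exists chi : C -> C,
    (forall s : C, half_plane 0 s -> half_plane 0 (chi s)) /\
    holomorphic_C0 chi /\
    (forall s : C, half_plane 0 s -> chi (phi s) = s /\ phi (chi s) = s).

Definition weighted_comp (D phi : C -> C) : (C -> C) -> (C -> C) :=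
  fun f s => Cmult (D s) (f (phi s)).

(* Main.v *)
Require Import Defs.
From Stdlib Require Import Reals Lra Lia Arith Classical ClassicalEpsilon.
From Coquelicot Require Import Coquelicot.
Open Scope R_scope.

(* In the basis [n^{-s}] the operator [W] is lower triangular, with diagonal
   [D(infty)] times [n^{-c_1}] (if [c0 = 1]), respectively [1, 0, 0, ...] (if
   [c0 >= 2]).  Everything rests on Bohr's theorem in quantitative form: if
   [|f| <= M] on [C_theta], the partial sums of [f] are [O(M log N)] there.  It is
   proved by averaging [f] along vertical lines against the kernel
   [(cos At - cos Bt)/t^2] with [A = log N], [B = log (N+1)], whose cosine transform
   is constant up to [A] and zero beyond [B].  It makes H^infty_+ a complete algebra
   stable under composition with [phi] and bounds coefficients by seminorms.
   As [phi] is not an automorphism, [psi] maps into [C_0], and then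
   [Re phi(s) >= Re s + kappa(eps)] on [C_eps].  Hence on functions of order [N^{-s}]
   at infinity, [N] large, [W] is as contracting as needed and a Neumann series
   inverts [W - lambda]; the first [N - 1] coefficients are then solved for one by
   one if [lambda] is not on the diagonal.  If [lambda] is the [m]-th diagonal entry
   and no earlier one, [m^{-s}] is not in the range.  For [c0 = 1],
   [D(infty) <> 0] and [lambda = 0], a continuous inverse would map the bounded
   family [n^{-s}] to a bounded one with leading coefficients of size
   [n^{Re c_1}], too large for Bohr's bound. *)

(** * Complex sequences and finite sums *)

Ltac re_im_ring :=
  unfold Re, Im, Cminus, Cplus, Copp, Cmult, Cconj, Ci, RtoC; simpl; ring.

Fixpoint Csum (u : nat -> C) (n : nat) : C :=
  match n with
  | O => RtoC 0
  | S k => Cplus (Csum u k) (u k)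
  end.

Lemma Csum_ext (u v : nat -> C) (n : nat) :
  (forall k, (k < n)%nat -> u k = v k) -> Csum u n = Csum v n.
Proof.
  induction n as [|n IH]; intros H; simpl; [reflexivity|].
  rewrite IH, H; auto with arith.
Qed.

Lemma Csum_plus (u v : nat -> C) (n : nat) :
  Csum (fun k => Cplus (u k) (v k)) n = Cplus (Csum u n) (Csum v n).
Proof. induction n as [|n IH]; simpl; [|rewrite IH]; ring. Qed.

Lemma Csum_scal (z : C) (u : nat -> C) (n : nat) :
  Csum (fun k => Cmult z (u k)) n = Cmult z (Csum u n).
Proof. induction n as [|n IH]; simpl; [|rewrite IH]; ring. Qed.

Lemma Csum_minus (u v : nat -> C) (n : nat) :
  Csum (fun k => Cminus (u k) (v k)) n = Cminus (Csum u n) (Csum v n).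
Proof. induction n as [|n IH]; simpl; [|rewrite IH]; ring. Qed.

Lemma Csum_shift (u : nat -> C) (p n : nat) :
  Csum (fun k => u (p + k)%nat) n = Cminus (Csum u (p + n)) (Csum u p).
Proof.
  induction n as [|n IH]; simpl.
  - rewrite Nat.add_0_r. ring.
  - rewrite IH, Nat.add_succ_r. simpl. ring.
Qed.

Fixpoint Rsum (u : nat -> R) (n : nat) : R :=
  match n with
  | O => 0
  | S k => Rsum u k + u k
  end.

Lemma Rsum_le (u v : nat -> R) (n : nat) :
  (forall k, (k < n)%nat -> u k <= v k) -> Rsum u n <= Rsum v n.
Proof.
  induction n as [|n IH]; intros H; simpl; [lra|].
  apply Rplus_le_compat; [apply IH; auto with arith|apply H; auto with arith].
Qed.

Lemma Rsum_scal (z : R) (u : nat -> R) (n : nat) :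
  Rsum (fun k => z * u k) n = z * Rsum u n.
Proof. induction n as [|n IH]; simpl; [|rewrite IH]; ring. Qed.

Lemma Rsum_const (z : R) (n : nat) : Rsum (fun _ => z) n = INR n * z.
Proof. induction n as [|n IH]; [simpl; ring|]. rewrite S_INR. simpl. rewrite IH. ring. Qed.

Lemma Rsum_telescope (z : nat -> R) (n : nat) :
  Rsum (fun k => z k - z (S k)) n = z O - z n.
Proof. induction n as [|n IH]; simpl; [|rewrite IH]; ring. Qed.

Lemma Cmod_Csum (u : nat -> C) (n : nat) :
  Cmod (Csum u n) <= Rsum (fun k => Cmod (u k)) n.
Proof.
  induction n as [|n IH]; simpl.
  - rewrite Cmod_0. lra.
  - eapply Rle_trans; [apply Cmod_triangle|]. lra.
Qed.

Lemma Cmod_minus_sym (x y : C) : Cmod (Cminus x y) = Cmod (Cminus y x).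
Proof. rewrite <- Cmod_opp. f_equal. ring. Qed.

Lemma Cmod_minus_triangle (x y z : C) :
  Cmod (Cminus x z) <= Cmod (Cminus x y) + Cmod (Cminus y z).
Proof.
  replace (Cminus x z) with (Cplus (Cminus x y) (Cminus y z)) by ring.
  apply Cmod_triangle.
Qed.

Lemma Cmod_minus_le (x y : C) : Cmod (Cminus x y) <= Cmod x + Cmod y.
Proof.
  eapply Rle_trans; [apply Cmod_triangle|]. rewrite Cmod_opp. lra.
Qed.

Lemma Cmod_le_minus (x y : C) : Cmod x <= Cmod y + Cmod (Cminus x y).
Proof.
  replace x with (Cplus y (Cminus x y)) at 1 by ring. apply Cmod_triangle.
Qed.

Lemma im_le_Cmod (z : C) : Rabs (Im z) <= Cmod z.
Proof.
  eapply Rle_trans; [|apply Rmax_Cmod]. apply Rmax_r.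
Qed.

Lemma re_le_Cmod' (z : C) : Re z <= Cmod z.
Proof. eapply Rle_trans; [apply Rle_abs|apply re_le_Cmod]. Qed.

Lemma re_ge_Cmod (z : C) : - Cmod z <= Re z.
Proof. pose proof (re_le_Cmod z). apply Rabs_le_between in H. lra. Qed.

Lemma Cmod_le_Re_Im (z : C) : Cmod z <= Rabs (Re z) + Rabs (Im z).
Proof.
  destruct z as [x y]. unfold Re, Im; simpl.
  replace (x, y) with (Cplus (RtoC x) (Cmult Ci (RtoC y))).
  - eapply Rle_trans; [apply Cmod_triangle|].
    rewrite Cmod_mult, Cmod_Ci, !Cmod_R. lra.
  - unfold Cplus, Cmult, Ci, RtoC; simpl. f_equal; ring.
Qed.

Definition Ccv (u : nat -> C) (l : C) : Prop :=
  forall eta : R, 0 < eta ->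
    exists N : nat, forall n : nat, (N <= n)%nat -> Cmod (Cminus (u n) l) < eta.

Lemma Ccv_unique (u : nat -> C) (l m : C) : Ccv u l -> Ccv u m -> l = m.
Proof.
  intros Hl Hm. destruct (Ceq_dec l m) as [|Hn]; [assumption|exfalso].
  assert (Hp : 0 < Cmod (Cminus l m)).
  { apply Cmod_gt_0. intro E. apply Hn.
    replace l with (Cplus (Cminus l m) m) by ring. rewrite E. ring. }
  destruct (Hl (Cmod (Cminus l m) / 2)) as [N1 H1]; [lra|].
  destruct (Hm (Cmod (Cminus l m) / 2)) as [N2 H2]; [lra|].
  specialize (H1 (max N1 N2) (Nat.le_max_l _ _)).
  specialize (H2 (max N1 N2) (Nat.le_max_r _ _)).
  pose proof (Cmod_minus_triangle l (u (max N1 N2)) m).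
  rewrite (Cmod_minus_sym l (u _)) in H. lra.
Qed.

Lemma Ccv_ext (u v : nat -> C) (l : C) : (forall n, u n = v n) -> Ccv u l -> Ccv v l.
Proof.
  intros E H eta He. destruct (H eta He) as [N HN]. exists N. intros n Hn.
  rewrite <- E. auto.
Qed.

Lemma Ccv_const (l : C) : Ccv (fun _ => l) l.
Proof.
  intros eta He. exists O. intros n _.
  replace (Cminus l l) with (RtoC 0) by ring. rewrite Cmod_0. exact He.
Qed.

Lemma Ccv_plus (u v : nat -> C) (l m : C) :
  Ccv u l -> Ccv v m -> Ccv (fun n => Cplus (u n) (v n)) (Cplus l m).
Proof.
  intros H1 H2 eta He.
  destruct (H1 (eta / 2)) as [N1 K1]; [lra|].
  destruct (H2 (eta / 2)) as [N2 K2]; [lra|].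
  exists (max N1 N2). intros n Hn.
  specialize (K1 n ltac:(lia)). specialize (K2 n ltac:(lia)).
  replace (Cminus (Cplus (u n) (v n)) (Cplus l m))
    with (Cplus (Cminus (u n) l) (Cminus (v n) m)) by ring.
  eapply Rle_lt_trans; [apply Cmod_triangle|]. lra.
Qed.

Lemma Ccv_scal (z : C) (u : nat -> C) (l : C) :
  Ccv u l -> Ccv (fun n => Cmult z (u n)) (Cmult z l).
Proof.
  intros H eta He.
  pose proof (Cmod_ge_0 z) as Hz.
  destruct (H (eta / (Cmod z + 1))) as [N K].
  { apply Rdiv_lt_0_compat; lra. }
  exists N. intros n Hn. specialize (K n Hn).
  replace (Cminus (Cmult z (u n)) (Cmult z l)) with (Cmult z (Cminus (u n) l)) by ring.
  rewrite Cmod_mult.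
  pose proof (Cmod_ge_0 (Cminus (u n) l)).
  assert (Cmod (Cminus (u n) l) * (Cmod z + 1) < eta).
  { apply Rlt_div_r in K; lra. }
  nra.
Qed.

Lemma Ccv_bound (u : nat -> C) (l : C) (M : R) (N : nat) :
  Ccv u l -> (forall n, (N <= n)%nat -> Cmod (u n) <= M) -> Cmod l <= M.
Proof.
  intros H B. apply le_epsilon. intros eps He.
  destruct (H eps He) as [N1 H1].
  specialize (H1 (max N N1) ltac:(lia)). specialize (B (max N N1) ltac:(lia)).
  pose proof (Cmod_le_minus l (u (max N N1))). rewrite Cmod_minus_sym in H0. lra.
Qed.

Lemma Ccv_minus (u v : nat -> C) (l m : C) :
  Ccv u l -> Ccv v m -> Ccv (fun n => Cminus (u n) (v n)) (Cminus l m).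
Proof.
  intros Hu Hv. apply Ccv_ext with (fun n => Cplus (u n) (Cmult (Copp (RtoC 1)) (v n))).
  - intros n. ring.
  - replace (Cminus l m) with (Cplus l (Cmult (Copp (RtoC 1)) m)) by ring.
    apply Ccv_plus; [exact Hu|apply Ccv_scal; exact Hv].
Qed.

Lemma Ccv_dist_le (u : nat -> C) (l z : C) (M : R) (N : nat) :
  Ccv u l -> (forall n, (N <= n)%nat -> Cmod (Cminus (u n) z) <= M) -> Cmod (Cminus l z) <= M.
Proof.
  intros H B. exact (Ccv_bound _ _ M N (Ccv_minus _ _ _ _ H (Ccv_const z)) B).
Qed.

Lemma Ccv_bounded (u : nat -> C) (l : C) : Ccv u l -> exists M, forall n, Cmod (u n) <= M.
Proof.
  intros H. destruct (H 1 ltac:(lra)) as [N HN].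
  assert (HB : forall K : nat, exists M, forall n, (n < K)%nat -> Cmod (u n) <= M).
  { induction K as [|K [M IH]].
    - exists 0. intros; lia.
    - exists (Rmax M (Cmod (u K))). intros n Hn.
      destruct (Nat.eq_dec n K) as [->|]; [apply Rmax_r|].
      eapply Rle_trans; [apply IH; lia|apply Rmax_l]. }
  destruct (HB N) as [M HM].
  exists (Rmax M (Cmod l + 1)). intros n.
  destruct (le_lt_dec N n) as [h|h].
  - specialize (HN n h). pose proof (Cmod_le_minus (u n) l).
    eapply Rle_trans; [|apply Rmax_r]. lra.
  - eapply Rle_trans; [apply HM; exact h|apply Rmax_l].
Qed.

Lemma Ccv_Cauchy (u : nat -> C) :
  (forall eta : R, 0 < eta -> exists N : nat, forall n m : nat,
     (N <= n)%nat -> (n <= m)%nat -> Cmod (Cminus (u m) (u n)) < eta) ->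
  exists l : C, Ccv u l.
Proof.
  intros H.
  assert (HC : forall p : C -> R,
    (forall x y : C, Rabs (p x - p y) <= Cmod (Cminus x y)) ->
    Cauchy_crit (fun n => p (u n))).
  { intros p Hp eps He. destruct (H eps He) as [N HN]. exists N.
    intros n m Hn Hm. unfold Rdist.
    eapply Rle_lt_trans; [apply Hp|].
    destruct (le_lt_dec n m) as [h|h].
    - rewrite Cmod_minus_sym. apply HN; lia.
    - apply HN; lia. }
  assert (H1 : Cauchy_crit (fun n => Re (u n))).
  { apply HC. intros y z. apply (re_le_Cmod (Cminus y z)). }
  assert (H2 : Cauchy_crit (fun n => Im (u n))).
  { apply HC. intros y z. apply (im_le_Cmod (Cminus y z)). }
  destruct (Rcomplete.R_complete _ H1) as [x Hx].
  destruct (Rcomplete.R_complete _ H2) as [y Hy].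
  clear H1 H2.
  exists (x, y). intros eta He.
  destruct (Hx (eta / 2)) as [N1 H1]; [lra|].
  destruct (Hy (eta / 2)) as [N2 H2]; [lra|].
  exists (max N1 N2). intros n Hn.
  specialize (H1 n ltac:(lia)). specialize (H2 n ltac:(lia)). unfold Rdist in *.
  eapply Rle_lt_trans; [apply Cmod_le_Re_Im|].
  assert (E1 : Re (Cminus (u n) (x, y)) = Re (u n) - x) by reflexivity.
  assert (E2 : Im (Cminus (u n) (x, y)) = Im (u n) - y) by reflexivity.
  rewrite E1, E2. lra.
Qed.

Lemma sum_n_Csum (u : nat -> C) (n : nat) :
  sum_n (G := C_NormedModule) u n = Csum u (S n).
Proof.
  induction n as [|n IH].
  - rewrite sum_O. simpl. ring.
  - rewrite sum_Sn, IH. reflexivity.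
Qed.

Lemma is_series_C (u : nat -> C) (l : C) :
  is_series (K := C_AbsRing) (V := C_NormedModule) u l <-> Ccv (Csum u) l.
Proof.
  unfold is_series. split.
  - intros H eta He.
    pose proof (proj1 (filterlim_locally_ball_norm (K := C_AbsRing) (U := C_NormedModule)
      (sum_n u) l) H (mkposreal eta He)) as [N HN].
    exists (S N). intros n Hn. destruct n as [|n]; [lia|].
    specialize (HN n ltac:(lia)). unfold ball_norm in HN.
    rewrite sum_n_Csum in HN. exact HN.
  - intros H.
    apply (filterlim_locally_ball_norm (K := C_AbsRing) (U := C_NormedModule)).
    intros [eta He]. destruct (H eta He) as [N HN]. exists N. intros n Hn.
    unfold ball_norm. rewrite sum_n_Csum. apply HN. lia.
Qed.

Lemma Cplus_minus_cancel (x y : C) : Cplus x (Cminus y x) = y.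
Proof. ring. Qed.

Lemma ex_derive_C_intro (f : C -> C) (s l : C) :
  (forall eta : R, 0 < eta -> exists delta : R, 0 < delta /\
     forall h : C, Cmod h < delta ->
       Cmod (Cminus (Cminus (f (Cplus s h)) (f s)) (Cmult l h)) <= eta * Cmod h) ->
  ex_derive (K := C_AbsRing) (V := C_NormedModule) f s.
Proof.
  intros H. exists l. split; [apply (is_linear_scal_l (K := C_AbsRing) (V := C_NormedModule))|].
  intros x Hx. apply (is_filter_lim_locally_unique (K := C_AbsRing) (V := AbsRing_NormedModule C_AbsRing)) in Hx.
  subst x. intros eta.
  destruct (H eta (cond_pos eta)) as [delta [Hd K]].
  apply (locally_le_locally_norm (K := C_AbsRing) (V := AbsRing_NormedModule C_AbsRing)).
  exists (mkposreal delta Hd). intros y Hy.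
  specialize (K (Cminus y s) Hy).
  rewrite Cplus_minus_cancel in K.
  assert (E : scal (K := C_AbsRing) (V := C_NormedModule) (minus y s) l = Cmult l (Cminus y s)).
  { apply Cmult_comm. }
  unfold norm at 1. simpl. rewrite <- (Cmult_comm (Cminus y s) l) in K. exact K.
Qed.

Lemma ex_derive_C_continuous (f : C -> C) (s : C) :
  ex_derive (K := C_AbsRing) (V := C_NormedModule) f s ->
  forall eta : R, 0 < eta -> exists delta : R, 0 < delta /\
    forall h : C, Cmod h < delta -> Cmod (Cminus (f (Cplus s h)) (f s)) < eta.
Proof.
  intros [l [_ H]] eta He.
  specialize (H s (fun P h => h) (mkposreal 1 Rlt_0_1)).
  apply (locally_norm_le_locally (K := C_AbsRing) (V := AbsRing_NormedModule C_AbsRing)) in H.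
  destruct H as [[d Hd] H].
  pose proof (Cmod_ge_0 l) as Hl.
  exists (Rmin d (eta / (Cmod l + 2))). split.
  { apply Rmin_pos; [exact Hd|]. apply Rdiv_lt_0_compat; lra. }
  intros h Hh.
  assert (Hh1 : Cmod h < d) by (eapply Rlt_le_trans; [exact Hh|apply Rmin_l]).
  assert (Hh2 : Cmod h < eta / (Cmod l + 2)) by (eapply Rlt_le_trans; [exact Hh|apply Rmin_r]).
  specialize (H (Cplus s h)).
  assert (E : Cminus (Cplus s h) s = h) by ring.
  assert (K : Cmod (Cminus (Cminus (f (Cplus s h)) (f s)) (Cmult (Cminus (Cplus s h) s) l))
     <= 1 * Cmod (Cminus (Cplus s h) s)).
  { apply H. change (Cmod (Cminus (Cplus s h) s) < d). rewrite E. exact Hh1. }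
  rewrite E in K.
  pose proof (Cmod_le_minus (Cminus (f (Cplus s h)) (f s)) (Cmult h l)) as T.
  rewrite Cmod_mult in T.
  apply Rlt_div_r in Hh2; [|lra].
  pose proof (Cmod_ge_0 h).
  nra.
Qed.

(** * The complex exponential and the functions n^{-s} *)

Definition is_curve_derive (g : R -> C) (t : R) (d : C) : Prop :=
  is_derive (fun x => Re (g x)) t (Re d) /\ is_derive (fun x => Im (g x)) t (Im d).

Lemma curve_derive_const (z : C) (t : R) : is_curve_derive (fun _ => z) t (RtoC 0).
Proof. split; exact (is_derive_const (V := R_NormedModule) _ t). Qed.

Lemma curve_derive_id (t : R) : is_curve_derive RtoC t (RtoC 1).
Proof.
  split; [exact (is_derive_id t)|exact (is_derive_const (V := R_NormedModule) _ t)].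
Qed.

Lemma curve_derive_plus (g h : R -> C) (t : R) (d e : C) :
  is_curve_derive g t d -> is_curve_derive h t e ->
  is_curve_derive (fun x => Cplus (g x) (h x)) t (Cplus d e).
Proof.
  intros [G1 G2] [H1 H2]. split.
  - exact (is_derive_plus _ _ t _ _ G1 H1).
  - exact (is_derive_plus _ _ t _ _ G2 H2).
Qed.

Lemma is_derive_eq (f : R -> R) (t d e : R) : is_derive f t d -> d = e -> is_derive f t e.
Proof. intros H <-. exact H. Qed.

Lemma is_derive_mult_R (f g : R -> R) (t df dg : R) :
  is_derive f t df -> is_derive g t dg ->
  is_derive (fun x => f x * g x) t (df * g t + f t * dg).
Proof.
  intros F G. exact (is_derive_mult f g t df dg F G Rmult_comm).
Qed.

Lemma curve_derive_mult (g h : R -> C) (t : R) (d e : C) :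
  is_curve_derive g t d -> is_curve_derive h t e ->
  is_curve_derive (fun x => Cmult (g x) (h x)) t
    (Cplus (Cmult d (h t)) (Cmult (g t) e)).
Proof.
  intros [G1 G2] [H1 H2]. split.
  - eapply is_derive_ext; [|eapply is_derive_eq;
      [apply (is_derive_minus (V := R_NormedModule) _ _ t _ _
        (is_derive_mult_R _ _ t _ _ G1 H1) (is_derive_mult_R _ _ t _ _ G2 H2))|]].
    + intros x. reflexivity.
    + unfold minus, plus, opp; simpl. unfold Re, Im. simpl. ring.
  - eapply is_derive_ext; [|eapply is_derive_eq;
      [apply (is_derive_plus (V := R_NormedModule) _ _ t _ _
        (is_derive_mult_R _ _ t _ _ G1 H2) (is_derive_mult_R _ _ t _ _ G2 H1))|]].
    + intros x. reflexivity.
    + unfold minus, plus, opp; simpl. unfold Re, Im. simpl. ring.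
Qed.

Lemma curve_derive_Cexp (w : C) (t : R) :
  is_curve_derive (fun x => Cexp (Cmult (RtoC x) w)) t
    (Cmult w (Cexp (Cmult (RtoC t) w))).
Proof.
  destruct w as [a b]. unfold is_curve_derive, Cexp, Re, Im, Cmult, RtoC; simpl. split.
  - auto_derive; [trivial|]. unfold Rminus. ring.
  - auto_derive; [trivial|]. unfold Rminus. ring.
Qed.

Lemma curve_derive_ext (g h : R -> C) (t : R) (d e : C) :
  (forall x, g x = h x) -> d = e -> is_curve_derive g t d -> is_curve_derive h t e.
Proof.
  intros E <- [G1 G2]. split.
  - eapply is_derive_ext; [|exact G1]. intros x. simpl. now rewrite E.
  - eapply is_derive_ext; [|exact G2]. intros x. simpl. now rewrite E.
Qed.

Lemma nondecreasing_of_derive (f df : R -> R) (a b : R) :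
  a <= b -> (forall t, a <= t <= b -> is_derive f t (df t) /\ 0 <= df t) -> f a <= f b.
Proof.
  intros Hab H.
  destruct (MVT_gen f a b df) as [c [Hc E]].
  - rewrite Rmin_left, Rmax_right by lra. intros x Hx. apply H. lra.
  - rewrite Rmin_left, Rmax_right by lra. intros x Hx.
    apply continuity_pt_filterlim.
    refine (ex_derive_continuous (K := R_AbsRing) (V := R_NormedModule) f x _).
    exists (df x). apply H. lra.
  - rewrite Rmin_left, Rmax_right in Hc by lra.
    destruct (H c Hc) as [_ P]. nra.
Qed.

(* Projecting the curve onto the direction of [g b - g a] reduces the claim to
   monotonicity of a real function. *)
Lemma mean_value_C (g gd : R -> C) (k kd : R -> R) (a b : R) :
  a <= b ->
  (forall t, a <= t <= b -> is_curve_derive g t (gd t) /\ is_derive k t (kd t) /\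
     Cmod (gd t) <= kd t) ->
  Cmod (Cminus (g b) (g a)) <= k b - k a.
Proof.
  intros Hab H.
  set (D := Cminus (g b) (g a)).
  assert (Hk : k a <= k b).
  { apply (nondecreasing_of_derive k kd a b Hab). intros t Ht.
    destruct (H t Ht) as [_ [K1 K2]]. split; [exact K1|].
    eapply Rle_trans; [apply Cmod_ge_0|exact K2]. }
  pose proof (Cmod_ge_0 D) as HD.
  destruct (Req_dec (Cmod D) 0) as [E|NE]; [lra|].
  set (F := fun t => Cmod D * k t + ((- Re D) * Re (g t) + (- Im D) * Im (g t))).
  set (Fd := fun t => Cmod D * kd t + ((- Re D) * Re (gd t) + (- Im D) * Im (gd t))).
  assert (HF : F a <= F b).
  { apply (nondecreasing_of_derive F Fd a b Hab). intros t Ht.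
    destruct (H t Ht) as [[G1 G2] [K1 K2]]. split.
    - unfold F, Fd.
      exact (is_derive_plus _ _ t _ _ (is_derive_scal k t (Cmod D) _ K1)
        (is_derive_plus _ _ t _ _ (is_derive_scal _ t (- Re D) _ G1)
           (is_derive_scal _ t (- Im D) _ G2))).
    - unfold Fd.
      assert (CS : Re D * Re (gd t) + Im D * Im (gd t) <= Cmod D * Cmod (gd t)).
      { replace (Re D * Re (gd t) + Im D * Im (gd t)) with (Re (Cmult (Cconj D) (gd t))).
        - rewrite <- Cmod_conj, <- Cmod_mult. apply re_le_Cmod'.
        - re_im_ring. }
      nra. }
  unfold F in HF.
  assert (E1 : Re D = Re (g b) - Re (g a)) by reflexivity.
  assert (E2 : Im D = Im (g b) - Im (g a)) by reflexivity.
  assert (E3 : Re D * (Re (g b) - Re (g a)) + Im D * (Im (g b) - Im (g a)) = Cmod D ^ 2).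
  { rewrite <- E1, <- E2, Cmod2_alt. ring. }
  clearbody D. nra.
Qed.

Lemma Cexp_plus (z w : C) : Cexp (Cplus z w) = Cmult (Cexp z) (Cexp w).
Proof.
  destruct z as [a b], w as [c d]. unfold Cexp, Cplus, Cmult, RtoC, Re, Im; simpl.
  rewrite exp_plus, cos_plus, sin_plus. f_equal; ring.
Qed.

Lemma Cexp_0 : Cexp (RtoC 0) = RtoC 1.
Proof.
  unfold Cexp, Cmult, RtoC, Re, Im; simpl. rewrite exp_0, cos_0, sin_0. f_equal; ring.
Qed.

Lemma Cmod_Cexp (z : C) : Cmod (Cexp z) = exp (Re z).
Proof.
  unfold Cexp. rewrite Cmod_mult, Cmod_R, Rabs_right; [|left; apply exp_pos].
  assert (E : Cmod (cos (Im z), sin (Im z)) = 1).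
  { unfold Cmod. simpl.
    replace (cos (Im z) * (cos (Im z) * 1) + sin (Im z) * (sin (Im z) * 1)) with 1.
    - apply sqrt_1.
    - pose proof (sin2_cos2 (Im z)). unfold Rsqr in H. lra. }
  rewrite E. ring.
Qed.

Lemma Cexp_real (x : R) : Cexp (RtoC x) = RtoC (exp x).
Proof.
  unfold Cexp, Cmult, RtoC, Re, Im; simpl. rewrite cos_0, sin_0. f_equal; ring.
Qed.

Lemma Cexp_imag (t : R) : Cexp (Cmult Ci (RtoC t)) = (cos t, sin t).
Proof.
  unfold Cexp, Cmult, Ci, RtoC, Re, Im; simpl.
  replace (0 * t - 1 * 0) with 0 by ring. replace (0 * 0 + 1 * t) with t by ring.
  rewrite exp_0. f_equal; ring.
Qed.

Lemma Cexp_Cpow (z : C) (n : nat) : Cpow (Cexp z) n = Cexp (Cmult (RtoC (INR n)) z).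
Proof.
  induction n as [|n IH].
  - simpl. rewrite <- Cexp_0. f_equal. ring.
  - rewrite S_INR. simpl Cpow. rewrite IH, <- Cexp_plus. f_equal.
    rewrite RtoC_plus. ring.
Qed.

Lemma exp_minus_1_le (x : R) : exp x - 1 <= x * exp x.
Proof.
  pose proof (exp_ineq1_le (- x)) as H. pose proof (exp_pos x) as P.
  assert (E : exp x * exp (- x) = 1) by (rewrite <- exp_plus, Rplus_opp_r; apply exp_0).
  nra.
Qed.

Lemma exp_le (x y : R) : x <= y -> exp x <= exp y.
Proof. intros [H| ->]; [left; apply exp_increasing; exact H|lra]. Qed.

Lemma Cmod_Cexp_minus_1 (z : C) : Cmod (Cminus (Cexp z) (RtoC 1)) <= exp (Cmod z) - 1.
Proof.
  set (r := Cmod z).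
  pose proof (mean_value_C (fun x => Cexp (Cmult (RtoC x) z))
    (fun t => Cmult z (Cexp (Cmult (RtoC t) z)))
    (fun t => exp (t * r)) (fun t => r * exp (t * r)) 0 1 Rle_0_1) as H.
  cbv beta in H.
  rewrite !Rmult_0_l, !Rmult_1_l, exp_0, Cmult_0_l, Cmult_1_l, Cexp_0 in H.
  apply H. intros t Ht. split; [|split].
  - apply curve_derive_Cexp.
  - auto_derive; [trivial|ring].
  - rewrite Cmod_mult, Cmod_Cexp. fold r. apply Rmult_le_compat_l; [apply Cmod_ge_0|].
    apply exp_le. eapply Rle_trans; [apply re_le_Cmod'|].
    rewrite Cmod_mult, Cmod_R, Rabs_right by lra. apply Rle_refl.
Qed.

Lemma Cmod_Cexp_minus_1' (z : C) :
  Cmod (Cminus (Cexp z) (RtoC 1)) <= Cmod z * exp (Cmod z).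
Proof.
  eapply Rle_trans; [apply Cmod_Cexp_minus_1|apply exp_minus_1_le].
Qed.

Lemma Cmod_Cexp_taylor (z : C) :
  Cmod (Cminus (Cminus (Cexp z) (RtoC 1)) z) <= Cmod z ^ 2 * exp (Cmod z).
Proof.
  set (r := Cmod z).
  assert (Hr : 0 <= r) by apply Cmod_ge_0.
  pose proof (mean_value_C
    (fun x => Cplus (Cexp (Cmult (RtoC x) z)) (Cmult (Copp z) (RtoC x)))
    (fun t => Cmult z (Cminus (Cexp (Cmult (RtoC t) z)) (RtoC 1)))
    (fun t => exp (t * r) - t * r) (fun t => r * (exp (t * r) - 1)) 0 1 Rle_0_1) as H.
  cbv beta in H.
  rewrite !Rmult_0_l, !Rmult_1_l, exp_0, Cmult_0_l, Cmult_1_l, Cexp_0 in H.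
  replace (Cminus (Cminus (Cexp z) (RtoC 1)) z)
    with (Cminus (Cplus (Cexp z) (Cmult (Copp z) (RtoC 1)))
                 (Cplus (RtoC 1) (Cmult (Copp z) (RtoC 0)))) by ring.
  eapply Rle_trans; [apply H|].
  - intros t Ht.
    assert (G : is_curve_derive
      (fun x => Cplus (Cexp (Cmult (RtoC x) z)) (Cmult (Copp z) (RtoC x))) t
      (Cmult z (Cminus (Cexp (Cmult (RtoC t) z)) (RtoC 1)))).
    { eapply curve_derive_ext; [intros x; reflexivity| |apply curve_derive_plus;
        [apply curve_derive_Cexp|apply curve_derive_mult;
          [apply curve_derive_const|apply curve_derive_id]]].
      cbv beta. ring. }
    split; [exact G|]. split.
    + auto_derive; [trivial|ring].
    + rewrite Cmod_mult. fold r. apply Rmult_le_compat_l; [exact Hr|].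
      eapply Rle_trans; [apply Cmod_Cexp_minus_1|].
      rewrite Cmod_mult, Cmod_R, Rabs_right by lra. apply Rle_refl.
  - pose proof (exp_minus_1_le r). nra.
Qed.

Definition rpow_opp (n : nat) (x : R) : R := exp (- (x * ln (INR n))).

Lemma rpow_opp_pos (n : nat) (x : R) : 0 < rpow_opp n x.
Proof. apply exp_pos. Qed.

Lemma ln_INR_ge_0 (n : nat) : 0 <= ln (INR n).
Proof.
  destruct n as [|n].
  - simpl. unfold ln. destruct (Rlt_dec 0 0) as [h|h]; [exfalso; lra|apply Rle_refl].
  - rewrite <- ln_1. apply ln_le; [lra|]. rewrite S_INR. pose proof (pos_INR n). lra.
Qed.

Lemma ln_INR_le (n m : nat) : (1 <= n)%nat -> (n <= m)%nat -> ln (INR n) <= ln (INR m).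
Proof.
  intros H1 H2. apply ln_le; [apply lt_0_INR; lia|apply le_INR; lia].
Qed.

Lemma Cmod_npow_opp (n : nat) (s : C) : Cmod (npow_opp n s) = rpow_opp n (Re s).
Proof.
  unfold npow_opp, rpow_opp. rewrite Cmod_Cexp. f_equal.
  re_im_ring.
Qed.

Lemma npow_opp_real (n : nat) (x : R) : npow_opp n (RtoC x) = RtoC (rpow_opp n x).
Proof.
  unfold npow_opp, rpow_opp. rewrite <- RtoC_mult, <- RtoC_opp. apply Cexp_real.
Qed.

Lemma npow_opp_plus (n : nat) (s w : C) :
  npow_opp n (Cplus s w) = Cmult (npow_opp n s) (npow_opp n w).
Proof. unfold npow_opp. rewrite <- Cexp_plus. f_equal. ring. Qed.

Lemma npow_opp_mult (n m : nat) (s : C) : (1 <= n)%nat -> (1 <= m)%nat ->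
  npow_opp (n * m) s = Cmult (npow_opp n s) (npow_opp m s).
Proof.
  intros Hn Hm. unfold npow_opp. rewrite <- Cexp_plus. f_equal.
  rewrite mult_INR, ln_mult by (apply lt_0_INR; lia).
  rewrite RtoC_plus. ring.
Qed.

Lemma npow_opp_pow (n k : nat) (s : C) : (1 <= n)%nat ->
  npow_opp (n ^ k) s = npow_opp n (Cmult (RtoC (INR k)) s).
Proof.
  intros Hn. unfold npow_opp. f_equal.
  rewrite pow_INR, ln_pow by (apply lt_0_INR; lia).
  rewrite RtoC_mult. ring.
Qed.

Lemma npow_opp_1 (s : C) : npow_opp 1 s = RtoC 1.
Proof. unfold npow_opp. rewrite <- Cexp_0. f_equal. simpl INR. rewrite ln_1. ring. Qed.

Lemma npow_opp_0 (n : nat) : npow_opp n (RtoC 0) = RtoC 1.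
Proof. unfold npow_opp. rewrite <- Cexp_0. f_equal. ring. Qed.

Lemma rpow_opp_plus (n : nat) (x y : R) :
  rpow_opp n (x + y) = rpow_opp n x * rpow_opp n y.
Proof. unfold rpow_opp. rewrite <- exp_plus. f_equal. ring. Qed.

Lemma rpow_opp_0 (n : nat) : rpow_opp n 0 = 1.
Proof. unfold rpow_opp. rewrite <- exp_0. f_equal. ring. Qed.

Lemma rpow_opp_1 (x : R) : rpow_opp 1 x = 1.
Proof. unfold rpow_opp. simpl INR. rewrite ln_1, Rmult_0_r, Ropp_0. apply exp_0. Qed.

Lemma rpow_opp_le_1 (n : nat) (x : R) : 0 <= x -> rpow_opp n x <= 1.
Proof.
  intros Hx. unfold rpow_opp. rewrite <- exp_0. apply exp_le.
  pose proof (ln_INR_ge_0 n). nra.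
Qed.

Lemma rpow_opp_antitone (n : nat) (x y : R) : x <= y -> rpow_opp n y <= rpow_opp n x.
Proof. intros H. apply exp_le. pose proof (ln_INR_ge_0 n). nra. Qed.

Lemma rpow_opp_le_base (n m : nat) (x : R) : (1 <= n)%nat -> (n <= m)%nat -> 0 <= x ->
  rpow_opp m x <= rpow_opp n x.
Proof.
  intros H1 H2 Hx. apply exp_le. pose proof (ln_INR_le n m H1 H2). nra.
Qed.

Lemma ln_le_self (x : R) : 0 < x -> ln x <= x.
Proof.
  intros H. pose proof (exp_ineq1_le (ln x)). rewrite exp_ln in H0 by exact H. lra.
Qed.

Lemma rpow_opp_small (x K eta : R) : 0 < x -> 0 <= K -> 0 < eta ->
  exists N : nat, (1 <= N)%nat /\ forall n, (N <= n)%nat -> K * rpow_opp n x < eta.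
Proof.
  intros Hx HK He. set (e := eta / (K + 1)).
  assert (He0 : 0 < e) by (apply Rdiv_lt_0_compat; lra).
  destruct (INR_unbounded (exp (- ln e / x + 1))) as [N HN].
  assert (P := exp_pos (- ln e / x + 1)).
  exists N. split; [destruct N; [simpl in HN; lra|lia]|]. intros n Hn.
  assert (H : rpow_opp n x < e).
  { unfold rpow_opp. rewrite <- (exp_ln e) by exact He0. apply exp_increasing.
    assert (L : - ln e / x + 1 < ln (INR n)).
    { rewrite <- (ln_exp (- ln e / x + 1)).
      apply ln_increasing; [exact P|]. apply le_INR in Hn. lra. }
    apply Rmult_lt_compat_l with (r := x) in L; [|exact Hx].
    replace (x * (- ln e / x + 1)) with (- ln e + x) in L by (field; lra). lra. }
  apply Rlt_div_r in H; [|lra]. pose proof (rpow_opp_pos n x). nra.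
Qed.

Lemma pow_small (q K eta : R) : 0 < q -> q < 1 -> 0 <= K -> 0 < eta ->
  exists N : nat, forall n, (N <= n)%nat -> K * q ^ n < eta.
Proof.
  intros Hq Hq1 HK He.
  destruct (pow_lt_1_zero q ltac:(rewrite Rabs_right; lra) (eta / (K + 1))) as [N HN].
  { apply Rdiv_lt_0_compat; lra. }
  exists N. intros n Hn. specialize (HN n Hn). pose proof (pow_lt q n Hq).
  rewrite Rabs_right in HN by lra. apply Rlt_div_r in HN; [nra|lra].
Qed.

Lemma mult_exp_le (k u : R) : 0 < k -> u * exp (- (k * u)) <= / k.
Proof.
  intros Hk.
  pose proof (exp_ineq1_le (k * u)) as H. pose proof (exp_pos (- (k * u))) as P.
  assert (E : exp (k * u) * exp (- (k * u)) = 1) by (rewrite <- exp_plus, Rplus_opp_r; apply exp_0).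
  apply Rmult_le_reg_l with k; [exact Hk|]. rewrite Rinv_r by lra. nra.
Qed.

Lemma mult2_exp_le (k u : R) : 0 < k -> 0 <= u -> u ^ 2 * exp (- (k * u)) <= 4 / k ^ 2.
Proof.
  intros Hk Hu.
  pose proof (mult_exp_le (k / 2) u ltac:(lra)) as H.
  replace (exp (- (k * u))) with (exp (- (k / 2 * u)) * exp (- (k / 2 * u)))
    by (rewrite <- exp_plus; f_equal; field).
  pose proof (exp_pos (- (k / 2 * u))) as P.
  replace (4 / k ^ 2) with (/ (k / 2) * / (k / 2)) by (field; lra).
  replace (u ^ 2 * (exp (- (k / 2 * u)) * exp (- (k / 2 * u))))
    with ((u * exp (- (k / 2 * u))) * (u * exp (- (k / 2 * u)))) by ring.
  apply Rmult_le_compat; try assumption; nra.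
Qed.

(** * Abel summation *)

Local Notation dsum a s := (Csum (dirichlet_term a s)).

Lemma abel_sum (x v : nat -> C) (n : nat) :
  Csum (fun k => Cmult (x k) (v k)) n =
  Cplus (Cmult (Csum x n) (v n))
        (Csum (fun k => Cmult (Csum x (S k)) (Cminus (v k) (v (S k)))) n).
Proof.
  induction n as [|n IH]; [simpl; ring|].
  simpl Csum in *. rewrite IH. ring.
Qed.

Lemma abel_bound (x v : nat -> C) (z : nat -> R) (n : nat) :
  (forall k, (k < n)%nat ->
     Cmod (Csum x (S k)) * Cmod (Cminus (v k) (v (S k))) <= z k - z (S k)) ->
  Cmod (Csum x n) * Cmod (v n) <= z n ->
  Cmod (Csum (fun k => Cmult (x k) (v k)) n) <= z O.
Proof.
  intros H1 H2. rewrite abel_sum.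
  eapply Rle_trans; [apply Cmod_triangle|]. rewrite Cmod_mult.
  assert (H3 : Cmod (Csum (fun k => Cmult (Csum x (S k)) (Cminus (v k) (v (S k)))) n)
               <= Rsum (fun k => z k - z (S k)) n).
  { eapply Rle_trans; [apply Cmod_Csum|]. apply Rsum_le. intros k Hk.
    rewrite Cmod_mult. apply H1. exact Hk. }
  rewrite Rsum_telescope in H3. lra.
Qed.

Lemma abel_curve (g gd : R -> C) (K kappa : R) (x : nat -> C) (A : R) (p : nat) :
  0 < kappa ->
  (forall u, 0 <= u -> is_curve_derive g u (gd u) /\
     Cmod (gd u) <= K * (kappa * exp (- (kappa * u))) /\
     Cmod (g u) <= K * exp (- (kappa * u))) ->
  (forall n, (p <= n)%nat -> Cmod (Cminus (Csum x n) (Csum x p)) <= A) ->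
  forall n, (p <= n)%nat ->
  Cmod (Cminus (Csum (fun k => Cmult (x k) (g (ln (INR (S k))))) n)
               (Csum (fun k => Cmult (x k) (g (ln (INR (S k))))) p))
    <= A * K * rpow_opp (S p) kappa.
Proof.
  intros Hk Hg Hx n Hn. replace n with (p + (n - p))%nat by lia.
  set (q := (n - p)%nat). rewrite <- Csum_shift.
  assert (HA : 0 <= A).
  { eapply Rle_trans; [apply Cmod_ge_0|apply (Hx p); lia]. }
  assert (Hu : forall k, 0 <= ln (INR (S k))) by (intros; apply ln_INR_ge_0).
  assert (HR : forall m, rpow_opp m kappa = exp (- (kappa * ln (INR m)))) by reflexivity.
  pose proof (abel_bound (fun k => x (p + k)%nat) (fun k => g (ln (INR (S (p + k)))))
    (fun k => A * K * rpow_opp (S (p + k)) kappa) q) as H.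
  cbv beta in H. rewrite Nat.add_0_r in H. apply H; clear H.
  - intros k _. rewrite (Csum_shift x).
    replace (A * K * rpow_opp (S (p + k)) kappa - A * K * rpow_opp (S (p + S k)) kappa)
      with (A * (K * rpow_opp (S (p + k)) kappa - K * rpow_opp (S (p + S k)) kappa)) by ring.
    apply Rmult_le_compat; try apply Cmod_ge_0; [apply Hx; lia|].
    rewrite Cmod_minus_sym.
    set (a := ln (INR (S (p + k)))). set (b := ln (INR (S (p + S k)))).
    pose proof (mean_value_C g gd (fun u => - K * exp (- (kappa * u)))
      (fun u => K * (kappa * exp (- (kappa * u)))) a b) as M.
    assert (Hab : a <= b) by (apply ln_INR_le; lia).
    specialize (M Hab). cbv beta in M.
    rewrite !HR. fold a b.
    eapply Rle_trans; [apply M|lra].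
    intros t Ht. assert (Ht0 : 0 <= t) by (specialize (Hu (p + k)%nat); fold a in Hu; lra).
    destruct (Hg t Ht0) as [G1 [G2 G3]]. split; [exact G1|]. split; [|exact G2].
    auto_derive; [trivial|ring].
  - rewrite (Csum_shift x), Rmult_assoc.
    apply Rmult_le_compat; try apply Cmod_ge_0; [apply Hx; lia|].
    destruct (Hg _ (Hu (p + q)%nat)) as [_ [_ G3]].
    rewrite HR. exact G3.
Qed.

Lemma is_series_Csum (a : nat -> C) (f : C -> C) (s : C) :
  dirichlet_rep a f -> half_plane 0 s -> Ccv (dsum a s) (f s).
Proof. intros H Hs. apply is_series_C. apply H. exact Hs. Qed.

Lemma dirichlet_term_plus (a : nat -> C) (s w : C) (k : nat) :
  dirichlet_term a (Cplus s w) k =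
  Cmult (dirichlet_term a s k) (Cexp (Cmult (RtoC (ln (INR (S k)))) (Copp w))).
Proof.
  unfold dirichlet_term. rewrite npow_opp_plus. unfold npow_opp at 2.
  replace (Copp (Cmult w (RtoC (ln (INR (S k))))))
    with (Cmult (RtoC (ln (INR (S k)))) (Copp w)) by ring.
  ring.
Qed.

Lemma Cmod_Cexp_scaled (t : R) (w : C) :
  Cmod (Cexp (Cmult (RtoC t) (Copp w))) = exp (- (Re w * t)).
Proof.
  rewrite Cmod_Cexp. f_equal. re_im_ring.
Qed.

Lemma osc_of_bound (x : nat -> C) (A : R) (p : nat) :
  (forall n, Cmod (Csum x n) <= A) ->
  forall n, (p <= n)%nat -> Cmod (Cminus (Csum x n) (Csum x p)) <= 2 * A.
Proof.
  intros H n _. eapply Rle_trans; [apply Cmod_minus_le|].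
  pose proof (H n). pose proof (H p). lra.
Qed.

(* The growth in [Cmod s] is harmless: in Bohr's theorem it is killed by an
   averaging kernel, while [f] itself is bounded there. *)
Lemma dirichlet_tail (a : nat -> C) (f : C -> C) (theta : R) :
  dirichlet_rep a f -> 0 < theta ->
  exists B : R, 0 <= B /\ forall (s : C) (p : nat), theta <= Re s ->
    Cmod (Cminus (f s) (dsum a s p))
      <= B * (Cmod s + theta) * rpow_opp (S p) (theta / 2).
Proof.
  intros Ha Ht.
  set (d := theta / 2). assert (Hd : 0 < d) by (unfold d; lra).
  assert (Hs0 : half_plane 0 (RtoC d)) by exact Hd.
  destruct (Ccv_bounded _ _ (is_series_Csum a f (RtoC d) Ha Hs0)) as [A HA].
  assert (HA0 : 0 <= A) by (eapply Rle_trans; [apply Cmod_ge_0|apply (HA O)]).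
  exists (2 * A / d). split; [apply Rmult_le_pos; [lra|left; apply Rinv_0_lt_compat; exact Hd]|].
  intros s p Hs.
  set (w := Cminus s (RtoC d)).
  assert (Hw : d <= Re w).
  { change (d <= Re s - d). unfold d in *. lra. }
  assert (Hwm : d <= Cmod w) by (eapply Rle_trans; [exact Hw|apply re_le_Cmod']).
  assert (Es : s = Cplus (RtoC d) w) by (unfold w; ring).
  assert (Hs' : half_plane 0 s) by (unfold half_plane; lra).
  assert (HT : forall n, (p <= n)%nat ->
    Cmod (Cminus (dsum a s n) (dsum a s p))
      <= 2 * A * (Cmod w / d) * rpow_opp (S p) d).
  { intros n Hn.
    rewrite !(Csum_ext (dirichlet_term a s) (fun k => Cmult (dirichlet_term a (RtoC d) k)
       (Cexp (Cmult (RtoC (ln (INR (S k)))) (Copp w)))))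
      by (intros; rewrite Es; apply dirichlet_term_plus).
    apply (abel_curve (fun u => Cexp (Cmult (RtoC u) (Copp w)))
      (fun u => Cmult (Copp w) (Cexp (Cmult (RtoC u) (Copp w)))) (Cmod w / d) d);
      [exact Hd| |apply osc_of_bound; exact HA|exact Hn].
    intros u Hu.
    assert (HE : exp (- (Re w * u)) <= exp (- (d * u))) by (apply exp_le; nra).
    pose proof (exp_pos (- (d * u))) as HP.
    split; [apply curve_derive_Cexp|split].
    - rewrite Cmod_mult, Cmod_opp, Cmod_Cexp_scaled.
      replace (Cmod w / d * (d * exp (- (d * u)))) with (Cmod w * exp (- (d * u))) by (field; lra).
      apply Rmult_le_compat_l; [apply Cmod_ge_0|exact HE].
    - rewrite Cmod_Cexp_scaled.
      assert (1 <= Cmod w / d).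
      { apply Rle_div_r; lra. }
      nra. }
  assert (HL : Cmod (Cminus (f s) (dsum a s p))
      <= 2 * A * (Cmod w / d) * rpow_opp (S p) d).
  { apply (Ccv_dist_le (dsum a s) _ _ _ p); [apply is_series_Csum; assumption|exact HT]. }
  eapply Rle_trans; [exact HL|].
  apply Rmult_le_compat_r; [left; apply rpow_opp_pos|].
  replace (2 * A * (Cmod w / d)) with (2 * A / d * Cmod w) by (field; lra).
  apply Rmult_le_compat_l.
  { apply Rmult_le_pos; [lra|left; apply Rinv_0_lt_compat; exact Hd]. }
  unfold w. eapply Rle_trans; [apply Cmod_minus_le|].
  rewrite Cmod_R, Rabs_right by lra. unfold d. lra.
Qed.

Lemma dirichlet_rep_holomorphic (a : nat -> C) (f : C -> C) :
  dirichlet_rep a f -> holomorphic_C0 f.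
Proof.
  intros Ha s Hs. unfold half_plane in Hs.
  set (d := Re s / 2). assert (Hd : 0 < d) by (unfold d; lra).
  set (w := Cminus s (RtoC d)).
  assert (Hw : Re w = d) by (change (Re s - d = d); unfold d; lra).
  assert (Es : s = Cplus (RtoC d) w) by (unfold w; ring).
  destruct (Ccv_bounded _ _ (is_series_Csum a f (RtoC d) Ha Hd)) as [A HA].
  assert (HA0 : 0 <= A) by (eapply Rle_trans; [apply Cmod_ge_0|apply (HA O)]).
  set (x := dirichlet_term a (RtoC d)).
  pose proof (Cmod_ge_0 w) as Hw0.
  set (lu := fun k => ln (INR (S k))).
  assert (HE : forall u, exp (- (d * u)) = exp (- (d / 2 * u)) * exp (- (d / 2 * u))).
  { intros u. rewrite <- exp_plus. f_equal. field. }
  assert (HE2 : forall u, exp (- (d / 2 * u)) = exp (- (d / 4 * u)) * exp (- (d / 4 * u))).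
  { intros u. rewrite <- exp_plus. f_equal. field. }
  set (g1 := fun u => Cmult (Copp (RtoC u)) (Cexp (Cmult (RtoC u) (Copp w)))).
  set (l_ := fun n => Csum (fun k => Cmult (x k) (g1 (lu k))) n).
  assert (Hl : exists l, Ccv l_ l).
  { set (K := (1 + Cmod w * / (d / 2)) / (d / 2) + / (d / 2)).
    assert (Hi : 0 < / (d / 2)) by (apply Rinv_0_lt_compat; lra).
    apply Ccv_Cauchy. intros eta He.
    assert (HK : 0 < K).
    { unfold K, Rdiv at 1. assert (0 <= Cmod w * / (d / 2)) by nra. nra. }
    destruct (rpow_opp_small (d / 2) (2 * A * K) eta ltac:(lra) ltac:(nra) He) as [N [_ HN]].
    exists N. intros n m Hn Hm.
    eapply Rle_lt_trans; [apply (abel_curve g1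
      (fun u => Cmult (Cminus (Cmult (RtoC u) w) (RtoC 1)) (Cexp (Cmult (RtoC u) (Copp w))))
      K (d / 2) x (2 * A) n ltac:(lra)); [|apply osc_of_bound; exact HA|exact Hm]|].
    - intros u Hu. split; [|split].
      + unfold g1. eapply curve_derive_ext; [intros; reflexivity| |apply curve_derive_mult;
          [|apply curve_derive_Cexp]].
        2: { eapply curve_derive_ext; [| |apply curve_derive_mult;
               [apply (curve_derive_const (Copp (RtoC 1)))|apply curve_derive_id]].
             - intros. cbv beta. ring.
             - reflexivity. }
        cbv beta. ring.
      + rewrite Cmod_mult, Cmod_Cexp_scaled, Hw, HE.
        pose proof (exp_pos (- (d / 2 * u))) as HP.
        pose proof (mult_exp_le (d / 2) u ltac:(lra)) as HM.
        assert (HT : Cmod (Cminus (Cmult (RtoC u) w) (RtoC 1)) <= u * Cmod w + 1).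
        { eapply Rle_trans; [apply Cmod_minus_le|].
          rewrite Cmod_mult, Cmod_1, Cmod_R, Rabs_right by lra. lra. }
        assert (HT2 : (u * Cmod w + 1) * exp (- (d / 2 * u)) <= Cmod w * / (d / 2) + 1).
        { assert (exp (- (d / 2 * u)) <= 1) by (rewrite <- exp_0; apply exp_le; nra). nra. }
        assert (HK2 : Cmod w * / (d / 2) + 1 <= K * (d / 2)).
        { unfold K. replace (((1 + Cmod w * / (d / 2)) / (d / 2) + / (d / 2)) * (d / 2))
            with (2 + Cmod w * / (d / 2)) by (field; lra). lra. }
        rewrite <- !Rmult_assoc. apply Rmult_le_compat_r; [lra|].
        eapply Rle_trans; [apply Rmult_le_compat_r; [lra|exact HT]|]. lra.
      + unfold g1. rewrite Cmod_mult, Cmod_opp, Cmod_R, Rabs_right by lra.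
        rewrite Cmod_Cexp_scaled, Hw, HE, <- Rmult_assoc.
        apply Rmult_le_compat_r; [left; apply exp_pos|].
        eapply Rle_trans; [apply mult_exp_le; lra|]. unfold K.
        assert (0 <= (1 + Cmod w * / (d / 2)) / (d / 2)).
        { apply Rmult_le_pos; nra. } lra.
    - apply HN. lia. }
  destruct Hl as [l Hl].
  apply ex_derive_C_intro with l. intros eta He.
  set (K := (8 / (d / 4)) * (Cmod w * (4 / (d / 4) ^ 2) + / (d / 4)) + 4 / (d / 4) ^ 2).
  assert (HK : 0 < K).
  { assert (0 < / (d / 4)) by (apply Rinv_0_lt_compat; lra).
    assert (0 < 4 / (d / 4) ^ 2).
    { apply Rdiv_lt_0_compat; [lra|]. apply pow_lt. lra. }
    assert (0 < 8 / (d / 4)) by (apply Rdiv_lt_0_compat; lra).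
    unfold K. assert (0 <= Cmod w * (4 / (d / 4) ^ 2)) by nra. nra. }
  exists (Rmin (d / 2) (eta / (2 * A * K + 1))). split.
  { apply Rmin_pos; [lra|]. apply Rdiv_lt_0_compat; [exact He|nra]. }
  intros h Hh.
  assert (Hh1 : Cmod h < d / 2) by (eapply Rlt_le_trans; [exact Hh|apply Rmin_l]).
  assert (Hh2 : Cmod h < eta / (2 * A * K + 1)) by (eapply Rlt_le_trans; [exact Hh|apply Rmin_r]).
  pose proof (Cmod_ge_0 h) as Hh0.
  set (E := fun u => Cminus (Cminus (Cexp (Cmult (RtoC u) (Copp h))) (RtoC 1))
                            (Cmult (RtoC u) (Copp h))).
  set (g := fun u => Cmult (Cexp (Cmult (RtoC u) (Copp w))) (E u)).
  assert (HB : forall n, Cmod (Csum (fun k => Cmult (x k) (g (lu k))) n)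
      <= 2 * A * (Cmod h ^ 2 * K)).
  { intros n.
    set (gd := fun u => Cmult (Cexp (Cmult (RtoC u) (Copp w)))
       (Cplus (Cmult (Copp w) (E u))
          (Cmult (Copp h) (Cminus (Cexp (Cmult (RtoC u) (Copp h))) (RtoC 1))))).
    assert (HC : forall u, 0 <= u -> is_curve_derive g u (gd u) /\
       Cmod (gd u) <= Cmod h ^ 2 * K * (d / 4 * exp (- (d / 4 * u))) /\
       Cmod (g u) <= Cmod h ^ 2 * K * exp (- (d / 4 * u))).
    { intros u Hu.
      assert (Hm : Cmod (Cmult (RtoC u) (Copp h)) = u * Cmod h).
      { rewrite Cmod_mult, Cmod_opp, Cmod_R, Rabs_right by lra. reflexivity. }
      assert (Hex : exp (u * Cmod h) * exp (- (d * u)) <= exp (- (d / 2 * u))).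
      { rewrite <- exp_plus. apply exp_le. nra. }
      assert (HEu : Cmod (E u) <= u ^ 2 * Cmod h ^ 2 * exp (u * Cmod h)).
      { unfold E. eapply Rle_trans; [apply Cmod_Cexp_taylor|]. rewrite Hm. apply Req_le. ring. }
      assert (HFu : Cmod (Cminus (Cexp (Cmult (RtoC u) (Copp h))) (RtoC 1))
                    <= u * Cmod h * exp (u * Cmod h)).
      { eapply Rle_trans; [apply Cmod_Cexp_minus_1'|]. rewrite Hm. lra. }
      pose proof (exp_pos (- (d * u))) as P1.
      pose proof (exp_pos (- (d / 4 * u))) as P4.
      pose proof (exp_pos (u * Cmod h)) as P0.
      pose proof (mult_exp_le (d / 4) u ltac:(lra)) as M1.
      pose proof (mult2_exp_le (d / 4) u ltac:(lra) Hu) as M2.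
      rewrite HE2 in Hex. set (e4 := exp (- (d / 4 * u))) in *.
      assert (Hq : 0 <= Cmod h ^ 2) by (apply pow_le; exact Hh0).
      assert (Hp4 : 0 < / (d / 4)) by (apply Rinv_0_lt_compat; lra).
      assert (Hp42 : 0 < 4 / (d / 4) ^ 2).
      { apply Rdiv_lt_0_compat; [lra|]. apply pow_lt. lra. }
      split; [|split].
      - unfold g, gd. eapply curve_derive_ext; [intros; reflexivity| |apply curve_derive_mult;
          [apply curve_derive_Cexp|]].
        2: { unfold E. eapply curve_derive_ext; [| |
               apply (curve_derive_plus (fun u => Cexp (Cmult (RtoC u) (Copp h)))
                 (fun u => Cplus (Cmult h (RtoC u)) (Copp (RtoC 1))));
               [apply (curve_derive_Cexp (Copp h))|apply curve_derive_plus;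
                [apply curve_derive_mult; [apply (curve_derive_const h)|apply curve_derive_id]|
                 apply (curve_derive_const (Copp (RtoC 1)))]]].
             - intros t. cbv beta. ring.
             - reflexivity. }
        cbv beta. ring.
      - unfold gd. rewrite Cmod_mult, Cmod_Cexp_scaled, Hw.
        assert (T : Cmod (Cplus (Cmult (Copp w) (E u))
          (Cmult (Copp h) (Cminus (Cexp (Cmult (RtoC u) (Copp h))) (RtoC 1))))
          <= Cmod h ^ 2 * (Cmod w * u ^ 2 + u) * exp (u * Cmod h)).
        { eapply Rle_trans; [apply Cmod_triangle|]. rewrite !Cmod_mult, !Cmod_opp.
          apply Rle_trans with (Cmod w * (u ^ 2 * Cmod h ^ 2 * exp (u * Cmod h)) +
            Cmod h * (u * Cmod h * exp (u * Cmod h))).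
          - apply Rplus_le_compat; apply Rmult_le_compat_l; assumption.
          - apply Req_le. ring. }
        apply Rle_trans with (exp (- (d * u)) *
          (Cmod h ^ 2 * (Cmod w * u ^ 2 + u) * exp (u * Cmod h)));
          [apply Rmult_le_compat_l; [lra|exact T]|].
        replace (exp (- (d * u)) * (Cmod h ^ 2 * (Cmod w * u ^ 2 + u) * exp (u * Cmod h)))
          with (Cmod h ^ 2 * ((Cmod w * u ^ 2 + u) * (exp (u * Cmod h) * exp (- (d * u))))) by ring.
        replace (Cmod h ^ 2 * K * (d / 4 * e4)) with (Cmod h ^ 2 * ((K * (d / 4)) * e4)) by ring.
        apply Rmult_le_compat_l; [exact Hq|].
        assert (0 <= Cmod w * u ^ 2 + u) by nra.
        apply Rle_trans with ((Cmod w * u ^ 2 + u) * (e4 * e4));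
          [apply Rmult_le_compat_l; assumption|].
        rewrite <- Rmult_assoc. apply Rmult_le_compat_r; [lra|].
        assert (T1 : (Cmod w * u ^ 2 + u) * e4 <= Cmod w * (4 / (d / 4) ^ 2) + / (d / 4)).
        { replace ((Cmod w * u ^ 2 + u) * e4) with (Cmod w * (u ^ 2 * e4) + u * e4) by ring.
          apply Rplus_le_compat; [apply Rmult_le_compat_l|]; assumption. }
        eapply Rle_trans; [exact T1|]. unfold K.
        replace ((8 / (d / 4) * (Cmod w * (4 / (d / 4) ^ 2) + / (d / 4)) + 4 / (d / 4) ^ 2) * (d / 4))
          with (8 * (Cmod w * (4 / (d / 4) ^ 2) + / (d / 4)) + 4 / (d / 4) ^ 2 * (d / 4))
          by (field; lra).
        assert (0 <= Cmod w * (4 / (d / 4) ^ 2)) by nra.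
        assert (0 <= 4 / (d / 4) ^ 2 * (d / 4)) by nra. lra.
      - unfold g. rewrite Cmod_mult, Cmod_Cexp_scaled, Hw.
        apply Rle_trans with (exp (- (d * u)) * (u ^ 2 * Cmod h ^ 2 * exp (u * Cmod h)));
          [apply Rmult_le_compat_l; [lra|exact HEu]|].
        replace (exp (- (d * u)) * (u ^ 2 * Cmod h ^ 2 * exp (u * Cmod h)))
          with (Cmod h ^ 2 * (u ^ 2 * (exp (u * Cmod h) * exp (- (d * u))))) by ring.
        rewrite (Rmult_assoc (Cmod h ^ 2) K).
        apply Rmult_le_compat_l; [exact Hq|].
        assert (Hu2 : 0 <= u ^ 2) by (apply pow_le; exact Hu).
        apply Rle_trans with (u ^ 2 * (e4 * e4)); [apply Rmult_le_compat_l; assumption|].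
        rewrite <- Rmult_assoc. apply Rmult_le_compat_r; [lra|].
        eapply Rle_trans; [exact M2|]. unfold K.
        assert (0 <= 8 / (d / 4) * (Cmod w * (4 / (d / 4) ^ 2) + / (d / 4))).
        { apply Rmult_le_pos; [apply Rmult_le_pos; lra|]. nra. }
        lra. }
    pose proof (abel_curve g gd (Cmod h ^ 2 * K) (d / 4) x (2 * A) O ltac:(lra) HC
      (osc_of_bound x A O HA) n ltac:(lia)) as HT.
    replace (Csum (fun k : nat => (x k * g (lu k))%C) n) with
      (Cminus (Csum (fun k : nat => (x k * g (lu k))%C) n)
              (Csum (fun k : nat => (x k * g (lu k))%C) 0)) by (simpl; ring).
    unfold lu at 1 2. eapply Rle_trans; [exact HT|].
    rewrite rpow_opp_1. lra. }
  assert (Hsh : half_plane 0 (Cplus s h)).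
  { unfold half_plane. change (0 < Re s + Re h). pose proof (re_ge_Cmod h). unfold d in *. lra. }
  assert (HLIM : Ccv (fun n => Csum (fun k => Cmult (x k) (g (lu k))) n)
     (Cminus (Cminus (f (Cplus s h)) (f s)) (Cmult l h))).
  { apply Ccv_ext with (fun n => Cplus (Cplus (dsum a (Cplus s h) n)
       (Cmult (Copp (RtoC 1)) (dsum a s n))) (Cmult (Copp h) (l_ n))).
    - intros n. unfold l_. rewrite <- !Csum_scal, <- !Csum_plus. apply Csum_ext. intros k _.
      rewrite (dirichlet_term_plus a s h).
      rewrite Es at 1 2. rewrite !(dirichlet_term_plus a (RtoC d) w). fold x (lu k).
      unfold g, g1, E. ring.
    - replace (Cminus (Cminus (f (Cplus s h)) (f s)) (Cmult l h))
        with (Cplus (Cplus (f (Cplus s h)) (Cmult (Copp (RtoC 1)) (f s))) (Cmult (Copp h) l))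
        by ring.
      apply Ccv_plus; [apply Ccv_plus|].
      + apply is_series_Csum; assumption.
      + apply Ccv_scal. apply is_series_Csum; assumption.
      + apply Ccv_scal. exact Hl. }
  eapply Rle_trans; [apply (Ccv_bound _ _ _ O HLIM); intros n _; apply HB|].
  apply Rlt_div_r in Hh2; [|nra]. nra.
Qed.

(** * An averaging kernel with trapezoidal cosine transform *)

Lemma abs_sin_le (x : R) : Rabs (sin x) <= Rabs x.
Proof.
  assert (H : forall y, 0 <= y -> Rabs (sin y) <= y).
  { intros y [Hy| <-]; [|rewrite sin_0, Rabs_R0; lra].
    pose proof (SIN_bound y) as [B1 B2].
    apply Rabs_le. split; [|left; apply sin_lt_x; exact Hy].
    destruct (Rle_lt_dec y PI) as [h|h].
    - pose proof (sin_ge_0 y ltac:(lra) h). lra.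
    - pose proof PI2_1. lra. }
  destruct (Rle_lt_dec 0 x) as [h|h].
  - rewrite (Rabs_right x) by lra. apply H. exact h.
  - rewrite (Rabs_left x) by lra. rewrite <- (Rabs_Ropp (sin x)), <- sin_neg. apply H. lra.
Qed.

Lemma abs_cos_minus (p q : R) : Rabs (cos p - cos q) <= Rabs (p - q) * Rabs (p + q) / 2.
Proof.
  rewrite form2, !Rabs_mult.
  pose proof (abs_sin_le ((p - q) / 2)) as H1. pose proof (abs_sin_le ((p + q) / 2)) as H2.
  unfold Rdiv in H1, H2. rewrite Rabs_mult in H1, H2.
  rewrite (Rabs_right (/ 2)) in H1, H2 by lra.
  replace (Rabs (-2)) with 2 by (rewrite Rabs_left; lra).
  pose proof (Rabs_pos (sin ((p - q) / 2))). pose proof (Rabs_pos (sin ((p + q) / 2))).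
  unfold Rdiv in *.
  apply Rle_trans with (2 * (Rabs (p - q) * / 2) * (Rabs (p + q) * / 2)); [|lra].
  apply Rmult_le_compat; try lra.
Qed.

Lemma abs_cos_minus' (p q : R) : Rabs (cos p - cos q) <= Rabs (p - q).
Proof.
  rewrite form2, !Rabs_mult.
  pose proof (abs_sin_le ((p - q) / 2)) as H1.
  unfold Rdiv in H1 at 2. rewrite Rabs_mult in H1.
  rewrite (Rabs_right (/ 2)) in H1 by lra.
  replace (Rabs (-2)) with 2 by (rewrite Rabs_left; lra).
  assert (H2 : Rabs (sin ((p + q) / 2)) <= 1).
  { apply Rabs_le. apply SIN_bound. }
  pose proof (Rabs_pos (sin ((p - q) / 2))). pose proof (Rabs_pos (sin ((p + q) / 2))). nra.
Qed.

Lemma abs_cos_minus_2 (p q : R) : Rabs (cos p - cos q) <= 2.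
Proof.
  pose proof (COS_bound p). pose proof (COS_bound q). apply Rabs_le. lra.
Qed.

Lemma continuous_of_ex_derive (f : R -> R) (x : R) : ex_derive f x -> continuous f x.
Proof. exact (ex_derive_continuous (K := R_AbsRing) (V := R_NormedModule) f x). Qed.

Lemma ex_RInt_pos (f : R -> R) (a b : R) : 0 < a -> 0 < b ->
  (forall t, 0 < t -> continuous f t) -> ex_RInt f a b.
Proof.
  intros Ha Hb H. apply (ex_RInt_continuous (V := R_CompleteNormedModule)).
  intros z [Hz _]. apply H. eapply Rlt_le_trans; [|exact Hz].
  apply Rmin_pos; assumption.
Qed.

Lemma RInt_split (f : R -> R) (a b c : R) : 0 < a -> 0 < b -> 0 < c ->
  (forall t, 0 < t -> continuous f t) -> RInt f a c = RInt f a b + RInt f b c.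
Proof.
  intros Ha Hb Hc H. symmetry.
  exact (RInt_Chasles (V := R_CompleteNormedModule) f a b c
    (ex_RInt_pos f a b Ha Hb H) (ex_RInt_pos f b c Hb Hc H)).
Qed.

Lemma abs_RInt_dominated (f h : R -> R) (a b I : R) :
  0 < a -> a <= b -> (forall t, 0 < t -> continuous f t) ->
  (forall t, a <= t <= b -> Rabs (f t) <= h t) -> is_RInt h a b I ->
  Rabs (RInt f a b) <= I.
Proof.
  intros Ha Hab Hc Hd HI.
  apply (norm_RInt_le (V := R_NormedModule) f h a b (RInt f a b) I Hab Hd); [|exact HI].
  apply (RInt_correct (V := R_CompleteNormedModule)). apply ex_RInt_pos; [lra|lra|exact Hc].
Qed.

Lemma is_RInt_const_R (M a b : R) : is_RInt (fun _ => M) a b ((b - a) * M).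
Proof. exact (is_RInt_const (V := R_NormedModule) a b M). Qed.

Lemma is_RInt_inv (M a b : R) : 0 < a -> a <= b ->
  is_RInt (fun t => M / t) a b (M * ln b - M * ln a).
Proof.
  intros Ha Hab.
  apply (is_RInt_derive (V := R_CompleteNormedModule) (fun t => M * ln t) (fun t => M / t));
    rewrite Rmin_left, Rmax_right by lra; intros x Hx.
  - auto_derive; [lra|]. field. lra.
  - apply continuous_of_ex_derive. auto_derive. lra.
Qed.

Lemma is_RInt_inv2 (M a b : R) : 0 < a -> a <= b ->
  is_RInt (fun t => M / t ^ 2) a b (M / a - M / b).
Proof.
  intros Ha Hab.
  replace (M / a - M / b) with (- M / b - (- M / a)) by (field; lra).
  apply (is_RInt_derive (V := R_CompleteNormedModule) (fun t => - M / t) (fun t => M / t ^ 2));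
    rewrite Rmin_left, Rmax_right by lra; intros x Hx.
  - auto_derive; [lra|]. field. lra.
  - apply continuous_of_ex_derive. auto_derive. nra.
Qed.

Definition fejer (v : R) : R := (1 - cos v) / v ^ 2.

Lemma continuous_fejer (v : R) : 0 < v -> continuous fejer v.
Proof.
  intros H. apply continuous_of_ex_derive. unfold fejer. auto_derive. nra.
Qed.

Lemma fejer_ge_0 (v : R) : 0 < v -> 0 <= fejer v.
Proof.
  intros H. pose proof (COS_bound v). unfold fejer. apply Rmult_le_pos; [lra|].
  left. apply Rinv_0_lt_compat. nra.
Qed.

Lemma fejer_le_half (v : R) : 0 < v -> fejer v <= / 2.
Proof.
  intros H. pose proof (abs_cos_minus 0 v) as K. rewrite cos_0 in K.
  replace (0 - v) with (- v) in K by ring. replace (0 + v) with v in K by ring.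
  rewrite Rabs_Ropp, (Rabs_right v) in K by lra.
  pose proof (Rle_abs (1 - cos v)).
  unfold fejer. apply Rle_div_l; nra.
Qed.

Lemma fejer_le_inv2 (v : R) : 0 < v -> fejer v <= 2 / v ^ 2.
Proof.
  intros H. pose proof (COS_bound v). unfold fejer. apply Rmult_le_compat_r; [|lra].
  left. apply Rinv_0_lt_compat. nra.
Qed.

Lemma RInt_fejer_le (u v : R) : 0 < u -> u <= v ->
  0 <= RInt fejer u v /\ RInt fejer u v <= v / 2 /\ RInt fejer u v <= 2 / u.
Proof.
  intros Hu Huv.
  assert (Hv : 0 < 2 / v) by (apply Rdiv_lt_0_compat; lra).
  split; [|split].
  - apply RInt_ge_0; [exact Huv|apply ex_RInt_pos; [lra|lra|exact continuous_fejer]|].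
    intros x Hx. apply fejer_ge_0. lra.
  - eapply Rle_trans; [apply Rle_abs|].
    eapply Rle_trans; [apply (abs_RInt_dominated fejer (fun _ => / 2) u v ((v - u) * / 2));
      [exact Hu|exact Huv|exact continuous_fejer| |apply is_RInt_const_R]|lra].
    intros t Ht. rewrite Rabs_right; [apply fejer_le_half; lra|].
    apply Rle_ge, fejer_ge_0. lra.
  - eapply Rle_trans; [apply Rle_abs|].
    eapply Rle_trans; [apply (abs_RInt_dominated fejer (fun t => 2 / t ^ 2) u v (2 / u - 2 / v));
      [exact Hu|exact Huv|exact continuous_fejer| |apply is_RInt_inv2; assumption]|lra].
    intros t Ht. rewrite Rabs_right; [apply fejer_le_inv2; lra|].
    apply Rle_ge, fejer_ge_0. lra.
Qed.

Lemma RInt_fejer_mono (u v u' v' : R) : 0 < u' -> u' <= u -> u <= v -> v <= v' ->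
  RInt fejer u v <= RInt fejer u' v' <= RInt fejer u v + u / 2 + 2 / v.
Proof.
  intros H1 H2 H3 H4.
  rewrite (RInt_split fejer u' u v') by (try exact continuous_fejer; lra).
  rewrite (RInt_split fejer u v v') by (try exact continuous_fejer; lra).
  pose proof (RInt_fejer_le u' u H1 H2). pose proof (RInt_fejer_le v v' ltac:(lra) H4). lra.
Qed.

(* The value of [c] is pi/2; only its positivity matters. *)
Lemma fejer_integral : exists c : R, 0 < c /\
  forall u v, 0 < u -> u <= v -> Rabs (RInt fejer u v - c) <= u / 2 + 2 / v.
Proof.
  set (E := fun x => exists u v, 0 < u /\ u <= v /\ x = RInt fejer u v).
  assert (HB : forall u v u1 v1, 0 < u -> u <= v -> 0 < u1 -> u1 <= v1 ->
     RInt fejer u1 v1 <= RInt fejer u v + u / 2 + 2 / v).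
  { intros u v u1 v1 Hu Huv Hu1 Huv1.
    assert (P1 : 0 < Rmin u u1) by (apply Rmin_pos; assumption).
    pose proof (Rmin_l u u1). pose proof (Rmin_r u u1).
    pose proof (Rmax_l v v1). pose proof (Rmax_r v v1).
    pose proof (RInt_fejer_mono u v (Rmin u u1) (Rmax v v1) P1 H Huv H1).
    pose proof (RInt_fejer_mono u1 v1 (Rmin u u1) (Rmax v v1) P1 H0 Huv1 H2). lra. }
  destruct (completeness E) as [c [Hc1 Hc2]].
  - exists (RInt fejer 1 1 + 1 / 2 + 2 / 1). intros x [u [v [Hu [Huv ->]]]].
    apply HB; lra.
  - exists (RInt fejer 1 1), 1, 1. repeat split; lra.
  - assert (HU : forall u v, 0 < u -> u <= v -> RInt fejer u v <= c).
    { intros u v Hu Huv. apply Hc1. exists u, v. auto. }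
    exists c. split.
    + apply Rlt_le_trans with (RInt fejer 1 2); [|apply HU; lra].
      apply RInt_gt_0; [lra| |].
      * intros x Hx. unfold fejer. apply Rdiv_lt_0_compat; [|nra].
        pose proof PI2_3_2 as HP.
        assert (cos x < cos 0) by (apply cos_decreasing_1; lra).
        rewrite cos_0 in H. lra.
      * intros x Hx. apply continuous_fejer. lra.
    + intros u v Hu Huv.
      assert (c <= RInt fejer u v + u / 2 + 2 / v).
      { apply Hc2. intros x [u1 [v1 [Hu1 [Huv1 ->]]]]. apply HB; assumption. }
      pose proof (HU u v Hu Huv).
      assert (0 < 2 / v) by (apply Rdiv_lt_0_compat; lra).
      apply Rabs_le. lra.
Qed.

Lemma continuous_one_minus_cos (x t : R) : 0 < t ->
  continuous (fun t => (1 - cos (x * t)) / t ^ 2) t.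
Proof. intros H. apply continuous_of_ex_derive. auto_derive. nra. Qed.

Lemma one_minus_cos_integral (c x T : R) :
  (forall u v, 0 < u -> u <= v -> Rabs (RInt fejer u v - c) <= u / 2 + 2 / v) ->
  1 <= T ->
  Rabs (RInt (fun t => (1 - cos (x * t)) / t ^ 2) (/ T) T - c * Rabs x) <= (x ^ 2 / 2 + 2) / T.
Proof.
  intros Hc HT.
  assert (HTi : / T <= T).
  { apply Rle_trans with 1; [|exact HT]. rewrite <- Rinv_1. apply Rinv_le_contravar; lra. }
  assert (HTi0 : 0 < / T) by (apply Rinv_0_lt_compat; lra).
  assert (Hpos : forall y, 0 < y ->
    Rabs (RInt (fun t => (1 - cos (y * t)) / t ^ 2) (/ T) T - c * y) <= (y ^ 2 / 2 + 2) / T).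
  { intros y Hy.
    assert (E : RInt (fun t => (1 - cos (y * t)) / t ^ 2) (/ T) T
                = y * RInt fejer (y * / T) (y * T)).
    { rewrite <- (Rplus_0_r (y * / T)), <- (Rplus_0_r (y * T)).
      rewrite <- (RInt_comp_lin (V := R_CompleteNormedModule) fejer y 0 (/ T) T).
      2: { apply ex_RInt_pos; [nra|nra|exact continuous_fejer]. }
      rewrite <- (RInt_scal (V := R_CompleteNormedModule)).
      2: { apply ex_RInt_pos; [lra|lra|]. intros t Ht.
           apply continuous_of_ex_derive. unfold fejer.
           apply (ex_derive_ext (fun t => y * ((1 - cos (y * t + 0)) / (y * t + 0) ^ 2))).
           - intros; reflexivity.
           - auto_derive. assert (0 < y * t) by nra. nra. }
      apply RInt_ext. intros t Ht. rewrite Rmin_left in Ht by lra.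
      change ((1 - cos (y * t)) / t ^ 2 = y * (y * fejer (y * t + 0)) :> R).
      unfold fejer. rewrite Rplus_0_r. field. split; lra. }
    rewrite E.
    replace (y * RInt fejer (y * / T) (y * T) - c * y)
      with (y * (RInt fejer (y * / T) (y * T) - c)) by ring.
    rewrite Rabs_mult, (Rabs_right y) by lra.
    replace ((y ^ 2 / 2 + 2) / T) with (y * (y * / T / 2 + 2 / (y * T))) by (field; lra).
    apply Rmult_le_compat_l; [lra|]. apply Hc; nra. }
  destruct (Rtotal_order x 0) as [h|[h|h]].
  - rewrite (Rabs_left x) by exact h.
    replace (x ^ 2) with ((- x) ^ 2) by ring.
    rewrite (RInt_ext _ (fun t => (1 - cos (- x * t)) / t ^ 2)).
    + apply Hpos. lra.
    + intros t _. replace (- x * t) with (- (x * t)) by ring. rewrite cos_neg. reflexivity.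
  - subst x. rewrite Rabs_R0.
    rewrite (RInt_ext _ (fun t => 0)).
    + rewrite RInt_const. change (scal (T - / T) 0) with ((T - / T) * 0).
      replace ((T - / T) * 0 - c * 0) with 0 by ring. rewrite Rabs_R0.
      apply Rmult_le_pos; lra.
    + intros t Ht. change ((1 - cos (0 * t)) / t ^ 2 = 0 :> R).
      rewrite Rmult_0_l, cos_0. unfold Rdiv. ring.
  - rewrite (Rabs_right x) by lra. apply Hpos. exact h.
Qed.

Definition bohr_kernel (A B t : R) : R := (cos (A * t) - cos (B * t)) / t ^ 2.

Lemma continuous_bohr_kernel (A B t : R) : 0 < t -> continuous (bohr_kernel A B) t.
Proof. intros H. apply continuous_of_ex_derive. unfold bohr_kernel. auto_derive. nra. Qed.

Lemma continuous_mult_bohr_kernel (A B : R) (g : R -> R) :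
  (forall t, 0 < t -> continuous g t) ->
  forall t, 0 < t -> continuous (fun t => g t * bohr_kernel A B t) t.
Proof.
  intros Hg t Ht. apply (continuous_mult (K := R_AbsRing)); [apply Hg; exact Ht|].
  apply continuous_bohr_kernel. exact Ht.
Qed.

Lemma mult_bohr_kernel_le (A B t y X Y : R) :
  0 < t -> Rabs y <= Y -> Rabs (cos (A * t) - cos (B * t)) <= X ->
  Rabs (y * bohr_kernel A B t) <= Y * (X / t ^ 2).
Proof.
  intros Ht HY HX. assert (Hi : 0 < / t ^ 2) by (apply Rinv_0_lt_compat; nra).
  unfold bohr_kernel, Rdiv. rewrite !Rabs_mult, (Rabs_right (/ t ^ 2)) by lra.
  apply Rmult_le_compat; try apply Rabs_pos; [|exact HY|apply Rmult_le_compat_r; lra].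
  apply Rmult_le_pos; [apply Rabs_pos|lra].
Qed.

(* The cosine transform of the kernel is a trapezoid: constant for frequencies up
   to [A] and zero beyond [B]. *)
Lemma bohr_kernel_transform (c A B lam T : R) :
  (forall u v, 0 < u -> u <= v -> Rabs (RInt fejer u v - c) <= u / 2 + 2 / v) ->
  0 <= A -> A <= B -> 0 <= lam -> 1 <= T ->
  Rabs (RInt (fun t => cos (lam * t) * bohr_kernel A B t) (/ T) T
        - c / 2 * (B + lam + Rabs (B - lam) - (A + lam) - Rabs (A - lam)))
    <= ((B + lam) ^ 2 + 4) / T.
Proof.
  intros Hc HA HAB Hl HT.
  assert (HTi0 : 0 < / T) by (apply Rinv_0_lt_compat; lra).
  set (P := fun x => RInt (fun t => (1 - cos (x * t)) / t ^ 2) (/ T) T).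
  assert (HP : forall x, is_RInt (fun t => (1 - cos (x * t)) / t ^ 2) (/ T) T (P x)).
  { intros x. apply (RInt_correct (V := R_CompleteNormedModule)).
    apply ex_RInt_pos; [lra|lra|]. intros t Ht. apply continuous_one_minus_cos. exact Ht. }
  assert (E : RInt (fun t => cos (lam * t) * bohr_kernel A B t) (/ T) T
     = / 2 * (P (B + lam) + P (B - lam) - (P (A + lam) + P (A - lam)))).
  { apply is_RInt_unique.
    eapply is_RInt_ext; [|apply (is_RInt_scal (V := R_NormedModule) _ _ _ (/ 2) _
      (is_RInt_minus (V := R_NormedModule) _ _ _ _ _ _
        (is_RInt_plus (V := R_NormedModule) _ _ _ _ _ _ (HP (B + lam)) (HP (B - lam)))
        (is_RInt_plus (V := R_NormedModule) _ _ _ _ _ _ (HP (A + lam)) (HP (A - lam)))))].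
    intros t Ht.
    assert (0 < t) by (rewrite Rmin_left in Ht; [lra|]; apply Rle_trans with 1; [|exact HT];
      rewrite <- Rinv_1; apply Rinv_le_contravar; lra).
    change (/ 2 * (((1 - cos ((B + lam) * t)) / t ^ 2 + (1 - cos ((B - lam) * t)) / t ^ 2)
      + - ((1 - cos ((A + lam) * t)) / t ^ 2 + (1 - cos ((A - lam) * t)) / t ^ 2))
      = cos (lam * t) * bohr_kernel A B t :> R).
    unfold bohr_kernel.
    replace ((B + lam) * t) with (B * t + lam * t) by ring.
    replace ((B - lam) * t) with (B * t - lam * t) by ring.
    replace ((A + lam) * t) with (A * t + lam * t) by ring.
    replace ((A - lam) * t) with (A * t - lam * t) by ring.
    rewrite !cos_plus, !cos_minus. field. lra. }
  rewrite E.
  assert (K : forall x, Rabs x <= B + lam ->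
    Rabs (P x - c * Rabs x) <= ((B + lam) ^ 2 + 4) / T / 2).
  { intros x Hx. eapply Rle_trans; [apply (one_minus_cos_integral c x T Hc HT)|].
    assert (x ^ 2 <= (B + lam) ^ 2).
    { rewrite <- (pow2_abs x). apply pow_incr. split; [apply Rabs_pos|exact Hx]. }
    unfold Rdiv. rewrite Rmult_assoc, (Rmult_comm (/ T)), <- Rmult_assoc.
    apply Rmult_le_compat_r; lra. }
  pose proof (K (B + lam) ltac:(rewrite Rabs_right; lra)) as K1.
  pose proof (K (B - lam) ltac:(apply Rabs_le; lra)) as K2.
  pose proof (K (A + lam) ltac:(rewrite Rabs_right; lra)) as K3.
  pose proof (K (A - lam) ltac:(apply Rabs_le; lra)) as K4.
  rewrite (Rabs_right (B + lam)) in K1 by lra. rewrite (Rabs_right (A + lam)) in K3 by lra.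
  apply Rabs_le_between in K1, K2, K3, K4.
  apply Rabs_le_between. lra.
Qed.

Lemma bohr_kernel_L1 (A B T M : R) (g : R -> R) :
  0 <= A -> A < B -> B - A <= 1 -> / (B - A) <= T ->
  (forall t, 0 < t -> continuous g t) -> (forall t, 0 < t -> Rabs (g t) <= M) ->
  Rabs (RInt (fun t => g t * bohr_kernel A B t) (/ T) T)
    <= M * (B - A) * ((A + B) / 2 + ln (/ (B - A)) + 2).
Proof.
  intros HA HAB Hb HT Hg HM. set (b := B - A) in *.
  assert (Hb0 : 0 < b) by (unfold b; lra).
  assert (HM0 : 0 <= M) by (eapply Rle_trans; [apply Rabs_pos|apply (HM 1); lra]).
  assert (Hib : 1 <= / b) by (rewrite <- Rinv_1; apply Rinv_le_contravar; lra).
  assert (HTi0 : 0 < / T) by (apply Rinv_0_lt_compat; lra).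
  assert (HTi : / T <= 1) by (rewrite <- Rinv_1; apply Rinv_le_contravar; lra).
  pose proof (continuous_mult_bohr_kernel A B g Hg) as Hc.
  rewrite (RInt_split _ (/ T) 1 T) by (try exact Hc; lra).
  rewrite (RInt_split _ 1 (/ b) T) by (try exact Hc; lra).
  assert (I1 : Rabs (RInt (fun t => g t * bohr_kernel A B t) (/ T) 1)
     <= (1 - / T) * (M * (b * (A + B) / 2))).
  { apply (abs_RInt_dominated _ (fun _ => M * (b * (A + B) / 2)));
      [exact HTi0|exact HTi|exact Hc| |apply is_RInt_const_R].
    intros t Ht. eapply Rle_trans; [apply mult_bohr_kernel_le; [lra|apply HM; lra|apply abs_cos_minus]|].
    apply Rmult_le_compat_l; [exact HM0|].
    replace (A * t - B * t) with (- (b * t)) by (unfold b; ring).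
    replace (A * t + B * t) with ((A + B) * t) by ring.
    rewrite Rabs_Ropp, !Rabs_right by nra.
    apply Req_le. field. lra. }
  assert (I2 : Rabs (RInt (fun t => g t * bohr_kernel A B t) 1 (/ b))
     <= M * b * ln (/ b) - M * b * ln 1).
  { apply (abs_RInt_dominated _ (fun t => M * b / t));
      [lra|exact Hib|exact Hc| |apply is_RInt_inv; lra].
    intros t Ht. eapply Rle_trans; [apply mult_bohr_kernel_le; [lra|apply HM; lra|apply abs_cos_minus']|].
    replace (A * t - B * t) with (- (b * t)) by (unfold b; ring).
    rewrite Rabs_Ropp, Rabs_right by nra. apply Req_le. field. lra. }
  assert (I3 : Rabs (RInt (fun t => g t * bohr_kernel A B t) (/ b) T)
     <= 2 * M / / b - 2 * M / T).
  { apply (abs_RInt_dominated _ (fun t => 2 * M / t ^ 2));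
      [lra|exact HT|exact Hc| |apply is_RInt_inv2; lra].
    intros t Ht. eapply Rle_trans; [apply mult_bohr_kernel_le; [lra|apply HM; lra|apply abs_cos_minus_2]|].
    apply Req_le. field. lra. }
  rewrite ln_1, Rmult_0_r in I2.
  replace (2 * M / / b) with (2 * M * b) in I3 by (field; lra).
  assert (0 <= 2 * M / T) by (apply Rmult_le_pos; lra).
  assert (0 <= / T * (M * (b * (A + B) / 2))).
  { apply Rmult_le_pos; [lra|]. apply Rmult_le_pos; [exact HM0|]. nra. }
  eapply Rle_trans; [apply Rabs_triang|].
  eapply Rle_trans; [apply Rplus_le_compat; [apply Rle_refl|apply Rabs_triang]|].
  lra.
Qed.

Lemma bohr_kernel_linear (A B T M : R) (g : R -> R) :
  0 <= A -> A < B -> 1 <= T ->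
  (forall t, 0 < t -> continuous g t) -> (forall t, 0 < t -> Rabs (g t) <= M * (1 + t)) ->
  Rabs (RInt (fun t => g t * bohr_kernel A B t) (/ T) T)
    <= M * ((B - A) * (A + B) + 4 * ln T).
Proof.
  intros HA HAB HT Hg HM. set (b := B - A) in *.
  assert (Hb0 : 0 < b) by (unfold b; lra).
  assert (HM0 : 0 <= M).
  { assert (0 <= M * (1 + 1)) by (eapply Rle_trans; [apply Rabs_pos|apply (HM 1); lra]). lra. }
  assert (HTi0 : 0 < / T) by (apply Rinv_0_lt_compat; lra).
  assert (HTi : / T <= 1) by (rewrite <- Rinv_1; apply Rinv_le_contravar; lra).
  pose proof (continuous_mult_bohr_kernel A B g Hg) as Hc.
  rewrite (RInt_split _ (/ T) 1 T) by (try exact Hc; lra).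
  assert (I1 : Rabs (RInt (fun t => g t * bohr_kernel A B t) (/ T) 1)
     <= (1 - / T) * (M * (b * (A + B)))).
  { apply (abs_RInt_dominated _ (fun _ => M * (b * (A + B))));
      [exact HTi0|exact HTi|exact Hc| |apply is_RInt_const_R].
    intros t Ht. eapply Rle_trans; [apply mult_bohr_kernel_le; [lra|apply HM; lra|apply abs_cos_minus]|].
    replace (A * t - B * t) with (- (b * t)) by (unfold b; ring).
    replace (A * t + B * t) with ((A + B) * t) by ring.
    rewrite Rabs_Ropp, !Rabs_right by nra.
    replace (M * (1 + t) * (b * t * ((A + B) * t) / 2 / t ^ 2))
      with (M * (b * (A + B)) * ((1 + t) / 2)) by (field; lra).
    assert (0 <= M * (b * (A + B))) by (apply Rmult_le_pos; [exact HM0|nra]).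
    nra. }
  assert (I2 : Rabs (RInt (fun t => g t * bohr_kernel A B t) 1 T)
     <= 4 * M * ln T - 4 * M * ln 1).
  { apply (abs_RInt_dominated _ (fun t => 4 * M / t));
      [lra|exact HT|exact Hc| |apply is_RInt_inv; lra].
    intros t Ht. eapply Rle_trans; [apply mult_bohr_kernel_le; [lra|apply HM; lra|apply abs_cos_minus_2]|].
    replace (M * (1 + t) * (2 / t ^ 2)) with (2 * M / t * ((1 + t) / t)) by (field; lra).
    replace (4 * M / t) with (2 * M / t * 2) by (field; lra).
    apply Rmult_le_compat_l.
    - apply Rmult_le_pos; [lra|]. left. apply Rinv_0_lt_compat. lra.
    - apply Rle_div_l; lra. }
  rewrite ln_1, Rmult_0_r in I2.
  assert (0 <= / T * (M * (b * (A + B)))).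
  { apply Rmult_le_pos; [lra|]. apply Rmult_le_pos; [exact HM0|]. nra. }
  eapply Rle_trans; [apply Rabs_triang|]. lra.
Qed.

(** * Bohr's theorem *)

Lemma is_RInt_Rsum (F : nat -> R -> R) (I : nat -> R) (a b : R) (n : nat) :
  (forall k, (k < n)%nat -> is_RInt (F k) a b (I k)) ->
  is_RInt (fun t => Rsum (fun k => F k t) n) a b (Rsum I n).
Proof.
  induction n as [|n IH]; intros H; simpl.
  - pose proof (is_RInt_const_R 0 a b) as H0. rewrite Rmult_0_r in H0. exact H0.
  - apply (is_RInt_plus (V := R_NormedModule) _ (F n)); [apply IH|apply H]; auto with arith.
Qed.

Lemma Rsum_mult_r (u : nat -> R) (z : R) (n : nat) :
  Rsum (fun k => u k * z) n = Rsum u n * z.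
Proof. induction n as [|n IH]; simpl; [|rewrite IH]; ring. Qed.

Lemma Rsum_ext (u v : nat -> R) (n : nat) :
  (forall k, (k < n)%nat -> u k = v k) -> Rsum u n = Rsum v n.
Proof.
  induction n as [|n IH]; intros H; simpl; [reflexivity|].
  rewrite IH, H; auto with arith.
Qed.

Lemma Rsum_truncate (u : nat -> R) (N m : nat) : (N <= m)%nat ->
  Rsum (fun k => if (k <? N)%nat then u k else 0) m = Rsum u N.
Proof.
  intros H. induction H as [|m H IH].
  - apply Rsum_ext. intros k Hk. apply Nat.ltb_lt in Hk. now rewrite Hk.
  - simpl. rewrite IH. replace (m <? N)%nat with false; [ring|].
    symmetry. apply Nat.ltb_ge. exact H.
Qed.

Lemma Rsum_diff_le (u v w : nat -> R) (n : nat) :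
  (forall k, (k < n)%nat -> Rabs (u k - v k) <= w k) ->
  Rabs (Rsum u n - Rsum v n) <= Rsum w n.
Proof.
  induction n as [|n IH]; intros H; simpl.
  - rewrite Rminus_0_r, Rabs_R0. lra.
  - replace (Rsum u n + u n - (Rsum v n + v n)) with ((Rsum u n - Rsum v n) + (u n - v n)) by ring.
    eapply Rle_trans; [apply Rabs_triang|].
    apply Rplus_le_compat; [apply IH|apply H]; auto with arith.
Qed.

Lemma ln_succ_bounds (N : nat) : (1 <= N)%nat ->
  0 < ln (INR (S N)) - ln (INR N) <= 1 /\
  / INR (S N) <= ln (INR (S N)) - ln (INR N).
Proof.
  intros HN.
  assert (H1 : 1 <= INR N) by (apply (le_INR 1) in HN; exact HN).
  rewrite S_INR. set (x := INR N) in *.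
  assert (Hlt : ln x < ln (x + 1)) by (apply ln_increasing; lra).
  pose proof (exp_ineq1_le (ln (x + 1) - ln x)) as E1.
  pose proof (exp_ineq1_le (- (ln (x + 1) - ln x))) as E2.
  replace (- (ln (x + 1) - ln x)) with (ln x + - ln (x + 1)) in E2 by ring.
  unfold Rminus in E1. rewrite exp_plus, exp_Ropp, !exp_ln in E1 by lra.
  rewrite exp_plus, exp_Ropp, !exp_ln in E2 by lra.
  replace ((x + 1) * / x) with (1 + / x) in E1 by (field; lra).
  replace (x * / (x + 1)) with (1 - / (x + 1)) in E2 by (field; lra).
  assert (/ x <= 1) by (rewrite <- Rinv_1; apply Rinv_le_contravar; lra).
  lra.
Qed.

Lemma continuous_Rsum (F : nat -> R -> R) (t : R) (n : nat) :
  (forall k, continuous (F k) t) -> continuous (fun t => Rsum (fun k => F k t) n) t.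
Proof.
  intros H. induction n as [|n IH]; simpl.
  - apply continuous_const.
  - apply (continuous_plus (V := R_NormedModule) _ (F n)); [exact IH|apply H].
Qed.

Section BohrReal.
Variables (c : R) (g : R -> R) (alpha : nat -> R) (M C0 C1 delta : R).
Hypothesis Hc0 : 0 < c.
Hypothesis Hc : forall u v, 0 < u -> u <= v -> Rabs (RInt fejer u v - c) <= u / 2 + 2 / v.
Hypothesis Hdelta : 0 < delta.
Hypothesis Hg : forall t, 0 < t -> continuous g t.
Hypothesis HM : forall t, 0 < t -> Rabs (g t) <= M.
Hypothesis Halpha : forall k, Rabs (alpha k) <= C0.
Hypothesis Htail : forall m t, 0 < t ->
  Rabs (g t - Rsum (fun k => alpha k * cos (ln (INR (S k)) * t)) m)
    <= C1 * rpow_opp (S m) delta * (1 + t).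

Lemma bohr_real_approx (N m : nat) : (1 <= N)%nat -> (N < m)%nat ->
  c * (ln (INR (S N)) - ln (INR N)) * Rabs (Rsum alpha N)
  <= M * (ln (INR (S N)) - ln (INR N)) * (2 + 2 * ln (INR (S N)))
     + 8 * C0 * / INR (S m)
     + C1 * rpow_opp (S m) delta * (2 * ln (INR (S N)) + 16 * ln (INR (S m))).
Proof.
  intros HN Hm.
  destruct (ln_succ_bounds N HN) as [[Hb0 Hb1] Hb2].
  set (A := ln (INR N)) in *. set (B := ln (INR (S N))) in *. set (b := B - A) in *.
  set (mu := INR (S m)).
  assert (HA : 0 <= A) by apply ln_INR_ge_0.
  assert (HSN : 0 < INR (S N)) by (apply lt_0_INR; lia).
  assert (Hmu : INR (S N) <= mu) by (apply le_INR; lia).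
  assert (Hmu1 : 1 <= mu) by (apply (le_INR 1); lia).
  assert (Hlm : 0 <= ln mu) by apply ln_INR_ge_0.
  assert (HC0 : 0 <= C0) by (eapply Rle_trans; [apply Rabs_pos|apply (Halpha O)]).
  set (T := mu ^ 4).
  assert (HT1 : mu <= T).
  { unfold T. assert (1 <= mu ^ 3) by (apply pow_R1_Rle; exact Hmu1).
    replace (mu ^ 4) with (mu * mu ^ 3) by ring. nra. }
  assert (HTb : / b <= T).
  { apply Rle_trans with (INR (S N)); [|lra].
    rewrite <- (Rinv_inv (INR (S N))). apply Rinv_le_contravar; [|exact Hb2].
    apply Rinv_0_lt_compat. exact HSN. }
  assert (HTi0 : 0 < / T) by (apply Rinv_0_lt_compat; lra).
  set (lam := fun k => ln (INR (S k))).
  set (I := fun k => RInt (fun t => cos (lam k * t) * bohr_kernel A B t) (/ T) T).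
  set (S_ := fun t => Rsum (fun k => alpha k * cos (lam k * t)) m).
  assert (HScont : forall t, 0 < t -> continuous S_ t).
  { intros t Ht. apply (continuous_Rsum (fun k t => alpha k * cos (lam k * t))).
    intros k. apply continuous_of_ex_derive. auto_derive. trivial. }
  assert (E1 : RInt (fun t => S_ t * bohr_kernel A B t) (/ T) T = Rsum (fun k => alpha k * I k) m).
  { apply is_RInt_unique.
    apply (is_RInt_ext (V := R_NormedModule)
      (fun t => Rsum (fun k => alpha k * (cos (lam k * t) * bohr_kernel A B t)) m)).
    - intros t _. unfold S_. rewrite <- Rsum_mult_r. apply Rsum_ext. intros k _. ring.
    - apply (is_RInt_Rsum (fun k t => alpha k * (cos (lam k * t) * bohr_kernel A B t))).
      intros k _. apply (is_RInt_scal (V := R_NormedModule) _ _ _ (alpha k) (I k)).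
      apply (RInt_correct (V := R_CompleteNormedModule)). apply ex_RInt_pos; [lra|lra|].
      apply (continuous_mult_bohr_kernel A B (fun t => cos (lam k * t))).
      intros t Ht. apply continuous_of_ex_derive. auto_derive. trivial. }
  assert (E2 : RInt (fun t => (g t - S_ t) * bohr_kernel A B t) (/ T) T
    = RInt (fun t => g t * bohr_kernel A B t) (/ T) T
      - RInt (fun t => S_ t * bohr_kernel A B t) (/ T) T).
  { apply is_RInt_unique.
    eapply (is_RInt_ext (V := R_NormedModule)); [|apply (is_RInt_minus (V := R_NormedModule));
      apply (RInt_correct (V := R_CompleteNormedModule)); apply ex_RInt_pos;
      [lra|lra|apply continuous_mult_bohr_kernel; exact Hg|lra|lra|apply continuous_mult_bohr_kernel; exact HScont]].
    intros t _. change (g t * bohr_kernel A B t - S_ t * bohr_kernel A B t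
      = (g t - S_ t) * bohr_kernel A B t :> R). ring. }
  assert (B1 : Rabs (RInt (fun t => g t * bohr_kernel A B t) (/ T) T)
     <= M * b * (2 + 2 * B)).
  { eapply Rle_trans; [apply (bohr_kernel_L1 A B T M g); try assumption; unfold b in *; lra|].
    fold b. assert (HM0 : 0 <= M) by (eapply Rle_trans; [apply Rabs_pos|apply (HM 1); lra]).
    apply Rmult_le_compat_l; [nra|].
    assert (ln (/ b) <= B).
    { apply ln_le; [apply Rinv_0_lt_compat; exact Hb0|].
      rewrite <- (Rinv_inv (INR (S N))). apply Rinv_le_contravar; [|exact Hb2].
      apply Rinv_0_lt_compat. exact HSN. }
    unfold b in *. lra. }
  assert (B2 : Rabs (RInt (fun t => (g t - S_ t) * bohr_kernel A B t) (/ T) T)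
     <= C1 * rpow_opp (S m) delta * (2 * B + 16 * ln mu)).
  { eapply Rle_trans; [apply (bohr_kernel_linear A B T (C1 * rpow_opp (S m) delta))|].
    - exact HA.
    - unfold b in *; lra.
    - lra.
    - intros t Ht. apply (continuous_minus (V := R_NormedModule)); auto.
    - intros t Ht. apply Htail. exact Ht.
    - assert (HC1 : 0 <= C1 * rpow_opp (S m) delta * (1 + 1)).
      { eapply Rle_trans; [apply Rabs_pos|apply (Htail m 1); lra]. }
      apply Rmult_le_compat_l; [lra|]. unfold T. rewrite ln_pow by lra.
      replace (INR 4) with 4 by (simpl; ring). fold b.
      assert (b * (A + B) <= 1 * (A + B)) by (apply Rmult_le_compat_r; unfold b in *; lra).
      unfold b in *. lra. }
  assert (B3 : Rabs (Rsum (fun k => alpha k * I k) m - c * b * Rsum alpha N)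
     <= 8 * C0 * / mu).
  { rewrite <- (Rsum_truncate alpha N m) by lia. rewrite <- Rsum_scal.
    eapply Rle_trans; [apply (Rsum_diff_le _ _ (fun _ => C0 * (8 * mu ^ 2 / T)))|].
    - intros k Hk.
      assert (Hlk : 0 <= lam k) by apply ln_INR_ge_0.
      assert (Hlk2 : lam k <= ln mu) by (apply ln_INR_le; lia).
      assert (HBm : B <= ln mu) by (apply ln_INR_le; lia).
      assert (Hlmm : ln mu <= mu) by (apply ln_le_self; lra).
      pose proof (bohr_kernel_transform c A B (lam k) T Hc HA ltac:(unfold b in *; lra) Hlk
        ltac:(lra)) as K. fold (I k) in K.
      assert (K2 : ((B + lam k) ^ 2 + 4) / T <= 8 * mu ^ 2 / T).
      { apply Rmult_le_compat_r; [lra|].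
        assert (0 <= B) by apply ln_INR_ge_0.
        assert ((B + lam k) ^ 2 <= (2 * mu) ^ 2) by (apply pow_incr; lra). nra. }
      assert (K3 : Rabs (alpha k * (I k - c / 2 * (B + lam k + Rabs (B - lam k) - (A + lam k) - Rabs (A - lam k))))
        <= C0 * (8 * mu ^ 2 / T)).
      { rewrite Rabs_mult. apply Rmult_le_compat; try apply Rabs_pos; [apply Halpha|lra]. }
      eapply Rle_trans; [|exact K3]. apply Req_le. f_equal.
      destruct (k <? N)%nat eqn:E.
      + apply Nat.ltb_lt in E.
        assert (lam k <= A) by (apply ln_INR_le; lia).
        rewrite !Rabs_right by (unfold b in *; lra). unfold b. field.
      + apply Nat.ltb_ge in E.
        assert (B <= lam k) by (apply ln_INR_le; lia).
        rewrite !Rabs_left1 by (unfold b in *; lra). field.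
    - rewrite Rsum_const.
      assert (HIm : INR m <= mu) by (apply le_INR; lia).
      replace (8 * C0 * / mu) with (mu * (C0 * (8 * mu ^ 2 / T))) by (unfold T; field; lra).
      apply Rmult_le_compat_r; [|exact HIm].
      apply Rmult_le_pos; [exact HC0|]. apply Rmult_le_pos; [|lra].
      pose proof (pow2_ge_0 mu). lra. }
  rewrite E2, E1 in B2.
  replace (c * b * Rabs (Rsum alpha N)) with (Rabs (c * b * Rsum alpha N)).
  2: { rewrite Rabs_mult, (Rabs_right (c * b)); [reflexivity|]. nra. }
  apply Rabs_le_between in B1, B2, B3. apply Rabs_le. lra.
Qed.

Lemma bohr_real (N : nat) : (1 <= N)%nat ->
  Rabs (Rsum alpha N) <= M * (2 + 2 * ln (INR (S N))) / c.
Proof.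
  intros HN.
  destruct (ln_succ_bounds N HN) as [[Hb0 Hb1] _].
  set (b := ln (INR (S N)) - ln (INR N)) in *.
  assert (HC0 : 0 <= C0) by (eapply Rle_trans; [apply Rabs_pos|apply (Halpha O)]).
  set (B := ln (INR (S N))). assert (HB : 0 <= B) by apply ln_INR_ge_0.
  set (r := Rmin 1 (delta / 2)).
  assert (Hr : 0 < r) by (apply Rmin_pos; lra).
  assert (HC1 : 0 <= C1).
  { assert (0 <= C1 * rpow_opp 1 delta * (1 + 1)).
    { eapply Rle_trans; [apply Rabs_pos|apply (Htail O 1); lra]. }
    pose proof (rpow_opp_pos 1 delta). nra. }
  set (L := 8 * C0 + C1 * (2 * B + 16 * / (delta / 2))).
  assert (Hi : 0 < / (delta / 2)) by (apply Rinv_0_lt_compat; lra).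
  assert (HL : 0 <= L) by (unfold L; nra).
  assert (Main : c * b * Rabs (Rsum alpha N) <= M * b * (2 + 2 * B)).
  { apply le_epsilon. intros eps Heps.
    destruct (rpow_opp_small r L eps Hr HL Heps) as [m0 [_ Hm0]].
    set (m := (N + m0 + 1)%nat).
    eapply Rle_trans; [apply (bohr_real_approx N m HN); unfold m; lia|].
    fold b B.
    assert (Hq : L * rpow_opp (S m) r < eps) by (apply Hm0; unfold m; lia).
    set (q := rpow_opp (S m) r) in *.
    assert (Hq0 : 0 < q) by apply rpow_opp_pos.
    assert (T1 : / INR (S m) <= q).
    { rewrite <- (exp_ln (/ INR (S m))).
      - rewrite ln_Rinv by (apply lt_0_INR; lia). unfold q, rpow_opp.
        apply exp_le. pose proof (ln_INR_ge_0 (S m)).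
        assert (r <= 1) by apply Rmin_l. nra.
      - apply Rinv_0_lt_compat. apply lt_0_INR. lia. }
    assert (T2 : rpow_opp (S m) (delta / 2) <= q) by (apply rpow_opp_antitone; apply Rmin_r).
    assert (T3 : rpow_opp (S m) delta = rpow_opp (S m) (delta / 2) * rpow_opp (S m) (delta / 2)).
    { rewrite <- rpow_opp_plus. f_equal. field. }
    pose proof (mult_exp_le (delta / 2) (ln (INR (S m))) ltac:(lra)) as T4.
    change (exp (- (delta / 2 * ln (INR (S m))))) with (rpow_opp (S m) (delta / 2)) in T4.
    assert (T5 : rpow_opp (S m) (delta / 2) <= 1) by (apply rpow_opp_le_1; lra).
    pose proof (rpow_opp_pos (S m) (delta / 2)) as T6.
    pose proof (ln_INR_ge_0 (S m)) as T7.
    set (p := rpow_opp (S m) (delta / 2)) in *.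
    set (l := ln (INR (S m))) in *.
    rewrite T3.
    assert (T8 : C1 * (p * p) * (2 * B + 16 * l) <= C1 * (2 * B + 16 * / (delta / 2)) * q).
    { replace (C1 * (p * p) * (2 * B + 16 * l)) with (C1 * (p * (2 * B * p + 16 * (l * p)))) by ring.
      rewrite (Rmult_assoc C1 _ q), (Rmult_comm _ q). apply Rmult_le_compat_l; [exact HC1|].
      apply Rmult_le_compat; try nra. }
    assert (T9 : 8 * C0 * / INR (S m) <= 8 * C0 * q) by (apply Rmult_le_compat_l; lra).
    unfold L in *. lra. }
  apply Rle_div_r; [exact Hc0|].
  apply Rmult_le_reg_l with b; [exact Hb0|]. fold B. lra.
Qed.
End BohrReal.

Lemma continuous_R_intro (g : R -> R) (t : R) :
  (forall eta, 0 < eta -> exists d, 0 < d /\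
     forall x, Rabs (x - t) < d -> Rabs (g x - g t) < eta) -> continuous g t.
Proof.
  intros H. apply continuity_pt_filterlim. intros eps He.
  destruct (H eps He) as [d [Hd K]]. exists d. split; [exact Hd|].
  intros x [_ Hx]. apply K. exact Hx.
Qed.

Lemma vertical_continuous (f : C -> C) (s u : C) (e : R) :
  holomorphic_C0 f -> half_plane 0 s -> forall t,
  continuous (fun t => Re (Cmult u (f (Cplus s (Cmult Ci (RtoC (e * t))))))) t.
Proof.
  intros Hf Hs t. apply continuous_R_intro. intros eta He.
  set (s1 := Cplus s (Cmult Ci (RtoC (e * t)))).
  assert (Hs1 : half_plane 0 s1).
  { unfold half_plane, s1 in *. replace (Re _) with (Re s); [exact Hs|].
    re_im_ring. }
  pose proof (Cmod_ge_0 u) as Hu.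
  destruct (ex_derive_C_continuous f s1 (Hf s1 Hs1) (eta / (Cmod u + 1))) as [d [Hd K]].
  { apply Rdiv_lt_0_compat; lra. }
  pose proof (Rabs_pos e) as Hep.
  exists (d / (Rabs e + 1)). split; [apply Rdiv_lt_0_compat; lra|].
  intros x Hx. apply Rlt_div_r in Hx; [|lra].
  specialize (K (Cmult Ci (RtoC (e * (x - t))))).
  assert (E : Cplus s1 (Cmult Ci (RtoC (e * (x - t)))) = Cplus s (Cmult Ci (RtoC (e * x)))).
  { unfold s1. rewrite !RtoC_mult, RtoC_minus. ring. }
  rewrite E in K.
  assert (HK : Cmod (Cminus (f (Cplus s (Cmult Ci (RtoC (e * x))))) (f s1)) < eta / (Cmod u + 1)).
  { apply K. rewrite Cmod_mult, Cmod_Ci, Cmod_R, Rabs_mult.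
    pose proof (Rabs_pos (x - t)). nra. }
  apply Rlt_div_r in HK; [|lra].
  assert (E2 : Re (Cmult u (f (Cplus s (Cmult Ci (RtoC (e * x)))))) - Re (Cmult u (f s1))
     = Re (Cmult u (Cminus (f (Cplus s (Cmult Ci (RtoC (e * x))))) (f s1)))).
  { re_im_ring. }
  fold s1. rewrite E2. eapply Rle_lt_trans; [apply re_le_Cmod|].
  rewrite Cmod_mult. pose proof (Cmod_ge_0 (Cminus (f (Cplus s (Cmult Ci (RtoC (e * x))))) (f s1))).
  nra.
Qed.

Lemma Csum_Re (u : C) (x : nat -> C) (n : nat) :
  Re (Cmult u (Csum x n)) = Rsum (fun k => Re (Cmult u (x k))) n.
Proof.
  induction n as [|n IH].
  - simpl. re_im_ring.
  - change (Re (Cmult u (Cplus (Csum x n) (x n)))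
      = Rsum (fun k => Re (Cmult u (x k))) n + Re (Cmult u (x n))).
    rewrite <- IH. re_im_ring.
Qed.

Lemma exists_unit (z : C) : exists u : C, Cmod u <= 1 /\ Re (Cmult u z) = Cmod z.
Proof.
  destruct (Req_dec (Cmod z) 0) as [E|NE].
  - exists (RtoC 1). rewrite Cmod_1. split; [lra|].
    apply Cmod_eq_0 in E. subst z. rewrite Cmod_0. re_im_ring.
  - exists (Cmult (RtoC (/ Cmod z)) (Cconj z)).
    pose proof (Cmod_ge_0 z).
    assert (0 < Cmod z) by lra.
    assert (0 < / Cmod z) by (apply Rinv_0_lt_compat; lra).
    split.
    + rewrite Cmod_mult, Cmod_conj, Cmod_R, Rabs_right by lra.
      rewrite Rinv_l by exact NE. lra.
    + replace (Re (Cmult (Cmult (RtoC (/ Cmod z)) (Cconj z)) z))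
        with (/ Cmod z * (Re z ^ 2 + Im z ^ 2)).
      * rewrite <- Cmod2_alt. field. exact NE.
      * re_im_ring.
Qed.

Lemma dirichlet_term_vertical (a : nat -> C) (s u : C) (k : nat) (t : R) :
  (Re (Cmult u (dirichlet_term a (Cplus s (Cmult Ci (RtoC (1 * t)))) k)) +
   Re (Cmult u (dirichlet_term a (Cplus s (Cmult Ci (RtoC ((-1) * t)))) k))) / 2
  = Re (Cmult u (dirichlet_term a s k)) * cos (ln (INR (S k)) * t).
Proof.
  rewrite !dirichlet_term_plus.
  set (z := dirichlet_term a s k). set (l := ln (INR (S k))).
  assert (E : forall e, Cexp (Cmult (RtoC l) (Copp (Cmult Ci (RtoC (e * t)))))
     = (cos (e * (l * t)), - sin (e * (l * t)))).
  { intros e. rewrite <- sin_neg, <- (cos_neg (e * (l * t))), <- Cexp_imag. f_equal.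
    rewrite RtoC_opp, !RtoC_mult. ring. }
  rewrite !E. replace (1 * (l * t)) with (l * t) by ring.
  replace (-1 * (l * t)) with (- (l * t)) by ring.
  rewrite cos_neg, sin_neg.
  destruct z as [z1 z2], u as [u1 u2]. unfold Re, Cmult; simpl. field.
Qed.

Lemma bohr_partial_sums : exists K : R, 0 < K /\
  forall (a : nat -> C) (f : C -> C) (theta M : R),
  dirichlet_rep a f -> 0 < theta ->
  (forall s, half_plane theta s -> Cmod (f s) <= M) ->
  forall (s : C) (N : nat), half_plane theta s ->
  Cmod (dsum a s N) <= K * M * (1 + ln (INR (S N))).
Proof.
  destruct fejer_integral as [c [Hc0 Hc]].
  exists (2 / c). split; [apply Rdiv_lt_0_compat; lra|].
  intros a f theta M Ha Ht HM s N Hs.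
  assert (Hs0 : half_plane 0 s) by (unfold half_plane in *; lra).
  assert (HM0 : 0 <= M) by (eapply Rle_trans; [apply Cmod_ge_0|apply (HM s Hs)]).
  destruct (Nat.eq_dec N 0) as [->|HN].
  { simpl. rewrite Cmod_0, ln_1. apply Rmult_le_pos; [|lra].
    apply Rmult_le_pos; [|exact HM0]. left. apply Rdiv_lt_0_compat; lra. }
  destruct (exists_unit (dsum a s N)) as [u [Hu1 Hu2]].
  pose proof (Cmod_ge_0 u) as Hu0.
  set (sh := fun e t => Cplus s (Cmult Ci (RtoC (e * t)))).
  assert (Hsh : forall e t, Re (sh e t) = Re s).
  { intros e t. unfold sh, Re, Cplus, Cmult, Ci, RtoC; simpl. ring. }
  assert (Hshm : forall e t, Rabs e = 1 -> 0 < t -> Cmod (sh e t) <= Cmod s + t).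
  { intros e t He Htt. unfold sh. eapply Rle_trans; [apply Cmod_triangle|].
    rewrite Cmod_mult, Cmod_Ci, Cmod_R, Rabs_mult, He, (Rabs_right t) by lra. lra. }
  set (g := fun t => (Re (Cmult u (f (sh 1 t))) + Re (Cmult u (f (sh (-1) t)))) / 2).
  assert (Hru : forall z, Rabs (Re (Cmult u z)) <= Cmod z).
  { intros z. eapply Rle_trans; [apply re_le_Cmod|]. rewrite Cmod_mult.
    pose proof (Cmod_ge_0 z). nra. }
  pose proof (dirichlet_rep_holomorphic a f Ha) as Hol.
  destruct (dirichlet_tail a f theta Ha Ht) as [B [HB HT]].
  destruct (Ccv_bounded _ _ (is_series_Csum a f s Ha Hs0)) as [C0 HC0].
  rewrite <- Hu2, Csum_Re.
  eapply Rle_trans; [apply Rle_abs|].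
  replace (2 / c * M * (1 + ln (INR (S N)))) with (M * (2 + 2 * ln (INR (S N))) / c) by (field; lra).
  apply (bohr_real c g _ M (2 * C0) (B * (Cmod s + theta + 1)) (theta / 2)); try assumption.
  - lra.
  - intros t _. unfold g.
    apply (continuous_mult (K := R_AbsRing) _ (fun _ => / 2)); [|apply continuous_const].
    apply (continuous_plus (V := R_NormedModule)); apply vertical_continuous; assumption.
  - intros t _. unfold g.
    pose proof (Hru (f (sh 1 t))) as R1. pose proof (Hru (f (sh (-1) t))) as R2.
    pose proof (HM (sh 1 t)) as M1. pose proof (HM (sh (-1) t)) as M2.
    unfold half_plane in M1, M2. rewrite Hsh in M1, M2.
    specialize (M1 Hs). specialize (M2 Hs).
    apply Rabs_le_between in R1, R2. apply Rabs_le. lra.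
  - intros k. eapply Rle_trans; [apply Hru|].
    replace (dirichlet_term a s k) with
      (Cminus (dsum a s (S k)) (dsum a s k)) by (simpl; ring).
    eapply Rle_trans; [apply Cmod_minus_le|]. pose proof (HC0 (S k)). pose proof (HC0 k). lra.
  - intros m t Htt.
    replace (g t - Rsum (fun k => Re (Cmult u (dirichlet_term a s k)) * cos (ln (INR (S k)) * t)) m)
      with ((Re (Cmult u (Cminus (f (sh 1 t)) (dsum a (sh 1 t) m))) +
             Re (Cmult u (Cminus (f (sh (-1) t)) (dsum a (sh (-1) t) m)))) / 2).
    2: { assert (D : forall x y, Re (Cmult u (Cminus x y)) = Re (Cmult u x) - Re (Cmult u y)).
         { intros. re_im_ring. }
         rewrite !D, !Csum_Re. unfold g.
         assert (E : Rsum (fun k => Re (Cmult u (dirichlet_term a s k)) * cos (ln (INR (S k)) * t)) m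
           = (Rsum (fun k => Re (Cmult u (dirichlet_term a (sh 1 t) k))) m
             + Rsum (fun k => Re (Cmult u (dirichlet_term a (sh (-1) t) k))) m) / 2).
         { clear. induction m as [|m IH]; [simpl; field|].
           cbn [Rsum]. rewrite IH, <- dirichlet_term_vertical. unfold sh. field. }
         rewrite E. field. }
    assert (T1 : forall e, Rabs e = 1 ->
      Rabs (Re (Cmult u (Cminus (f (sh e t)) (dsum a (sh e t) m))))
        <= B * (Cmod s + theta + 1) * rpow_opp (S m) (theta / 2) * (1 + t)).
    { intros e He. eapply Rle_trans; [apply Hru|].
      eapply Rle_trans; [apply HT; rewrite Hsh; unfold half_plane in Hs; lra|].
      replace (B * (Cmod s + theta + 1) * rpow_opp (S m) (theta / 2) * (1 + t))
        with (B * ((Cmod s + theta + 1) * (1 + t)) * rpow_opp (S m) (theta / 2)) by ring.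
      apply Rmult_le_compat_r; [left; apply rpow_opp_pos|].
      apply Rmult_le_compat_l; [exact HB|].
      pose proof (Hshm e t He Htt). pose proof (Cmod_ge_0 s). nra. }
    pose proof (T1 1 ltac:(apply Rabs_R1)) as X1.
    pose proof (T1 (-1) ltac:(rewrite Rabs_left; lra)) as X2.
    apply Rabs_le_between in X1, X2. apply Rabs_le. lra.
  - lia.
Qed.

(** * The algebra H^infty_+ *)

Lemma functional_choice (A B : Type) (P : A -> B -> Prop) :
  (forall x, exists y, P x y) -> exists F : A -> B, forall x, P x (F x).
Proof.
  intros H. exists (fun x => proj1_sig (constructive_indefinite_description _ (H x))).
  intros x. exact (proj2_sig (constructive_indefinite_description _ (H x))).
Qed.

Definition bounded_on (f : C -> C) (theta M : R) : Prop :=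
  forall s, half_plane theta s -> Cmod (f s) <= M.

Lemma bounded_on_ge_0 (f : C -> C) (theta M : R) : bounded_on f theta M -> 0 <= M.
Proof.
  intros H. eapply Rle_trans; [apply Cmod_ge_0|apply (H (RtoC (theta + 1)))].
  change (theta < theta + 1). lra.
Qed.

Lemma half_plane_weaken (theta eps : R) (s : C) :
  theta <= eps -> half_plane eps s -> half_plane theta s.
Proof. unfold half_plane. lra. Qed.

Lemma half_plane_0 (eps : R) (s : C) : 0 < eps -> half_plane eps s -> half_plane 0 s.
Proof. unfold half_plane. lra. Qed.

Lemma ln_INR_SS_le (n : nat) : ln (INR (S (S n))) <= 1 + ln (INR (S n)).
Proof. destruct (ln_succ_bounds (S n) ltac:(lia)) as [[_ H] _]. lra. Qed.

Lemma log_rpow_bound (nu : R) (n : nat) : 0 < nu ->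
  (2 + ln (INR n)) * rpow_opp n nu <= 2 + / nu.
Proof.
  intros Hn. pose proof (rpow_opp_le_1 n nu ltac:(lra)) as H1.
  pose proof (mult_exp_le nu (ln (INR n)) Hn) as H2.
  change (exp (- (nu * ln (INR n)))) with (rpow_opp n nu) in H2. lra.
Qed.

Lemma coef_bound (nu : R) : 0 < nu -> exists K : R, 0 < K /\
  forall (a : nat -> C) (f : C -> C) (theta M : R),
  dirichlet_rep a f -> 0 < theta -> bounded_on f theta M ->
  forall n, (1 <= n)%nat -> Cmod (a n) * rpow_opp n (theta + nu) <= K * M.
Proof.
  intros Hnu. destruct bohr_partial_sums as [K [HK HB]].
  assert (Hi : 0 < / (nu / 2)) by (apply Rinv_0_lt_compat; lra).
  exists (2 * K * (2 + / (nu / 2))). split; [nra|].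
  intros a f theta M Ha Ht HM n Hn. destruct n as [|k]; [lia|].
  pose proof (bounded_on_ge_0 f theta M HM) as HM0.
  set (s := RtoC (theta + nu / 2)).
  assert (Hs : half_plane theta s) by (change (theta < theta + nu / 2); lra).
  pose proof (HB a f theta M Ha Ht HM s (S k) Hs) as B1.
  pose proof (HB a f theta M Ha Ht HM s k Hs) as B2.
  assert (HT : Cmod (dirichlet_term a s k) <= 2 * (K * M * (2 + ln (INR (S k))))).
  { replace (dirichlet_term a s k) with
      (Cminus (dsum a s (S k)) (dsum a s k)) by (simpl; ring).
    eapply Rle_trans; [apply Cmod_minus_le|].
    pose proof (ln_INR_SS_le k). assert (0 <= K * M) by nra.
    assert (K * M * (1 + ln (INR (S (S k)))) <= K * M * (2 + ln (INR (S k))))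
      by (apply Rmult_le_compat_l; lra).
    assert (K * M * (1 + ln (INR (S k))) <= K * M * (2 + ln (INR (S k))))
      by (apply Rmult_le_compat_l; lra). lra. }
  unfold dirichlet_term in HT. rewrite Cmod_mult, Cmod_npow_opp in HT.
  change (Re s) with (theta + nu / 2) in HT.
  replace (theta + nu) with (theta + nu / 2 + nu / 2) by field.
  rewrite rpow_opp_plus, <- Rmult_assoc.
  pose proof (log_rpow_bound (nu / 2) (S k) ltac:(lra)) as HL.
  pose proof (rpow_opp_pos (S k) (nu / 2)) as HP.
  apply Rle_trans with (2 * (K * M * (2 + ln (INR (S k)))) * rpow_opp (S k) (nu / 2)).
  - apply Rmult_le_compat_r; lra.
  - replace (2 * (K * M * (2 + ln (INR (S k)))) * rpow_opp (S k) (nu / 2))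
      with (2 * (K * M) * ((2 + ln (INR (S k))) * rpow_opp (S k) (nu / 2))) by ring.
    replace (2 * K * (2 + / (nu / 2)) * M) with (2 * (K * M) * (2 + / (nu / 2))) by ring.
    apply Rmult_le_compat_l; [nra|exact HL].
Qed.

Lemma bohr_tail (delta : R) : 0 < delta -> exists K : R, 0 < K /\
  forall (a : nat -> C) (f : C -> C) (theta M : R),
  dirichlet_rep a f -> 0 < theta -> bounded_on f theta M ->
  forall (s : C) (p : nat), half_plane (theta + delta) s ->
  Cmod (Cminus (f s) (dsum a s p)) <= K * M * rpow_opp (S p) (delta / 2).
Proof.
  intros Hd. destruct bohr_partial_sums as [K [HK HB]].
  assert (Hi : 0 < / (delta / 2)) by (apply Rinv_0_lt_compat; lra).
  set (K' := K * (2 + / (delta / 2))).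
  assert (HK' : 0 < K') by (unfold K'; nra).
  exists (4 * K'). split; [lra|].
  intros a f theta M Ha Ht HM s p Hs. unfold half_plane in Hs.
  pose proof (bounded_on_ge_0 f theta M HM) as HM0.
  set (s1 := Cminus s (RtoC delta)).
  assert (Hs1 : half_plane theta s1) by (change (theta < Re s - delta); lra).
  assert (Es : s = Cplus s1 (RtoC delta)) by (unfold s1; ring).
  set (x := dirichlet_term a s1).
  set (y := fun k => rpow_opp (S k) (delta / 2)).
  assert (Hy : forall k, 0 < y k) by (intros; apply rpow_opp_pos).
  assert (Hymono : forall j k, (j <= k)%nat -> y k <= y j).
  { intros j k H. apply rpow_opp_le_base; [lia|lia|lra]. }
  assert (HX : forall k j, (j <= S k)%nat -> Cmod (Csum x j) * y k <= K' * M).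
  { intros k j Hj. pose proof (HB a f theta M Ha Ht HM s1 j Hs1) as B. fold x in B.
    assert (L : 1 + ln (INR (S j)) <= 2 + ln (INR (S k))).
    { pose proof (ln_INR_SS_le k).
      assert (ln (INR (S j)) <= ln (INR (S (S k)))) by (apply ln_INR_le; lia). lra. }
    pose proof (log_rpow_bound (delta / 2) (S k) ltac:(lra)) as HL. fold (y k) in HL.
    specialize (Hy k).
    apply Rle_trans with (K * M * ((2 + ln (INR (S k))) * y k)).
    - rewrite <- Rmult_assoc. apply Rmult_le_compat_r; [lra|].
      eapply Rle_trans; [exact B|]. apply Rmult_le_compat_l; [nra|exact L].
    - unfold K'. replace (K * (2 + / (delta / 2)) * M) with (K * M * (2 + / (delta / 2))) by ring.
      apply Rmult_le_compat_l; [nra|exact HL]. }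
  assert (HV : forall k, Cexp (Cmult (RtoC (ln (INR (S k)))) (Copp (RtoC delta)))
     = RtoC (y k * y k)).
  { intros k. unfold y. rewrite <- rpow_opp_plus. replace (delta / 2 + delta / 2) with delta by field.
    rewrite <- npow_opp_real. unfold npow_opp. f_equal. ring. }
  assert (HT : forall n, (p <= n)%nat ->
    Cmod (Cminus (dsum a s n) (dsum a s p)) <= 4 * (K' * M) * y p).
  { intros n Hn. replace n with (p + (n - p))%nat by lia. set (q := (n - p)%nat).
    rewrite <- Csum_shift.
    rewrite (Csum_ext _ (fun k => Cmult (x (p + k)%nat) (RtoC (y (p + k)%nat * y (p + k)%nat)))).
    2: { intros k _. rewrite Es, dirichlet_term_plus, HV. reflexivity. }
    pose proof (abel_bound (fun k => x (p + k)%nat)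
      (fun k => RtoC (y (p + k)%nat * y (p + k)%nat))
      (fun k => 4 * (K' * M) * y (p + k)%nat) q) as H.
    cbv beta in H. rewrite Nat.add_0_r in H. apply H; clear H.
    - intros k _. rewrite (Csum_shift x), <- RtoC_minus, Cmod_R.
      rewrite Nat.add_succ_r.
      pose proof (Hymono (p + k)%nat (S (p + k)) ltac:(lia)) as Hm.
      pose proof (Hy (p + k)%nat) as P1. pose proof (Hy (S (p + k))) as P2.
      set (y1 := y (p + k)%nat) in *. set (y2 := y (S (p + k))) in *.
      rewrite Rabs_right by nra.
      assert (HD : Cmod (Cminus (Csum x (S (p + k))) (Csum x p)) * y1 <= 2 * (K' * M)).
      { pose proof (HX (p + k)%nat (S (p + k)) ltac:(lia)) as X1.
        pose proof (HX (p + k)%nat p ltac:(lia)) as X2. fold y1 in X1, X2.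
        pose proof (Cmod_minus_le (Csum x (S (p + k))) (Csum x p)). nra. }
      pose proof (Cmod_ge_0 (Cminus (Csum x (S (p + k))) (Csum x p))) as HD0.
      set (X := Cmod (Cminus (Csum x (S (p + k))) (Csum x p))) in *.
      replace (X * (y1 * y1 - y2 * y2)) with (X * (y1 + y2) * (y1 - y2)) by ring.
      replace (4 * (K' * M) * y1 - 4 * (K' * M) * y2) with (4 * (K' * M) * (y1 - y2)) by ring.
      apply Rmult_le_compat_r; [lra|]. nra.
    - rewrite (Csum_shift x), Cmod_R.
      pose proof (Hy (p + q)%nat) as P1. set (y1 := y (p + q)%nat) in *.
      rewrite Rabs_right by nra.
      pose proof (HX (p + q)%nat (p + q)%nat ltac:(lia)) as X1.
      pose proof (HX (p + q)%nat p ltac:(lia)) as X2. fold y1 in X1, X2.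
      pose proof (Cmod_minus_le (Csum x (p + q)) (Csum x p)).
      rewrite <- Rmult_assoc. apply Rmult_le_compat_r; [lra|].
      assert (0 <= K' * M) by nra. nra. }
  replace (4 * K' * M * rpow_opp (S p) (delta / 2)) with (4 * (K' * M) * y p) by (unfold y; ring).
  apply (Ccv_dist_le (dsum a s) _ _ _ p); [|exact HT].
  apply is_series_Csum; [exact Ha|unfold half_plane; lra].
Qed.

Lemma Hinf_plus_intro (a : nat -> C) (f : C -> C) :
  dirichlet_rep a f -> (forall eps, 0 < eps -> exists M, bounded_on f eps M) -> Hinf_plus f.
Proof.
  intros Ha HM. split; [apply (dirichlet_rep_holomorphic a); exact Ha|].
  split; [exact HM|]. exists a. exact Ha.
Qed.

Lemma Hinf_plus_bounded (f : C -> C) (eps : R) :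
  Hinf_plus f -> 0 < eps -> exists M, 0 <= M /\ bounded_on f eps M.
Proof.
  intros [_ [H _]] He. destruct (H eps He) as [M HM]. exists M.
  split; [apply (bounded_on_ge_0 f eps); exact HM|exact HM].
Qed.

Lemma dirichlet_rep_ext (a : nat -> C) (f g : C -> C) :
  eq_C0 f g -> dirichlet_rep a f -> dirichlet_rep a g.
Proof. intros E H s Hs. rewrite <- (E s Hs). apply H. exact Hs. Qed.

Lemma Hinf_plus_ext (f g : C -> C) : eq_C0 f g -> Hinf_plus f -> Hinf_plus g.
Proof.
  intros E [_ [HM [a Ha]]]. apply (Hinf_plus_intro a).
  - apply (dirichlet_rep_ext a f); assumption.
  - intros eps He. destruct (HM eps He) as [M K]. exists M. intros s Hs.
    rewrite <- E; [apply K; exact Hs|]. apply (half_plane_0 eps); assumption.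
Qed.

Lemma dirichlet_rep_plus (a b : nat -> C) (f g : C -> C) :
  dirichlet_rep a f -> dirichlet_rep b g ->
  dirichlet_rep (fun n => Cplus (a n) (b n)) (fun s => Cplus (f s) (g s)).
Proof.
  intros Ha Hb s Hs. apply is_series_C.
  apply Ccv_ext with (fun n => Cplus (dsum a s n) (dsum b s n)).
  - intros n. rewrite <- Csum_plus. apply Csum_ext. intros k _. unfold dirichlet_term. ring.
  - apply Ccv_plus; apply is_series_Csum; assumption.
Qed.

Lemma dirichlet_rep_scal (z : C) (a : nat -> C) (f : C -> C) :
  dirichlet_rep a f -> dirichlet_rep (fun n => Cmult z (a n)) (fun s => Cmult z (f s)).
Proof.
  intros Ha s Hs. apply is_series_C.
  apply Ccv_ext with (fun n => Cmult z (dsum a s n)).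
  - intros n. rewrite <- Csum_scal. apply Csum_ext. intros k _. unfold dirichlet_term. ring.
  - apply Ccv_scal. apply is_series_Csum; assumption.
Qed.

Lemma dirichlet_rep_minus (a b : nat -> C) (f g : C -> C) :
  dirichlet_rep a f -> dirichlet_rep b g ->
  dirichlet_rep (fun n => Cminus (a n) (b n)) (fun s => Cminus (f s) (g s)).
Proof.
  intros Ha Hb s Hs. apply is_series_C.
  apply Ccv_ext with (fun n => Cminus (dsum a s n) (dsum b s n)).
  - intros n. rewrite <- Csum_minus. apply Csum_ext. intros k _. unfold dirichlet_term. ring.
  - apply Ccv_minus; apply is_series_Csum; assumption.
Qed.

Lemma Hinf_plus_plus (f g : C -> C) :
  Hinf_plus f -> Hinf_plus g -> Hinf_plus (fun s => Cplus (f s) (g s)).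
Proof.
  intros Hf Hg. pose proof Hf as [_ [_ [a Ha]]]. pose proof Hg as [_ [_ [b Hb]]].
  apply (Hinf_plus_intro _ _ (dirichlet_rep_plus a b f g Ha Hb)).
  intros eps He. destruct (Hinf_plus_bounded f eps Hf He) as [M [_ HM]].
  destruct (Hinf_plus_bounded g eps Hg He) as [N [_ HN]].
  exists (M + N). intros s Hs. eapply Rle_trans; [apply Cmod_triangle|].
  apply Rplus_le_compat; auto.
Qed.

Lemma Hinf_plus_scal (z : C) (f : C -> C) :
  Hinf_plus f -> Hinf_plus (fun s => Cmult z (f s)).
Proof.
  intros Hf. pose proof Hf as [_ [_ [a Ha]]].
  apply (Hinf_plus_intro _ _ (dirichlet_rep_scal z a f Ha)).
  intros eps He. destruct (Hinf_plus_bounded f eps Hf He) as [M [_ HM]].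
  exists (Cmod z * M). intros s Hs. rewrite Cmod_mult.
  apply Rmult_le_compat_l; [apply Cmod_ge_0|auto].
Qed.

Lemma Hinf_plus_minus (f g : C -> C) :
  Hinf_plus f -> Hinf_plus g -> Hinf_plus (fun s => Cminus (f s) (g s)).
Proof.
  intros Hf Hg.
  apply (Hinf_plus_ext (fun s => Cplus (f s) (Cmult (Copp (RtoC 1)) (g s)))).
  - intros s _. ring.
  - apply Hinf_plus_plus; [exact Hf|apply Hinf_plus_scal; exact Hg].
Qed.

Definition delta_coef (n m : nat) : C := if (m =? n)%nat then RtoC 1 else RtoC 0.

Lemma dirichlet_rep_npow (n : nat) : (1 <= n)%nat -> dirichlet_rep (delta_coef n) (npow_opp n).
Proof.
  intros Hn s Hs. apply is_series_C. intros eta He. exists n. intros m Hm.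
  replace (dsum (delta_coef n) s m) with (npow_opp n s).
  { replace (Cminus (npow_opp n s) (npow_opp n s)) with (RtoC 0) by ring.
    rewrite Cmod_0. exact He. }
  assert (H0 : forall k, (S k <> n)%nat -> dirichlet_term (delta_coef n) s k = RtoC 0).
  { intros k Hk. unfold dirichlet_term, delta_coef.
    apply Nat.eqb_neq in Hk. rewrite Hk. ring. }
  assert (H1 : forall j, (j < n)%nat -> dsum (delta_coef n) s j = RtoC 0).
  { induction j as [|j IH]; intros Hj; [reflexivity|].
    simpl. rewrite IH, H0 by lia. ring. }
  induction Hm as [|m Hm IH].
  - destruct n as [|k]; [lia|]. simpl Csum. rewrite H1 by lia.
    unfold dirichlet_term, delta_coef. rewrite Nat.eqb_refl. ring.
  - simpl. rewrite <- IH, H0 by lia. ring.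
Qed.

Lemma npow_opp_bounded (n : nat) (theta : R) : 0 <= theta ->
  bounded_on (npow_opp n) theta (rpow_opp n theta).
Proof.
  intros Ht s Hs. rewrite Cmod_npow_opp. apply rpow_opp_antitone. unfold half_plane in Hs. lra.
Qed.

Lemma Hinf_plus_npow (n : nat) : (1 <= n)%nat -> Hinf_plus (npow_opp n).
Proof.
  intros Hn. apply (Hinf_plus_intro _ _ (dirichlet_rep_npow n Hn)).
  intros eps He. exists (rpow_opp n eps). apply npow_opp_bounded. lra.
Qed.

Lemma Hinf_plus_const (z : C) : Hinf_plus (fun _ => z).
Proof.
  apply (Hinf_plus_ext (fun s => Cmult z (npow_opp 1 s))).
  - intros s _. rewrite npow_opp_1. ring.
  - apply Hinf_plus_scal, Hinf_plus_npow. lia.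
Qed.

Lemma Hinf_plus_Csum (F : nat -> C -> C) (n : nat) :
  (forall k, Hinf_plus (F k)) -> Hinf_plus (fun s => Csum (fun k => F k s) n).
Proof.
  intros H. induction n as [|n IH]; simpl; [apply Hinf_plus_const|].
  apply Hinf_plus_plus; auto.
Qed.

Lemma Ccv_Csum (u : nat -> nat -> C) (l : nat -> C) (n : nat) :
  (forall k, Ccv (fun j => u j k) (l k)) -> Ccv (fun j => Csum (u j) n) (Csum l n).
Proof.
  intros H. induction n as [|n IH]; simpl; [apply Ccv_const|]. apply Ccv_plus; auto.
Qed.

Lemma inv_INR_lt (x : R) : 0 < x -> exists N, forall k, (N <= k)%nat -> / (INR k + 1) < x.
Proof.
  intros Hx. destruct (INR_unbounded (/ x)) as [N HN]. exists N. intros k Hk.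
  apply le_INR in Hk. rewrite <- (Rinv_inv x). assert (0 < / x) by (apply Rinv_0_lt_compat; exact Hx).
  apply Rinv_lt_contravar; [|lra]. apply Rmult_lt_0_compat; lra.
Qed.

Lemma Hinf_plus_closed (f : C -> C) :
  (forall eps eta, 0 < eps -> 0 < eta -> exists g, Hinf_plus g /\
     bounded_on (fun s => Cminus (g s) (f s)) eps eta) -> Hinf_plus f.
Proof.
  intros H.
  assert (Hpos : forall k, 0 < / (INR k + 1)).
  { intros k. apply Rinv_0_lt_compat. pose proof (pos_INR k). lra. }
  destruct (functional_choice nat (C -> C) _
    (fun k => H (/ (INR k + 1)) (/ (INR k + 1)) (Hpos k) (Hpos k))) as [F HF].
  destruct (functional_choice nat (nat -> C) _
    (fun k => proj2 (proj2 (proj1 (HF k))))) as [A HA].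
  destruct (coef_bound 1 ltac:(lra)) as [K [HK HC]].
  assert (Hle1 : forall k, / (INR k + 1) <= 1).
  { intros k. rewrite <- Rinv_1. apply Rinv_le_contravar; [lra|]. pose proof (pos_INR k). lra. }
  assert (HCau : forall n, exists l, Ccv (fun k => A k (S n)) l).
  { intros n. apply Ccv_Cauchy. intros eta He.
    pose proof (rpow_opp_pos (S n) (1 + 1)) as HP.
    destruct (inv_INR_lt (eta * rpow_opp (S n) (1 + 1) / (2 * K))) as [N HN].
    { apply Rdiv_lt_0_compat; nra. }
    exists N. intros k l Hk Hl.
    assert (HB : bounded_on (fun s => Cminus (F l s) (F k s)) 1 (/ (INR l + 1) + / (INR k + 1))).
    { intros s Hs. eapply Rle_trans; [apply (Cmod_minus_triangle _ (f s))|].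
      apply Rplus_le_compat; [|rewrite Cmod_minus_sym]; apply HF;
        (eapply half_plane_weaken; [apply Hle1|exact Hs]). }
    pose proof (HC _ _ 1 _ (dirichlet_rep_minus _ _ _ _ (HA l) (HA k)) ltac:(lra) HB
      (S n) ltac:(lia)) as B.
    cbv beta in B.
    pose proof (HN k ltac:(lia)) as B1. pose proof (HN l ltac:(lia)) as B2.
    apply Rlt_div_r in B1; [|lra]. apply Rlt_div_r in B2; [|lra]. nra. }
  destruct (functional_choice nat C _ HCau) as [b Hb].
  set (a := fun n => b (pred n)).
  assert (Ha : forall n, Ccv (fun k => A k (S n)) (a (S n))) by exact Hb.
  assert (Hbd : forall eps, 0 < eps -> exists M k0, 0 <= M /\ bounded_on f eps M /\
     forall k, (k0 <= k)%nat -> bounded_on (F k) eps M).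
  { intros eps He. destruct (inv_INR_lt eps He) as [k0 Hk0].
    destruct (Hinf_plus_bounded (F k0) eps (proj1 (HF k0)) He) as [M [HM0 HM]].
    assert (Hf : bounded_on f eps (M + 1)).
    { intros s Hs. eapply Rle_trans; [apply (Cmod_le_minus _ (F k0 s))|].
      apply Rplus_le_compat; [apply HM; exact Hs|]. rewrite Cmod_minus_sym.
      eapply Rle_trans; [apply HF|apply Hle1].
      eapply half_plane_weaken; [left; apply (Hk0 k0); lia|exact Hs]. }
    exists (M + 2), k0. split; [lra|]. split.
    - intros s Hs. specialize (Hf s Hs). lra.
    - intros k Hk s Hs. eapply Rle_trans; [apply (Cmod_le_minus _ (f s))|].
      specialize (Hf s Hs).
      assert (Cmod (Cminus (F k s) (f s)) <= 1).
      { eapply Rle_trans; [apply HF|apply Hle1].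
        eapply half_plane_weaken; [left; apply (Hk0 k); lia|exact Hs]. }
      lra. }
  apply (Hinf_plus_intro a).
  - intros s Hs. apply is_series_C. unfold half_plane in Hs.
    set (e := Re s / 3). assert (He : 0 < e) by (unfold e; lra).
    assert (Hs2 : half_plane (e + e) s) by (unfold half_plane, e; lra).
    destruct (bohr_tail e He) as [K2 [HK2 HT]].
    destruct (Hbd e He) as [M [k0 [HM0 [_ HM]]]].
    assert (HFs : Ccv (fun k => F k s) (f s)).
    { intros eta Heta. destruct (inv_INR_lt (Rmin eta (Re s))) as [N HN].
      { apply Rmin_pos; lra. }
      exists N. intros k Hk. specialize (HN k Hk).
      assert (/ (INR k + 1) < eta) by (eapply Rlt_le_trans; [exact HN|apply Rmin_l]).
      assert (/ (INR k + 1) < Re s) by (eapply Rlt_le_trans; [exact HN|apply Rmin_r]).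
      eapply Rle_lt_trans; [apply HF; assumption|assumption]. }
    assert (HB : forall p, Cmod (Cminus (f s) (dsum a s p))
       <= K2 * M * rpow_opp (S p) (e / 2)).
    { intros p.
      apply (Ccv_bound (fun k => Cminus (F k s) (dsum (A k) s p)) _ _ k0).
      - apply Ccv_minus; [exact HFs|].
        apply (Ccv_Csum (fun j => dirichlet_term (A j) s)). intros k.
        apply Ccv_ext with (fun j => Cmult (npow_opp (S k) s) (A j (S k))).
        + intros j. unfold dirichlet_term. ring.
        + unfold dirichlet_term. rewrite Cmult_comm. apply Ccv_scal. apply Ha.
      - intros k Hk.
        apply (HT _ _ e); [apply HA|exact He|apply HM; exact Hk|exact Hs2]. }
    intros eta Heta.
    destruct (rpow_opp_small (e / 2) (K2 * M) eta ltac:(lra) ltac:(nra) Heta) as [N [_ HN]].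
    exists N. intros n Hn. rewrite Cmod_minus_sym. eapply Rle_lt_trans; [apply HB|].
    apply HN. lia.
  - intros eps He. destruct (Hbd eps He) as [M [_ [_ [HM _]]]]. exists M. exact HM.
Qed.

Lemma Hinf_plus_approx (a : nat -> C) (f : C -> C) (eps eta : R) :
  Hinf_plus f -> dirichlet_rep a f -> 0 < eps -> 0 < eta ->
  exists N, bounded_on (fun s => Cminus (dsum a s N) (f s)) eps eta.
Proof.
  intros Hf Ha He Heta.
  destruct (bohr_tail (eps / 2) ltac:(lra)) as [K [HK HT]].
  destruct (Hinf_plus_bounded f (eps / 2) Hf ltac:(lra)) as [M [HM0 HM]].
  destruct (rpow_opp_small (eps / 2 / 2) (K * M) eta ltac:(lra) ltac:(nra) Heta) as [N [_ HN]].
  exists N. intros s Hs. rewrite Cmod_minus_sym.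
  eapply Rle_trans; [apply (HT a f (eps / 2) M Ha ltac:(lra) HM)|].
  - unfold half_plane in *. lra.
  - left. apply HN. lia.
Qed.

Lemma Hinf_plus_npow_mult (n : nat) (f : C -> C) : (1 <= n)%nat -> Hinf_plus f ->
  Hinf_plus (fun s => Cmult (npow_opp n s) (f s)).
Proof.
  intros Hn Hf. pose proof Hf as [_ [_ [a Ha]]].
  apply Hinf_plus_closed. intros eps eta He Heta.
  destruct (Hinf_plus_approx a f eps eta Hf Ha He Heta) as [N HN].
  exists (fun s => Csum (fun k => Cmult (a (S k)) (npow_opp (n * S k) s)) N). split.
  - apply Hinf_plus_Csum. intros k. apply Hinf_plus_scal, Hinf_plus_npow. nia.
  - intros s Hs.
    rewrite (Csum_ext _ (fun k => Cmult (npow_opp n s) (dirichlet_term a s k))).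
    2: { intros k _. rewrite npow_opp_mult by lia. unfold dirichlet_term. ring. }
    rewrite Csum_scal.
    replace (Cminus (Cmult (npow_opp n s) (dsum a s N)) (Cmult (npow_opp n s) (f s)))
      with (Cmult (npow_opp n s) (Cminus (dsum a s N) (f s))) by ring.
    rewrite Cmod_mult. specialize (HN s Hs). cbv beta in HN.
    assert (Cmod (npow_opp n s) <= 1).
    { rewrite Cmod_npow_opp. apply rpow_opp_le_1. unfold half_plane in Hs. lra. }
    pose proof (Cmod_ge_0 (npow_opp n s)).
    pose proof (Cmod_ge_0 (Cminus (dsum a s N) (f s))). nra.
Qed.

Lemma Hinf_plus_mult (f g : C -> C) : Hinf_plus f -> Hinf_plus g ->
  Hinf_plus (fun s => Cmult (f s) (g s)).
Proof.
  intros Hf Hg. pose proof Hf as [_ [_ [a Ha]]].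
  apply Hinf_plus_closed. intros eps eta He Heta.
  destruct (Hinf_plus_bounded g eps Hg He) as [M [HM0 HM]].
  destruct (Hinf_plus_approx a f eps (eta / (M + 1)) Hf Ha He) as [N HN].
  { apply Rdiv_lt_0_compat; lra. }
  exists (fun s => Csum (fun k => Cmult (a (S k)) (Cmult (npow_opp (S k) s) (g s))) N). split.
  - apply (Hinf_plus_Csum (fun k s => Cmult (a (S k)) (Cmult (npow_opp (S k) s) (g s)))).
    intros k. apply Hinf_plus_scal, Hinf_plus_npow_mult; [lia|exact Hg].
  - intros s Hs.
    rewrite (Csum_ext _ (fun k => Cmult (g s) (dirichlet_term a s k))).
    2: { intros k _. unfold dirichlet_term. ring. }
    rewrite Csum_scal.
    replace (Cminus (Cmult (g s) (dsum a s N)) (Cmult (f s) (g s)))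
      with (Cmult (g s) (Cminus (dsum a s N) (f s))) by ring.
    rewrite Cmod_mult. specialize (HN s Hs). cbv beta in HN. specialize (HM s Hs).
    apply Rle_div_r in HN; [|lra].
    pose proof (Cmod_ge_0 (g s)).
    pose proof (Cmod_ge_0 (Cminus (dsum a s N) (f s))). nra.
Qed.

Lemma Hinf_plus_pow (f : C -> C) (n : nat) : Hinf_plus f -> Hinf_plus (fun s => Cpow (f s) n).
Proof.
  intros Hf. induction n as [|n IH]; simpl; [apply Hinf_plus_const|].
  apply Hinf_plus_mult; assumption.
Qed.

Lemma Cpow_diff_le (x y : C) (R0 : R) (n : nat) :
  0 <= R0 -> Cmod x <= R0 -> Cmod y <= R0 ->
  Cmod (Cminus (Cpow x (S n)) (Cpow y (S n))) <= INR (S n) * R0 ^ n * Cmod (Cminus x y).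
Proof.
  intros H0 Hx Hy. induction n as [|n IH].
  - simpl. rewrite !Cmult_1_r. lra.
  - replace (Cminus (Cpow x (S (S n))) (Cpow y (S (S n))))
      with (Cplus (Cmult x (Cminus (Cpow x (S n)) (Cpow y (S n))))
                  (Cmult (Cpow y (S n)) (Cminus x y))) by (simpl; ring).
    eapply Rle_trans; [apply Cmod_triangle|]. rewrite !Cmod_mult, Cmod_pow.
    pose proof (Cmod_ge_0 (Cminus x y)) as HD.
    assert (P : Cmod y ^ S n <= R0 ^ S n) by (apply pow_incr; split; [apply Cmod_ge_0|exact Hy]).
    rewrite (S_INR (S n)).
    replace ((INR (S n) + 1) * R0 ^ S n * Cmod (Cminus x y))
      with (R0 * (INR (S n) * R0 ^ n * Cmod (Cminus x y)) + R0 ^ S n * Cmod (Cminus x y))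
      by (simpl pow; ring).
    apply Rplus_le_compat; [|apply Rmult_le_compat_r; assumption].
    apply Rmult_le_compat; try apply Cmod_ge_0; assumption.
Qed.

Lemma exp_pow_INR (x : R) (n : nat) : exp x ^ n = exp (INR n * x).
Proof.
  induction n as [|n IH]; [simpl; rewrite Rmult_0_l, exp_0; reflexivity|].
  rewrite S_INR. simpl pow. rewrite IH, <- exp_plus. f_equal. ring.
Qed.

Lemma Cexp_limit (z : C) (M : R) (n : nat) : Cmod z <= M ->
  Cmod (Cminus (Cpow (Cplus (RtoC 1) (Cmult (RtoC (/ INR (S n))) z)) (S n)) (Cexp z))
    <= M ^ 2 * exp M * / INR (S n).
Proof.
  intros HM.
  assert (HN : 0 < INR (S n)) by (apply lt_0_INR; lia).
  set (i := / INR (S n)). assert (Hi : 0 < i) by (apply Rinv_0_lt_compat; exact HN).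
  set (w := Cmult (RtoC i) z).
  assert (HM0 : 0 <= M) by (eapply Rle_trans; [apply Cmod_ge_0|exact HM]).
  assert (Hw : Cmod w <= i * M).
  { unfold w. rewrite Cmod_mult, Cmod_R, Rabs_right by lra. apply Rmult_le_compat_l; lra. }
  pose proof (Cmod_ge_0 w) as Hw0.
  replace (Cexp z) with (Cpow (Cexp w) (S n)).
  2: { rewrite Cexp_Cpow. f_equal. unfold w. rewrite Cmult_assoc, <- RtoC_mult.
       unfold i. rewrite Rinv_r by lra. ring. }
  eapply Rle_trans; [apply (Cpow_diff_le _ _ (exp (i * M)))|].
  - left; apply exp_pos.
  - eapply Rle_trans; [apply Cmod_triangle|]. rewrite Cmod_1.
    pose proof (exp_ineq1_le (i * M)). lra.
  - rewrite Cmod_Cexp. apply exp_le. eapply Rle_trans; [apply re_le_Cmod'|exact Hw].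
  - assert (HT : Cmod (Cminus (Cplus (RtoC 1) w) (Cexp w)) <= (i * M) ^ 2 * exp (i * M)).
    { rewrite Cmod_minus_sym.
      replace (Cminus (Cexp w) (Cplus (RtoC 1) w)) with (Cminus (Cminus (Cexp w) (RtoC 1)) w) by ring.
      eapply Rle_trans; [apply Cmod_Cexp_taylor|].
      apply Rmult_le_compat; [apply pow_le; exact Hw0|left; apply exp_pos| |apply exp_le; exact Hw].
      apply pow_incr. lra. }
    assert (HE : exp (i * M) ^ n * exp (i * M) = exp M).
    { replace (exp (i * M) ^ n * exp (i * M)) with (exp (i * M) ^ S n) by (simpl; ring).
      rewrite exp_pow_INR. f_equal. unfold i. field. lra. }
    apply Rle_trans with (INR (S n) * exp (i * M) ^ n * ((i * M) ^ 2 * exp (i * M))).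
    + apply Rmult_le_compat_l; [|exact HT].
      apply Rmult_le_pos; [lra|]. apply pow_le. left; apply exp_pos.
    + apply Req_le. rewrite <- HE. unfold i. field. lra.
Qed.

Lemma Hinf_plus_Cexp (f : C -> C) : Hinf_plus f -> Hinf_plus (fun s => Cexp (f s)).
Proof.
  intros Hf. apply Hinf_plus_closed. intros eps eta He Heta.
  destruct (Hinf_plus_bounded f eps Hf He) as [M [HM0 HM]].
  assert (HP : 0 <= M ^ 2 * exp M).
  { apply Rmult_le_pos; [apply pow2_ge_0|left; apply exp_pos]. }
  destruct (inv_INR_lt (eta / (M ^ 2 * exp M + 1))) as [N HN].
  { apply Rdiv_lt_0_compat; lra. }
  exists (fun s => Cpow (Cplus (RtoC 1) (Cmult (RtoC (/ INR (S N))) (f s))) (S N)). split.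
  - apply (Hinf_plus_pow (fun s => Cplus (RtoC 1) (Cmult (RtoC (/ INR (S N))) (f s)))).
    apply Hinf_plus_plus; [apply Hinf_plus_const|apply Hinf_plus_scal; exact Hf].
  - intros s Hs. eapply Rle_trans; [apply (Cexp_limit _ M); apply HM; exact Hs|].
    specialize (HN N ltac:(lia)). rewrite <- S_INR in HN. apply Rlt_div_r in HN; [|lra].
    assert (0 < / INR (S N)) by (apply Rinv_0_lt_compat; apply lt_0_INR; lia). lra.
Qed.

(** * Leading coefficients and symbols with positive real part *)

Lemma Rsum_inv_squares (p : nat) : Rsum (fun k => rpow_opp (S k) 2) p <= 2.
Proof.
  apply Rle_trans with (Rsum (fun k => / (INR k + / 2) - / (INR (S k) + / 2)) p).
  - apply Rsum_le. intros k _. rewrite S_INR. pose proof (pos_INR k) as Hk.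
    assert (E : rpow_opp (S k) 2 = / ((INR k + 1) * (INR k + 1))).
    { unfold rpow_opp. rewrite S_INR.
      replace (- (2 * ln (INR k + 1))) with (- ln (INR k + 1) + - ln (INR k + 1)) by ring.
      rewrite exp_plus, exp_Ropp, exp_ln by lra. field. lra. }
    rewrite E.
    replace (/ (INR k + / 2) - / (INR k + 1 + / 2))
      with (/ ((INR k + / 2) * (INR k + 1 + / 2))) by (field; lra).
    apply Rinv_le_contravar; nra.
  - rewrite (Rsum_telescope (fun k => / (INR k + / 2))). simpl INR.
    assert (0 < / (INR p + / 2)) by (apply Rinv_0_lt_compat; pose proof (pos_INR p); lra).
    replace (/ (0 + / 2)) with 2 by field. lra.
Qed.

Lemma low_tail (N : nat) : (1 <= N)%nat -> exists K : R, 0 < K /\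
  forall (a : nat -> C) (f : C -> C) (M : R),
  dirichlet_rep a f -> bounded_on f 1 M -> (forall m, (1 <= m < N)%nat -> a m = RtoC 0) ->
  forall s, 1 < Re s -> Cmod (f s) <= K * M * rpow_opp N (Re s).
Proof.
  intros HN. destruct (coef_bound 1 ltac:(lra)) as [K [HK HC]].
  exists ((2 * K + 1) * rpow_opp N (-4)).
  pose proof (rpow_opp_pos N (-4)) as HP. split; [nra|].
  intros a f M Ha HM Hz s Hs.
  pose proof (bounded_on_ge_0 f 1 M HM) as HM0.
  replace ((2 * K + 1) * rpow_opp N (-4) * M * rpow_opp N (Re s))
    with ((2 * K + 1) * M * rpow_opp N (Re s + -4)) by (rewrite rpow_opp_plus; ring).
  pose proof (rpow_opp_pos N (Re s + -4)) as HP1.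
  destruct (Rle_lt_dec 4 (Re s)) as [h|h].
  - assert (Hs0 : half_plane 0 s) by (unfold half_plane; lra).
    apply (Ccv_bound (dsum a s) _ _ O); [apply is_series_Csum; assumption|].
    intros p _. eapply Rle_trans; [apply Cmod_Csum|].
    apply Rle_trans with (Rsum (fun k => K * M * rpow_opp N (Re s + -4) * rpow_opp (S k) 2) p).
    + apply Rsum_le. intros k _. unfold dirichlet_term. rewrite Cmod_mult, Cmod_npow_opp.
      pose proof (rpow_opp_pos (S k) 2) as HP2.
      assert (HKM : 0 <= K * M) by nra.
      destruct (le_lt_dec N (S k)) as [Hk|Hk].
      * pose proof (HC a f 1 M Ha ltac:(lra) HM (S k) ltac:(lia)) as HB.
        assert (E : rpow_opp (S k) (Re s)
          = rpow_opp (S k) (1 + 1) * (rpow_opp (S k) (Re s + -4) * rpow_opp (S k) 2)).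
        { rewrite <- !rpow_opp_plus. f_equal. ring. }
        rewrite E, <- Rmult_assoc.
        assert (HL : rpow_opp (S k) (Re s + -4) <= rpow_opp N (Re s + -4))
          by (apply rpow_opp_le_base; [lia|lia|lra]).
        pose proof (rpow_opp_pos (S k) (Re s + -4)) as HP3.
        apply Rle_trans with (K * M * (rpow_opp (S k) (Re s + -4) * rpow_opp (S k) 2)).
        -- apply Rmult_le_compat_r; [|exact HB]. nra.
        -- rewrite (Rmult_assoc (K * M)). apply Rmult_le_compat_l; [exact HKM|].
           apply Rmult_le_compat_r; lra.
      * rewrite (Hz (S k)) by lia. rewrite Cmod_0, Rmult_0_l.
        apply Rmult_le_pos; [|lra]. apply Rmult_le_pos; lra.
    + rewrite Rsum_scal. pose proof (Rsum_inv_squares p) as HS.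
      assert (HKM : 0 <= K * M * rpow_opp N (Re s + -4)).
      { apply Rmult_le_pos; [nra|lra]. }
      apply Rle_trans with (K * M * rpow_opp N (Re s + -4) * 2).
      * apply Rmult_le_compat_l; assumption.
      * assert (0 <= M * rpow_opp N (Re s + -4)) by (apply Rmult_le_pos; lra). nra.
  - specialize (HM s Hs).
    assert (1 <= rpow_opp N (Re s + -4)).
    { rewrite <- (rpow_opp_0 N). apply rpow_opp_antitone. lra. }
    assert (M <= (2 * K + 1) * M) by nra.
    assert (0 <= (2 * K + 1) * M) by nra. nra.
Qed.

Lemma lead (N : nat) (a : nat -> C) (f : C -> C) :
  (1 <= N)%nat -> Hinf_plus f -> dirichlet_rep a f ->
  (forall m, (1 <= m < N)%nat -> a m = RtoC 0) ->
  exists K, 0 <= K /\ forall s, 1 < Re s ->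
    Cmod (Cminus (f s) (Cmult (a N) (npow_opp N s))) <= K * rpow_opp (S N) (Re s).
Proof.
  intros HN Hf Ha Hz.
  destruct (low_tail (S N) ltac:(lia)) as [K [HK HT]].
  set (g := fun s => Cminus (f s) (Cmult (a N) (npow_opp N s))).
  assert (Hg : Hinf_plus g).
  { apply Hinf_plus_minus; [exact Hf|apply Hinf_plus_scal, Hinf_plus_npow; exact HN]. }
  destruct (Hinf_plus_bounded g 1 Hg ltac:(lra)) as [M [HM0 HM]].
  exists (K * M). split; [nra|]. intros s Hs.
  apply (HT (fun n => Cminus (a n) (Cmult (a N) (delta_coef N n))) g M).
  - apply dirichlet_rep_minus; [exact Ha|].
    apply dirichlet_rep_scal. apply dirichlet_rep_npow. exact HN.
  - exact HM.
  - intros m Hm. unfold delta_coef. destruct (Nat.eq_dec m N) as [->|Hne].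
    + rewrite Nat.eqb_refl. ring.
    + rewrite Hz by lia. apply Nat.eqb_neq in Hne. rewrite Hne. ring.
  - exact Hs.
Qed.

Definition tends_to_infinity (s_ : nat -> C) : Prop :=
  forall x : R, exists N : nat, forall n : nat, (N <= n)%nat -> x < Re (s_ n).

Definition real_points (n : nat) : C := RtoC (INR n + 1).

Lemma real_points_tends : tends_to_infinity real_points.
Proof.
  intros x. destruct (INR_unbounded x) as [N HN]. exists N. intros n Hn.
  apply le_INR in Hn. unfold real_points. change (x < INR n + 1). lra.
Qed.

Lemma real_points_half_plane (n : nat) : half_plane 0 (real_points n).
Proof. unfold half_plane. change (0 < INR n + 1). pose proof (pos_INR n). lra. Qed.

Lemma npow_opp_opp (n : nat) (s : C) : Cmult (npow_opp n s) (npow_opp n (Copp s)) = RtoC 1.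
Proof. rewrite <- npow_opp_plus, Cplus_opp_r. apply npow_opp_0. Qed.

Lemma rpow_ratio_small (m N : nat) (K eta : R) (s_ : nat -> C) :
  (1 <= m)%nat -> (m < N)%nat -> 0 <= K -> 0 < eta -> tends_to_infinity s_ ->
  exists k0, forall k, (k0 <= k)%nat ->
    rpow_opp m (- Re (s_ k)) * (K * rpow_opp N (Re (s_ k))) < eta.
Proof.
  intros Hm HN HK He Hs.
  set (b := ln (INR N) - ln (INR m)).
  assert (Hb : 0 < b).
  { unfold b. assert (ln (INR m) < ln (INR N)); [|lra].
    apply ln_increasing; [apply lt_0_INR; lia|apply lt_INR; lia]. }
  destruct (Hs (- ln (eta / (K + 1)) / b)) as [k0 Hk0].
  exists k0. intros k Hk. specialize (Hk0 k Hk).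
  apply Rlt_div_l in Hk0; [|exact Hb].
  replace (rpow_opp m (- Re (s_ k)) * (K * rpow_opp N (Re (s_ k))))
    with (K * exp (- (Re (s_ k) * b))).
  2: { unfold rpow_opp, b. rewrite (Rmult_comm (exp _)), Rmult_assoc, <- exp_plus.
       f_equal. f_equal. ring. }
  assert (HE : exp (- (Re (s_ k) * b)) < eta / (K + 1)).
  { rewrite <- (exp_ln (eta / (K + 1))) by (apply Rdiv_lt_0_compat; lra).
    apply exp_increasing. lra. }
  apply Rlt_div_r in HE; [|lra]. pose proof (exp_pos (- (Re (s_ k) * b))). nra.
Qed.

Lemma lead_lim (N : nat) (a : nat -> C) (f : C -> C) (s_ : nat -> C) :
  (1 <= N)%nat -> Hinf_plus f -> dirichlet_rep a f ->
  (forall m, (1 <= m < N)%nat -> a m = RtoC 0) -> tends_to_infinity s_ ->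
  Ccv (fun k => Cmult (npow_opp N (Copp (s_ k))) (f (s_ k))) (a N).
Proof.
  intros HN Hf Ha Hz Hs eta He.
  destruct (lead N a f HN Hf Ha Hz) as [K [HK HL]].
  destruct (rpow_ratio_small N (S N) K eta s_ HN ltac:(lia) HK He Hs) as [k1 H1].
  destruct (Hs 1) as [k2 H2].
  exists (max k1 k2). intros k Hk.
  specialize (H1 k ltac:(lia)). specialize (H2 k ltac:(lia)).
  replace (Cminus (Cmult (npow_opp N (Copp (s_ k))) (f (s_ k))) (a N))
    with (Cmult (npow_opp N (Copp (s_ k)))
       (Cminus (f (s_ k)) (Cmult (a N) (npow_opp N (s_ k))))).
  - rewrite Cmod_mult, Cmod_npow_opp. change (Re (Copp (s_ k))) with (- Re (s_ k)).
    eapply Rle_lt_trans; [|exact H1].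
    apply Rmult_le_compat_l; [left; apply rpow_opp_pos|]. apply HL. exact H2.
  - transitivity (Cminus (Cmult (npow_opp N (Copp (s_ k))) (f (s_ k)))
      (Cmult (a N) (Cmult (npow_opp N (s_ k)) (npow_opp N (Copp (s_ k)))))); [ring|].
    rewrite npow_opp_opp. ring.
Qed.

Lemma coef_of_limit (N : nat) (b : nat -> C) (g : C -> C) (L : C) :
  (1 <= N)%nat -> Hinf_plus g -> dirichlet_rep b g ->
  Ccv (fun k => Cmult (npow_opp N (Copp (real_points k))) (g (real_points k))) L ->
  (forall m, (1 <= m < N)%nat -> b m = RtoC 0) /\ b N = L.
Proof.
  intros HN Hg Hb HL.
  destruct (Ccv_bounded _ _ HL) as [K HK].
  assert (HK0 : 0 <= K) by (eapply Rle_trans; [apply Cmod_ge_0|apply (HK O)]).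
  assert (Hbd : forall k, Cmod (g (real_points k)) <= K * rpow_opp N (Re (real_points k))).
  { intros k. specialize (HK k). cbv beta in HK.
    replace (g (real_points k)) with (Cmult (npow_opp N (real_points k))
      (Cmult (npow_opp N (Copp (real_points k))) (g (real_points k)))).
    - rewrite Cmod_mult, Cmod_npow_opp, Rmult_comm.
      apply Rmult_le_compat_r; [left; apply rpow_opp_pos|exact HK].
    - rewrite Cmult_assoc, npow_opp_opp. ring. }
  assert (HZ : forall m, (1 <= m < N)%nat -> b m = RtoC 0).
  { induction m as [m IH] using (well_founded_induction lt_wf). intros Hm.
    apply (Ccv_unique (fun k => Cmult (npow_opp m (Copp (real_points k))) (g (real_points k)))).
    - apply lead_lim; [lia|exact Hg|exact Hb| |apply real_points_tends].
      intros j Hj. apply IH; lia.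
    - intros eta He.
      destruct (rpow_ratio_small m N K eta real_points ltac:(lia) ltac:(lia) HK0 He
        real_points_tends) as [k0 H0].
      exists k0. intros k Hk.
      replace (Cminus (Cmult (npow_opp m (Copp (real_points k))) (g (real_points k))) (RtoC 0))
        with (Cmult (npow_opp m (Copp (real_points k))) (g (real_points k))) by ring.
      rewrite Cmod_mult, Cmod_npow_opp.
      change (Re (Copp (real_points k))) with (- Re (real_points k)).
      eapply Rle_lt_trans; [|apply (H0 k Hk)].
      apply Rmult_le_compat_l; [left; apply rpow_opp_pos|apply Hbd]. }
  split; [exact HZ|].
  apply (Ccv_unique (fun k => Cmult (npow_opp N (Copp (real_points k))) (g (real_points k)))).
  - apply lead_lim; [exact HN|exact Hg|exact Hb|exact HZ|apply real_points_tends].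
  - exact HL.
Qed.

Lemma dirichlet_rep_unique (a b : nat -> C) (f g : C -> C) :
  Hinf_plus f -> eq_C0 f g -> dirichlet_rep a f -> dirichlet_rep b g ->
  forall n, (1 <= n)%nat -> a n = b n.
Proof.
  intros Hf E Ha Hb n Hn.
  apply (dirichlet_rep_ext b g f) in Hb; [|intros s Hs; symmetry; apply E; exact Hs].
  pose proof (dirichlet_rep_minus a b f f Ha Hb) as Hd.
  assert (H0 : Cminus (a n) (b n) = RtoC 0).
  { apply (coef_of_limit n (fun n => Cminus (a n) (b n)) (fun s => Cminus (f s) (f s)));
      [exact Hn|apply Hinf_plus_minus; exact Hf|exact Hd|].
    apply Ccv_ext with (fun _ => RtoC 0); [intros k; ring|apply Ccv_const]. }
  replace (a n) with (Cplus (Cminus (a n) (b n)) (b n)) by ring. rewrite H0. ring.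
Qed.

Lemma Ccv_Re_ge_0 (u : nat -> C) (l : C) : Ccv u l -> (forall n, 0 <= Re (u n)) -> 0 <= Re l.
Proof.
  intros H Hu. apply Rnot_lt_le. intros Hl.
  destruct (H (- Re l)) as [N HN]; [lra|].
  specialize (HN N (Nat.le_refl N)). specialize (Hu N).
  pose proof (re_le_Cmod' (Cminus (u N) l)) as K.
  change (Re (Cminus (u N) l)) with (Re (u N) - Re l) in K. lra.
Qed.

Section PositiveRealPart.
Variables (c : nat -> C) (psi : C -> C).
Hypothesis Hpsi : Hinf_plus psi.
Hypothesis Hc : dirichlet_rep c psi.
Hypothesis Hpos : forall s, half_plane 0 s -> half_plane 0 (psi s).

Lemma psi_lim (s_ : nat -> C) : tends_to_infinity s_ -> Ccv (fun k => psi (s_ k)) (c 1%nat).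
Proof.
  intros Hs. apply Ccv_ext with (fun k => Cmult (npow_opp 1 (Copp (s_ k))) (psi (s_ k))).
  - intros k. rewrite npow_opp_1. ring.
  - apply lead_lim; [lia|exact Hpsi|exact Hc|intros; lia|exact Hs].
Qed.

(* If [Re c_1 = 0], the first nonconstant term [c_m m^{-s}] governs the sign of
   [Re psi] far to the right, and it points in every direction along vertical
   translates; four of them suffice. *)
Lemma Re_c1_pos : 0 < Re (c 1%nat).
Proof.
  assert (H0 : 0 <= Re (c 1%nat)).
  { apply (Ccv_Re_ge_0 (fun k => psi (real_points k)));
      [apply psi_lim, real_points_tends|].
    intros k. left. apply (Hpos _ (real_points_half_plane k)). }
  destruct H0 as [H0|H0]; [exact H0|exfalso].
  assert (HZ : forall m, (2 <= m)%nat -> c m = RtoC 0).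
  { induction m as [m IH] using (well_founded_induction lt_wf). intros Hm.
    set (g := fun s => Cminus (psi s) (Cmult (c 1%nat) (npow_opp 1 s))).
    set (d := fun n => Cminus (c n) (Cmult (c 1%nat) (delta_coef 1 n))).
    assert (Hg : Hinf_plus g).
    { apply Hinf_plus_minus; [exact Hpsi|apply Hinf_plus_scal, Hinf_plus_npow; lia]. }
    assert (Hd : dirichlet_rep d g).
    { apply dirichlet_rep_minus; [exact Hc|].
      apply dirichlet_rep_scal, dirichlet_rep_npow. lia. }
    assert (Hd0 : forall j, (1 <= j < m)%nat -> d j = RtoC 0).
    { intros j Hj. unfold d, delta_coef. destruct (Nat.eq_dec j 1) as [->|Hne].
      - simpl. ring.
      - rewrite IH by lia. apply Nat.eqb_neq in Hne. rewrite Hne. ring. }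
    assert (Hdm : d m = c m).
    { unfold d, delta_coef. replace (m =? 1)%nat with false; [ring|].
      symmetry. apply Nat.eqb_neq. lia. }
    assert (HL : 0 < ln (INR m)).
    { rewrite <- ln_1. apply ln_increasing; [lra|]. apply (lt_INR 1). lia. }
    assert (HR : forall t, 0 <= Re (Cmult (Cexp (Cmult Ci (RtoC t))) (c m))).
    { intros t.
      set (it := Cmult Ci (RtoC (- (t / ln (INR m))))).
      set (s_ := fun k => Cplus (real_points k) it).
      assert (Hre : forall k, Re (s_ k) = INR k + 1).
      { intros k. unfold s_, it, real_points, Re, Cplus, Cmult, Ci, RtoC; simpl. ring. }
      assert (Hs : tends_to_infinity s_).
      { intros x. destruct (real_points_tends x) as [N HN]. exists N. intros n Hn.
        rewrite Hre. apply (HN n Hn). }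
      pose proof (lead_lim m d g s_ ltac:(lia) Hg Hd Hd0 Hs) as HC. rewrite Hdm in HC.
      assert (Hit : npow_opp m it = Cexp (Cmult Ci (RtoC t))).
      { unfold npow_opp. f_equal. unfold it. unfold Cmult, Copp, Ci, RtoC; simpl.
        f_equal; field; lra. }
      rewrite <- Hit.
      apply (Ccv_Re_ge_0 _ _ (Ccv_scal (npow_opp m it) _ _ HC)).
      intros k. unfold s_ at 1.
      replace (Copp (Cplus (real_points k) it))
        with (Cplus (Copp (real_points k)) (Copp it)) by ring.
      rewrite npow_opp_plus.
      replace (Cmult (npow_opp m it) (Cmult (Cmult (npow_opp m (Copp (real_points k)))
        (npow_opp m (Copp it))) (g (s_ k))))
        with (Cmult (Cmult (npow_opp m it) (npow_opp m (Copp it)))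
               (Cmult (npow_opp m (Copp (real_points k))) (g (s_ k)))) by ring.
      rewrite npow_opp_opp, Cmult_1_l.
      assert (Hreal : npow_opp m (Copp (real_points k)) = RtoC (rpow_opp m (- (INR k + 1)))).
      { rewrite <- npow_opp_real, RtoC_opp. reflexivity. }
      rewrite Hreal.
      replace (Re (Cmult (RtoC (rpow_opp m (- (INR k + 1)))) (g (s_ k))))
        with (rpow_opp m (- (INR k + 1)) * Re (g (s_ k)))
        by re_im_ring.
      apply Rmult_le_pos; [left; apply rpow_opp_pos|].
      unfold g. rewrite npow_opp_1.
      replace (Re (Cminus (psi (s_ k)) (Cmult (c 1%nat) (RtoC 1))))
        with (Re (psi (s_ k)) - Re (c 1%nat)) by re_im_ring.
      rewrite <- H0. rewrite Rminus_0_r. left. apply Hpos. unfold half_plane. rewrite Hre.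
      pose proof (pos_INR k). lra. }
    pose proof (HR 0) as R1. pose proof (HR PI) as R2.
    pose proof (HR (PI / 2)) as R3. pose proof (HR (- (PI / 2))) as R4.
    rewrite Cexp_imag in R1, R2, R3, R4.
    rewrite cos_0, sin_0 in R1. rewrite cos_PI, sin_PI in R2.
    rewrite cos_neg, sin_neg in R4. rewrite cos_PI2, sin_PI2 in R3, R4.
    destruct (c m) as [x y]. unfold Re, Cmult in R1, R2, R3, R4; simpl in R1, R2, R3, R4.
    unfold RtoC. f_equal; lra. }
  assert (Hs1 : half_plane 0 (RtoC 1)) by (change (0 < 1); lra).
  assert (Hp : psi (RtoC 1) = c 1%nat).
  { apply (Ccv_unique (dsum c (RtoC 1)));
      [apply is_series_Csum; assumption|].
    intros eta He. exists 1%nat. intros n Hn.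
    assert (E : dsum c (RtoC 1) n = c 1%nat).
    { induction Hn as [|n Hn IH].
      - simpl. unfold dirichlet_term. rewrite npow_opp_1. ring.
      - simpl. rewrite IH. unfold dirichlet_term at 1. rewrite (HZ (S n)) by lia. ring. }
    rewrite E. replace (Cminus (c 1%nat) (c 1%nat)) with (RtoC 0) by ring.
    rewrite Cmod_0. exact He. }
  specialize (Hpos _ Hs1). rewrite Hp in Hpos. unfold half_plane in Hpos. lra.
Qed.

(* Large powers of [F = 2^{-psi}] are uniformly small on [C_eps]: by Bohr's theorem
   a number of coefficients independent of the power suffices to approximate them,
   and each coefficient tends to 0 because [|F| <= q < 1] far to the right. *)
Lemma psi_gap (eps : R) : 0 < eps ->
  exists kappa, 0 < kappa /\ forall s, half_plane eps s -> kappa <= Re (psi s).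
Proof.
  intros He. pose proof Re_c1_pos as Hc1. set (r := Re (c 1%nat)) in *.
  assert (Hl2 : 0 < ln 2) by (rewrite <- ln_1; apply ln_increasing; lra).
  set (F := fun s => Cexp (Cmult (RtoC (- ln 2)) (psi s))).
  assert (HF : Hinf_plus F) by (apply Hinf_plus_Cexp, Hinf_plus_scal; exact Hpsi).
  assert (HFm : forall s, Cmod (F s) = exp (- (ln 2 * Re (psi s)))).
  { intros s. unfold F. rewrite Cmod_Cexp. f_equal. re_im_ring. }
  assert (Hfar : exists x, 1 <= x /\ forall s, half_plane x s -> r / 2 <= Re (psi s)).
  { destruct (lead 1 c psi (Nat.le_refl 1) Hpsi Hc ltac:(intros; lia)) as [K [HK HL]].
    destruct (INR_unbounded (4 * K / r + 1)) as [N HN].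
    assert (HT : forall s, half_plane (INR N) s -> K * rpow_opp 2 (Re s) <= r / 2).
    { intros s Hs. unfold half_plane in Hs. unfold rpow_opp.
      assert (E2 : Re s * / 2 <= Re s * ln (INR 2)).
      { assert (0 <= 4 * K / r) by (apply Rmult_le_pos; [lra|left; apply Rinv_0_lt_compat; exact Hc1]).
        apply Rmult_le_compat_l; [lra|]. pose proof ln_lt_2. replace (INR 2) with 2 by (simpl; ring). lra. }
      pose proof (exp_ineq1_le (Re s * / 2)) as E3.
      assert (E4 : exp (- (Re s * ln (INR 2))) <= exp (- (Re s * / 2))) by (apply exp_le; lra).
      assert (E5 : exp (Re s * / 2) * exp (- (Re s * / 2)) = 1)
        by (rewrite <- exp_plus, Rplus_opp_r; apply exp_0).
      pose proof (exp_pos (- (Re s * / 2))) as E6.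
      assert (E7 : 4 * K / r + 1 < Re s) by lra.
      assert (E8 : 4 * K < r * Re s).
      { assert (4 * K / r < Re s) by lra. apply Rlt_div_l in H; lra. }
      assert (E9 : K * exp (- (Re s * / 2)) <= r * Re s / 4 * exp (- (Re s * / 2)))
        by (apply Rmult_le_compat_r; lra).
      assert (E10 : K * exp (- (Re s * ln (INR 2))) <= K * exp (- (Re s * / 2)))
        by (apply Rmult_le_compat_l; lra).
      pose proof (mult_exp_le (/ 2) (Re s) ltac:(lra)) as E11.
      rewrite (Rmult_comm (/ 2)) in E11.
      eapply Rle_trans; [exact E10|]. eapply Rle_trans; [exact E9|].
      rewrite Rinv_inv in E11. nra. }
    exists (Rmax 1 (INR N)). split; [apply Rmax_l|]. intros s Hs.
    unfold half_plane in Hs.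
    pose proof (Rmax_l 1 (INR N)). pose proof (Rmax_r 1 (INR N)).
    specialize (HL s ltac:(lra)). specialize (HT s ltac:(unfold half_plane; lra)).
    rewrite npow_opp_1 in HL.
    pose proof (re_ge_Cmod (Cminus (psi s) (Cmult (c 1%nat) (RtoC 1)))) as HR.
    replace (Re (Cminus (psi s) (Cmult (c 1%nat) (RtoC 1)))) with (Re (psi s) - r) in HR
      by (unfold r, Re, Cminus, Cplus, Copp, Cmult, RtoC; simpl; ring).
    lra. }
  destruct Hfar as [x [Hx Hfar]].
  set (q := exp (- (ln 2 * (r / 2)))).
  assert (Hq0 : 0 < q) by apply exp_pos.
  assert (Hq1 : q < 1).
  { unfold q. rewrite <- exp_0. apply exp_increasing. nra. }
  destruct (coef_bound 1 ltac:(lra)) as [K1 [HK1 HC]].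
  destruct (bohr_tail (eps / 2) ltac:(lra)) as [K2 [HK2 HT]].
  destruct (rpow_opp_small (eps / 2 / 2) K2 (/ 4) ltac:(lra) ltac:(lra) ltac:(lra)) as [p [_ Hp]].
  set (L := Rsum (fun k => K1 * rpow_opp (S k) (- (x + 1))) p).
  assert (HL : 0 <= L).
  { unfold L. rewrite Rsum_scal. apply Rmult_le_pos; [lra|].
    replace 0 with (Rsum (fun _ => 0) p) by (rewrite Rsum_const; ring).
    apply Rsum_le. intros k _. left; apply rpow_opp_pos. }
  destruct (pow_small q L (/ 4) Hq0 Hq1 HL ltac:(lra)) as [k Hk].
  set (j := S k). specialize (Hk j ltac:(unfold j; lia)).
  pose proof (Hinf_plus_pow F j HF) as HFj. pose proof HFj as [_ [_ [A HA]]].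
  assert (HB1 : bounded_on (fun s => Cpow (F s) j) x (q ^ j)).
  { intros s Hs. rewrite Cmod_pow. apply pow_incr. split; [apply Cmod_ge_0|].
    rewrite HFm. unfold q. apply exp_le. specialize (Hfar s Hs). nra. }
  assert (HB2 : bounded_on (fun s => Cpow (F s) j) (eps / 2) 1).
  { intros s Hs. rewrite Cmod_pow, <- (pow1 j). apply pow_incr. split; [apply Cmod_ge_0|].
    rewrite HFm, <- exp_0. apply exp_le.
    assert (0 < Re (psi s)) by (apply Hpos; unfold half_plane in *; lra). nra. }
  exists (/ INR j). assert (HJ : 0 < INR j) by (apply lt_0_INR; unfold j; lia).
  split; [apply Rinv_0_lt_compat; exact HJ|]. intros s Hs.
  assert (HS1 : Cmod (dsum A s p) <= L * q ^ j).
  { eapply Rle_trans; [apply Cmod_Csum|]. unfold L. rewrite <- Rsum_mult_r.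
    apply Rsum_le. intros i _. unfold dirichlet_term.
    rewrite Cmod_mult, Cmod_npow_opp.
    assert (Hi1 : rpow_opp (S i) (Re s) <= 1) by (apply rpow_opp_le_1; unfold half_plane in Hs; lra).
    pose proof (HC A _ x (q ^ j) HA ltac:(lra) HB1 (S i) ltac:(lia)) as HCi.
    assert (E : rpow_opp (S i) (x + 1) * rpow_opp (S i) (- (x + 1)) = 1).
    { rewrite <- rpow_opp_plus, Rplus_opp_r. apply rpow_opp_0. }
    pose proof (rpow_opp_pos (S i) (- (x + 1))) as P1.
    pose proof (Cmod_ge_0 (A (S i))) as P2.
    apply Rle_trans with (Cmod (A (S i)) * 1); [apply Rmult_le_compat_l; assumption|].
    replace (Cmod (A (S i)) * 1) with
      (Cmod (A (S i)) * rpow_opp (S i) (x + 1) * rpow_opp (S i) (- (x + 1)))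
      by (rewrite Rmult_assoc, E; reflexivity).
    replace (K1 * rpow_opp (S i) (- (x + 1)) * q ^ j)
      with (K1 * q ^ j * rpow_opp (S i) (- (x + 1))) by ring.
    apply Rmult_le_compat_r; lra. }
  assert (HS2 : Cmod (Cminus (Cpow (F s) j) (dsum A s p)) <= / 4).
  { eapply Rle_trans; [apply (HT A (fun s => Cpow (F s) j) (eps / 2) 1 HA ltac:(lra) HB2)|].
    - unfold half_plane in *. lra.
    - specialize (Hp (S p) ltac:(lia)). lra. }
  assert (HS3 : Cmod (F s) ^ j <= / 2).
  { rewrite <- Cmod_pow.
    pose proof (Cmod_le_minus (Cpow (F s) j) (dsum A s p)).
    assert (0 < q ^ j) by (apply pow_lt; exact Hq0). nra. }
  rewrite HFm, exp_pow_INR in HS3.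
  assert (HS4 : ln 2 <= INR j * (ln 2 * Re (psi s))).
  { apply Rnot_lt_le. intros Hlt.
    assert (Hexp : exp (- ln 2) < exp (INR j * - (ln 2 * Re (psi s)))) by (apply exp_increasing; lra).
    rewrite exp_Ropp, exp_ln in Hexp by lra. lra. }
  apply Rmult_le_reg_l with (INR j); [exact HJ|]. rewrite Rinv_r by lra.
  apply Rmult_le_reg_l with (ln 2); [exact Hl2|]. lra.
Qed.
End PositiveRealPart.

(** * Weighted composition operators *)

Lemma Ccv_mult (u v : nat -> C) (l m : C) :
  Ccv u l -> Ccv v m -> Ccv (fun n => Cmult (u n) (v n)) (Cmult l m).
Proof.
  intros Hu Hv. destruct (Ccv_bounded u l Hu) as [M HM].
  intros eta He. pose proof (Cmod_ge_0 m) as Hm0.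
  assert (HM0 : 0 <= M) by (eapply Rle_trans; [apply Cmod_ge_0|apply (HM O)]).
  destruct (Hu (eta / 2 / (Cmod m + 1))) as [N1 H1]; [apply Rdiv_lt_0_compat; lra|].
  destruct (Hv (eta / 2 / (M + 1))) as [N2 H2]; [apply Rdiv_lt_0_compat; lra|].
  exists (max N1 N2). intros n Hn.
  specialize (H1 n ltac:(lia)). specialize (H2 n ltac:(lia)). specialize (HM n).
  apply Rlt_div_r in H1; [|lra]. apply Rlt_div_r in H2; [|lra].
  replace (Cminus (Cmult (u n) (v n)) (Cmult l m))
    with (Cplus (Cmult (u n) (Cminus (v n) m)) (Cmult m (Cminus (u n) l))) by ring.
  eapply Rle_lt_trans; [apply Cmod_triangle|]. rewrite !Cmod_mult.
  pose proof (Cmod_ge_0 (Cminus (u n) l)). pose proof (Cmod_ge_0 (Cminus (v n) m)).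
  pose proof (Cmod_ge_0 (u n)). nra.
Qed.

Lemma Ccv_Cexp (u : nat -> C) (l : C) : Ccv u l -> Ccv (fun n => Cexp (u n)) (Cexp l).
Proof.
  intros H eta He. set (K := Cmod (Cexp l)). assert (HK : 0 <= K) by apply Cmod_ge_0.
  pose proof (exp_pos 1) as He1.
  assert (HKe : 0 <= K * exp 1) by nra.
  destruct (H (Rmin 1 (eta / (K * exp 1 + 1)))) as [N HN].
  { apply Rmin_pos; [lra|]. apply Rdiv_lt_0_compat; lra. }
  exists N. intros n Hn. specialize (HN n Hn).
  set (w := Cminus (u n) l) in *.
  assert (H1 : Cmod w < 1) by (eapply Rlt_le_trans; [exact HN|apply Rmin_l]).
  assert (H2 : Cmod w < eta / (K * exp 1 + 1)) by (eapply Rlt_le_trans; [exact HN|apply Rmin_r]).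
  apply Rlt_div_r in H2; [|lra].
  replace (Cminus (Cexp (u n)) (Cexp l)) with (Cmult (Cexp l) (Cminus (Cexp w) (RtoC 1))).
  - rewrite Cmod_mult. fold K. pose proof (Cmod_Cexp_minus_1' w) as HT.
    pose proof (Cmod_ge_0 w) as Hw.
    assert (exp (Cmod w) <= exp 1) by (apply exp_le; lra).
    assert (Cmod (Cminus (Cexp w) (RtoC 1)) <= Cmod w * exp 1) by nra.
    assert (K * Cmod (Cminus (Cexp w) (RtoC 1)) <= K * (Cmod w * exp 1))
      by (apply Rmult_le_compat_l; assumption).
    nra.
  - replace (Cexp (u n)) with (Cmult (Cexp l) (Cexp w)); [ring|].
    rewrite <- Cexp_plus. f_equal. unfold w. ring.
Qed.

Lemma geom_series (u : nat -> C) (K : R) :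
  (forall j, Cmod (u j) <= K * (/ 2) ^ j) ->
  exists l, Ccv (Csum u) l /\ forall n, Cmod (Cminus (Csum u n) l) <= 2 * K * (/ 2) ^ n.
Proof.
  intros H.
  assert (HK : 0 <= K).
  { specialize (H O). simpl in H. pose proof (Cmod_ge_0 (u O)). lra. }
  assert (Hp : forall n, 0 < (/ 2) ^ n) by (intros; apply pow_lt; lra).
  assert (HO : forall n q, Cmod (Cminus (Csum u (n + q)) (Csum u n))
     <= 2 * K * (/ 2) ^ n - 2 * K * (/ 2) ^ (n + q)).
  { intros n q. induction q as [|q IH].
    - rewrite Nat.add_0_r. replace (Cminus (Csum u n) (Csum u n)) with (RtoC 0) by ring.
      rewrite Cmod_0. lra.
    - rewrite Nat.add_succ_r. simpl Csum. simpl pow.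
      replace (Cminus (Cplus (Csum u (n + q)) (u (n + q)%nat)) (Csum u n))
        with (Cplus (Cminus (Csum u (n + q)) (Csum u n)) (u (n + q)%nat)) by ring.
      eapply Rle_trans; [apply Cmod_triangle|]. specialize (H (n + q)%nat). lra. }
  destruct (Ccv_Cauchy (Csum u)) as [l Hl].
  { intros eta He.
    destruct (pow_small (/ 2) (2 * K) eta) as [N HN]; try lra.
    exists N. intros n m Hn Hm. replace m with (n + (m - n))%nat by lia.
    specialize (HN n Hn).
    pose proof (HO n (m - n)%nat). pose proof (Hp n). pose proof (Hp (n + (m - n))%nat). nra. }
  exists l. split; [exact Hl|]. intros n. rewrite Cmod_minus_sym.
  apply (Ccv_dist_le (Csum u) _ _ _ n); [exact Hl|].
  intros m Hm. replace m with (n + (m - n))%nat by lia.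
  pose proof (HO n (m - n)%nat). pose proof (Hp (n + (m - n))%nat). nra.
Qed.

Lemma seminorm_lt_bounded (eps M : R) (h : C -> C) :
  Rbar_lt (seminorm eps h) M -> bounded_on h eps M.
Proof.
  intros H s Hs. unfold seminorm in H.
  set (E := fun x : R => exists s : C, half_plane eps s /\ x = Cmod (h s)) in H.
  destruct (Lub_Rbar_correct E) as [Hub _].
  specialize (Hub (Cmod (h s)) (ex_intro _ s (conj Hs eq_refl))).
  pose proof (Rbar_le_lt_trans _ _ _ Hub H) as K. simpl in K. lra.
Qed.

Lemma bounded_seminorm_lt (eps M eta : R) (h : C -> C) :
  bounded_on h eps M -> M < eta -> Rbar_lt (seminorm eps h) eta.
Proof.
  intros H HM. unfold seminorm.
  set (E := fun x : R => exists s : C, half_plane eps s /\ x = Cmod (h s)).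
  destruct (Lub_Rbar_correct E) as [_ Hlub].
  apply Rbar_le_lt_trans with (Finite M); [|exact HM].
  apply Hlub. intros x [s [Hs ->]]. apply H. exact Hs.
Qed.

Lemma continuous_operator_intro (T : (C -> C) -> (C -> C)) :
  (forall f, Hinf_plus f -> Hinf_plus (T f)) ->
  (forall f g, Hinf_plus f -> Hinf_plus g ->
     eq_C0 (T (fun s => Cplus (f s) (g s))) (fun s => Cplus (T f s) (T g s))) ->
  (forall k f, Hinf_plus f -> eq_C0 (T (fun s => Cmult k (f s))) (fun s => Cmult k (T f s))) ->
  (forall eps, 0 < eps -> exists delta K, 0 < delta /\ 0 <= K /\ forall f g M,
     Hinf_plus f -> Hinf_plus g -> bounded_on (fsub g f) delta M ->
     bounded_on (fsub (T g) (T f)) eps (K * M)) ->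
  continuous_operator T.
Proof.
  intros H1 H2 H3 H4. split; [exact H1|]. split; [exact H2|]. split; [exact H3|].
  intros f Hf eps eta He Heta. destruct (H4 eps He) as [d [K [Hd [HK HB]]]].
  exists d, (eta / (K + 1)).
  assert (0 < eta / (K + 1)) by (apply Rdiv_lt_0_compat; lra).
  split; [exact Hd|]. split; [assumption|].
  intros g Hg Hlt. apply bounded_seminorm_lt with (K * (eta / (K + 1))).
  - apply HB; [exact Hf|exact Hg|]. apply seminorm_lt_bounded. exact Hlt.
  - replace eta with ((K + 1) * (eta / (K + 1))) at 2 by (field; lra). nra.
Qed.

Definition vanish_below (N : nat) (a : nat -> C) : Prop :=
  forall m, (1 <= m < N)%nat -> a m = RtoC 0.

Definition inV (N : nat) (f : C -> C) : Prop :=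
  Hinf_plus f /\ exists a, dirichlet_rep a f /\ vanish_below N a.

Lemma inV_1 (f : C -> C) : Hinf_plus f -> inV 1 f.
Proof.
  intros Hf. split; [exact Hf|]. destruct Hf as [_ [_ [a Ha]]]. exists a.
  split; [exact Ha|]. intros m Hm. lia.
Qed.

Lemma inV_sub_lead (N : nat) (f g : C -> C) (a b : nat -> C) (z : C) :
  (1 <= N)%nat -> Hinf_plus f -> Hinf_plus g ->
  dirichlet_rep a f -> dirichlet_rep b g -> vanish_below N a -> vanish_below N b ->
  a N = Cmult z (b N) -> inV (S N) (fun s => Cminus (f s) (Cmult z (g s))).
Proof.
  intros HN Hf Hg Ha Hb Hza Hzb E. split.
  - apply Hinf_plus_minus; [exact Hf|apply Hinf_plus_scal; exact Hg].
  - exists (fun n => Cminus (a n) (Cmult z (b n))). split.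
    + apply dirichlet_rep_minus; [exact Ha|apply dirichlet_rep_scal; exact Hb].
    + intros m Hm. destruct (Nat.eq_dec m N) as [->|Hne].
      * rewrite E. ring.
      * rewrite Hza, Hzb by lia. ring.
Qed.

Lemma vanish_below_delta (N : nat) : vanish_below N (delta_coef N).
Proof.
  intros m Hm. unfold delta_coef. replace (m =? N)%nat with false; [reflexivity|].
  symmetry. apply Nat.eqb_neq. lia.
Qed.

Lemma delta_coef_diag (N : nat) : delta_coef N N = RtoC 1.
Proof. unfold delta_coef. rewrite Nat.eqb_refl. reflexivity. Qed.

Section WeightedComposition.
Variables (a : nat -> C) (D : C -> C) (c0 : nat) (c : nat -> C) (phi psi : C -> C).
Hypothesis HD : Hinf_plus D.
Hypothesis HDa : dirichlet_rep a D.
Hypothesis Hc0 : (1 <= c0)%nat.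
Hypothesis Hphi : forall s, half_plane 0 s -> phi s = Cplus (Cmult (RtoC (INR c0)) s) (psi s).
Hypothesis Hpsi : Hinf_plus psi.
Hypothesis Hc : dirichlet_rep c psi.
Hypothesis Hpos : forall s, half_plane 0 s -> half_plane 0 (psi s).

Lemma Re_phi (s : C) : half_plane 0 s -> Re (phi s) = INR c0 * Re s + Re (psi s).
Proof.
  intros Hs. rewrite (Hphi s Hs). re_im_ring.
Qed.

Lemma INR_c0 : 1 <= INR c0.
Proof. apply (le_INR 1). exact Hc0. Qed.

Lemma Re_phi_gt (s : C) : half_plane 0 s -> Re s < Re (phi s).
Proof.
  intros Hs. rewrite (Re_phi s Hs). pose proof INR_c0. specialize (Hpos s Hs).
  unfold half_plane in *. nra.
Qed.

Lemma phi_half_plane (eps : R) (s : C) : 0 <= eps -> half_plane eps s -> half_plane eps (phi s).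
Proof.
  intros He Hs. pose proof (Re_phi_gt s (half_plane_weaken 0 eps s He Hs)).
  unfold half_plane in *. lra.
Qed.

Lemma phi_gap (eps : R) : 0 < eps -> exists kappa, 0 < kappa /\
  forall s, half_plane eps s -> Re s + kappa <= Re (phi s).
Proof.
  intros He. destruct (psi_gap c psi Hpsi Hc Hpos eps He) as [k [Hk H]].
  exists k. split; [exact Hk|]. intros s Hs. specialize (H s Hs).
  assert (Hs0 : half_plane 0 s) by (apply (half_plane_0 eps); assumption).
  rewrite (Re_phi s Hs0). pose proof INR_c0. unfold half_plane in *. nra.
Qed.

Lemma Hinf_plus_npow_phi (n : nat) : (1 <= n)%nat -> Hinf_plus (fun s => npow_opp n (phi s)).
Proof.
  intros Hn.
  apply (Hinf_plus_ext (fun s => Cmult (npow_opp (n ^ c0) s)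
    (Cexp (Cmult (RtoC (- ln (INR n))) (psi s))))).
  - intros s Hs. rewrite (Hphi s Hs), npow_opp_plus, npow_opp_pow by exact Hn.
    f_equal. unfold npow_opp. f_equal. rewrite RtoC_opp. ring.
  - apply Hinf_plus_npow_mult.
    + pose proof (Nat.pow_nonzero n c0 ltac:(lia)). lia.
    + apply Hinf_plus_Cexp, Hinf_plus_scal. exact Hpsi.
Qed.

Lemma Hinf_plus_comp (f : C -> C) : Hinf_plus f -> Hinf_plus (fun s => f (phi s)).
Proof.
  intros Hf. pose proof Hf as [_ [_ [b Hb]]].
  apply Hinf_plus_closed. intros eps eta He Heta.
  destruct (Hinf_plus_approx b f eps eta Hf Hb He Heta) as [N HN].
  exists (fun s => dsum b (phi s) N). split.
  - apply (Hinf_plus_Csum (fun k s => dirichlet_term b (phi s) k)). intros k.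
    apply (Hinf_plus_scal (b (S k)) (fun s => npow_opp (S k) (phi s))).
    apply Hinf_plus_npow_phi. lia.
  - intros s Hs. apply HN. apply phi_half_plane; [lra|exact Hs].
Qed.

Local Notation W := (weighted_comp D phi).

Lemma W_Hinf (f : C -> C) : Hinf_plus f -> Hinf_plus (W f).
Proof. intros Hf. apply Hinf_plus_mult; [exact HD|apply Hinf_plus_comp; exact Hf]. Qed.

Lemma W_continuous : continuous_operator W.
Proof.
  apply continuous_operator_intro.
  - exact W_Hinf.
  - intros f g _ _ s _. unfold weighted_comp. ring.
  - intros k f _ s _. unfold weighted_comp. ring.
  - intros eps He. destruct (Hinf_plus_bounded D eps HD He) as [M [HM0 HM]].
    exists eps, M. split; [exact He|]. split; [exact HM0|].
    intros f g B Hf Hg HB s Hs. unfold fsub, weighted_comp.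
    replace (Cminus (Cmult (D s) (g (phi s))) (Cmult (D s) (f (phi s))))
      with (Cmult (D s) (fsub g f (phi s))) by (unfold fsub; ring).
    rewrite Cmod_mult. apply Rmult_le_compat; try apply Cmod_ge_0.
    + apply HM. exact Hs.
    + apply HB. apply phi_half_plane; [lra|exact Hs].
Qed.

(* Diagonal of the lower triangular matrix of [W] in the basis [n^{-s}]. *)
Definition diag (N : nat) : C :=
  Cmult (a 1%nat)
    (if (c0 =? 1)%nat then npow_opp N (c 1%nat)
     else if (N =? 1)%nat then RtoC 1 else RtoC 0).

Lemma diag_factor_lim (N : nat) : (1 <= N)%nat ->
  Ccv (fun k => npow_opp N (Cminus (phi (real_points k)) (real_points k)))
    (if (c0 =? 1)%nat then npow_opp N (c 1%nat)
     else if (N =? 1)%nat then RtoC 1 else RtoC 0).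
Proof.
  intros HN. destruct (Nat.eqb_spec c0 1) as [E|NE].
  - apply Ccv_ext with (fun k => Cexp (Cmult (Copp (RtoC (ln (INR N)))) (psi (real_points k)))).
    + intros k. rewrite (Hphi _ (real_points_half_plane k)), E. unfold npow_opp. f_equal.
      simpl INR. ring.
    + unfold npow_opp.
      replace (Copp (Cmult (c 1%nat) (RtoC (ln (INR N)))))
        with (Cmult (Copp (RtoC (ln (INR N)))) (c 1%nat)) by ring.
      apply Ccv_Cexp, Ccv_scal. apply psi_lim; [exact Hpsi|exact Hc|apply real_points_tends].
  - destruct (Nat.eqb_spec N 1) as [->|HN1].
    + apply Ccv_ext with (fun _ => RtoC 1); [intros k; now rewrite npow_opp_1|apply Ccv_const].
    + intros eta He.
      destruct (rpow_ratio_small 1 N 1 eta real_points ltac:(lia) ltac:(lia) ltac:(lra) He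
        real_points_tends) as [k0 H0].
      exists k0. intros k Hk. specialize (H0 k Hk).
      replace (Cminus (npow_opp N (Cminus (phi (real_points k)) (real_points k))) (RtoC 0))
        with (npow_opp N (Cminus (phi (real_points k)) (real_points k))) by ring.
      rewrite Cmod_npow_opp.
      rewrite rpow_opp_1, !Rmult_1_l in H0. eapply Rle_lt_trans; [|exact H0].
      apply rpow_opp_antitone.
      change (Re (Cminus (phi (real_points k)) (real_points k)))
        with (Re (phi (real_points k)) - Re (real_points k)).
      pose proof (real_points_half_plane k) as Hs. rewrite (Re_phi _ Hs).
      specialize (Hpos _ Hs). unfold half_plane in *.
      assert (2 <= INR c0) by (apply (le_INR 2); lia). nra.
Qed.

Lemma phi_points_tends : tends_to_infinity (fun k => phi (real_points k)).
Proof.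
  intros x. destruct (real_points_tends x) as [N HN]. exists N. intros n Hn.
  specialize (HN n Hn). pose proof (Re_phi_gt _ (real_points_half_plane n)). lra.
Qed.

Lemma W_lead (N : nat) (f : C -> C) (u b : nat -> C) :
  (1 <= N)%nat -> Hinf_plus f -> dirichlet_rep u f -> vanish_below N u ->
  dirichlet_rep b (W f) -> vanish_below N b /\ b N = Cmult (diag N) (u N).
Proof.
  intros HN Hf Hu Hz Hb.
  apply (coef_of_limit N b (W f)); [exact HN|apply W_Hinf; exact Hf|exact Hb|].
  apply Ccv_ext with (fun k => Cmult (Cmult (D (real_points k))
      (npow_opp N (Cminus (phi (real_points k)) (real_points k))))
      (Cmult (npow_opp N (Copp (phi (real_points k)))) (f (phi (real_points k))))).
  - intros k. unfold weighted_comp. set (p := phi (real_points k)). set (s := real_points k).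
    replace (Copp s) with (Cplus (Cminus p s) (Copp p)) by ring.
    rewrite npow_opp_plus. ring.
  - unfold diag. apply Ccv_mult; [apply Ccv_mult|].
    + apply Ccv_ext with (fun k => Cmult (npow_opp 1 (Copp (real_points k))) (D (real_points k))).
      * intros k. rewrite npow_opp_1. ring.
      * apply lead_lim; [lia|exact HD|exact HDa|intros; lia|apply real_points_tends].
    + apply diag_factor_lim. exact HN.
    + apply (lead_lim N u f (fun k => phi (real_points k)));
        [exact HN|exact Hf|exact Hu|exact Hz|apply phi_points_tends].
Qed.

Section Resolvent.
Variable lam : C.

Definition shifted_comp (f : C -> C) (s : C) : C := Cminus (W f s) (Cmult lam (f s)).
Local Notation T := shifted_comp.

Lemma T_Hinf (f : C -> C) : Hinf_plus f -> Hinf_plus (T f).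
Proof. intros Hf. apply Hinf_plus_minus; [apply W_Hinf|apply Hinf_plus_scal]; exact Hf. Qed.

Lemma T_continuous : continuous_operator T.
Proof.
  apply continuous_operator_intro.
  - exact T_Hinf.
  - intros f g _ _ s _. unfold shifted_comp, weighted_comp. ring.
  - intros k f _ s _. unfold shifted_comp, weighted_comp. ring.
  - intros eps He. destruct (Hinf_plus_bounded D eps HD He) as [M [HM0 HM]].
    pose proof (Cmod_ge_0 lam) as Hl.
    exists eps, (M + Cmod lam). split; [exact He|]. split; [lra|].
    intros f g B Hf Hg HB s Hs. unfold fsub, shifted_comp, weighted_comp.
    replace (Cminus (Cminus (Cmult (D s) (g (phi s))) (Cmult lam (g s)))
       (Cminus (Cmult (D s) (f (phi s))) (Cmult lam (f s))))
      with (Cminus (Cmult (D s) (fsub g f (phi s))) (Cmult lam (fsub g f s)))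
      by (unfold fsub; ring).
    eapply Rle_trans; [apply Cmod_minus_le|]. rewrite !Cmod_mult, Rmult_plus_distr_r.
    apply Rplus_le_compat.
    + apply Rmult_le_compat; try apply Cmod_ge_0; [apply HM; exact Hs|].
      apply HB. apply phi_half_plane; [lra|exact Hs].
    + apply Rmult_le_compat_l; [exact Hl|]. apply HB. exact Hs.
Qed.

Lemma T_lead (N : nat) (f g : C -> C) (u b : nat -> C) :
  (1 <= N)%nat -> Hinf_plus f -> dirichlet_rep u f -> vanish_below N u ->
  eq_C0 (T f) g -> dirichlet_rep b g ->
  vanish_below N b /\ b N = Cmult (Cminus (diag N) lam) (u N).
Proof.
  intros HN Hf Hu Hz E Hb.
  pose proof (W_Hinf f Hf) as [_ [_ [w Hw]]].
  destruct (W_lead N f u w HN Hf Hu Hz Hw) as [W1 W2].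
  pose proof (dirichlet_rep_minus _ _ _ _ Hw (dirichlet_rep_scal lam _ _ Hu)) as HT.
  pose proof (dirichlet_rep_unique _ _ _ _ (T_Hinf f Hf) E HT Hb) as HU. cbv beta in HU.
  split.
  - intros m Hm. rewrite <- HU, W1, Hz by lia. ring.
  - rewrite <- HU, W2 by exact HN. ring.
Qed.

Lemma T_inV (N : nat) (f : C -> C) : (1 <= N)%nat -> inV N f -> inV N (T f).
Proof.
  intros HN [Hf [u [Hu Hz]]]. pose proof (T_Hinf f Hf) as HT. split; [exact HT|].
  pose proof HT as [_ [_ [b Hb]]]. exists b. split; [exact Hb|].
  apply (T_lead N f (T f) u b HN Hf Hu Hz); [intros s _; reflexivity|exact Hb].
Qed.

Lemma T_preimage_npow (m : nat) (z : C) (f : C -> C) (u : nat -> C) :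
  (1 <= m)%nat -> (forall p, (1 <= p < m)%nat -> diag p <> lam) ->
  Hinf_plus f -> dirichlet_rep u f -> eq_C0 (T f) (fun s => Cmult z (npow_opp m s)) ->
  vanish_below m u /\ Cmult (Cminus (diag m) lam) (u m) = z.
Proof.
  intros Hm Hd Hf Hu E.
  pose proof (dirichlet_rep_scal z _ _ (dirichlet_rep_npow m Hm)) as Hb.
  assert (HZ : forall p, (p <= m)%nat -> vanish_below p u).
  { induction p as [|p IH]; intros Hp; [intros j Hj; lia|].
    intros j Hj. destruct (Nat.eq_dec j p) as [->|Hne]; [|apply IH; lia].
    destruct (T_lead p f _ u _ ltac:(lia) Hf Hu (IH ltac:(lia)) E Hb) as [_ B].
    cbv beta in B. rewrite (vanish_below_delta m p) in B by lia.
    rewrite Cmult_0_r in B.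
    assert (Hne : Cminus (diag p) lam <> RtoC 0).
    { intro K. apply (Hd p ltac:(lia)). replace (diag p) with (Cplus (Cminus (diag p) lam) lam) by ring.
      rewrite K. ring. }
    replace (u p) with (Cmult (Cinv (Cminus (diag p) lam)) (Cmult (Cminus (diag p) lam) (u p))).
    - rewrite <- B. ring.
    - rewrite Cmult_assoc, Cinv_l by exact Hne. ring. }
  split; [apply HZ; lia|].
  destruct (T_lead m f _ u _ Hm Hf Hu (HZ m (Nat.le_refl m)) E Hb) as [_ B].
  cbv beta in B. rewrite delta_coef_diag in B. rewrite <- B. ring.
Qed.

Lemma spectrum_diag (m : nat) :
  (1 <= m)%nat -> diag m = lam -> (forall p, (1 <= p < m)%nat -> diag p <> lam) ->
  spectrum W lam.
Proof.
  intros Hm E Hd [_ [U [[HU _] HI]]].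
  pose proof (Hinf_plus_npow m Hm) as Hn.
  pose proof (HU _ Hn) as Hf. pose proof Hf as [_ [_ [u Hu]]].
  destruct (T_preimage_npow m (RtoC 1) (U (npow_opp m)) u Hm Hd Hf Hu) as [_ K].
  - intros s Hs. rewrite Cmult_1_l. apply (HI _ Hn). exact Hs.
  - rewrite E in K. replace (Cminus lam lam) with (RtoC 0) in K by ring.
    rewrite Cmult_0_l in K. apply (f_equal fst) in K. simpl in K. lra.
Qed.

Section OffSpectrum.
Hypothesis Hlam : lam <> RtoC 0.
Hypothesis Hdiag : forall p, (1 <= p)%nat -> diag p <> lam.

Fixpoint Wn (j : nat) (f : C -> C) : C -> C :=
  match j with O => f | S i => W (Wn i f) end.

Lemma Wn_Hinf (j : nat) (f : C -> C) : Hinf_plus f -> Hinf_plus (Wn j f).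
Proof. intros Hf. induction j as [|j IH]; [exact Hf|apply W_Hinf; exact IH]. Qed.

Lemma Wn_T (j : nat) (f : C -> C) (s : C) :
  Wn j (T f) s = Cminus (Wn (S j) f s) (Cmult lam (Wn j f s)).
Proof.
  revert s. induction j as [|j IH]; intros s; [reflexivity|].
  change (Wn (S j) (T f) s) with (Cmult (D s) (Wn j (T f) (phi s))). rewrite IH.
  simpl. unfold shifted_comp, weighted_comp. ring.
Qed.

Let rho := Cmod lam / 2.

Lemma rho_pos : 0 < rho.
Proof. unfold rho. apply Cmod_gt_0 in Hlam. lra. Qed.

(* On functions vanishing to order [N] at infinity, [W] contracts by the factor
   [sup |D| * N^{-kappa}], since [phi] moves points of [C_1] to the right by [kappa]. *)
Lemma Wn_bound : exists N, (1 <= N)%nat /\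
  forall eps, 0 < eps -> eps <= 1 -> exists K, 0 <= K /\
  forall f M, inV N f -> bounded_on f eps M ->
  forall j s, half_plane eps s -> Cmod (Wn j f s) <= K * M * rho ^ j.
Proof.
  pose proof rho_pos as Hr.
  destruct (phi_gap 1 ltac:(lra)) as [k1 [Hk1 Hg1]].
  destruct (Hinf_plus_bounded D 1 HD ltac:(lra)) as [M1 [HM10 HM1]].
  destruct (rpow_opp_small k1 M1 rho Hk1 HM10 Hr) as [N [HN Hsm]].
  specialize (Hsm N (Nat.le_refl N)). apply Rlt_le in Hsm.
  destruct (low_tail N HN) as [K0 [HK0 HT]].
  assert (G1 : forall f M, inV N f -> bounded_on f 1 M ->
    forall j s, half_plane 1 s -> Cmod (Wn j f s) <= K0 * M * rho ^ j * rpow_opp N (Re s)).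
  { intros f M [Hf [u [Hu Hz]]] HM.
    pose proof (bounded_on_ge_0 f 1 M HM) as HM0.
    induction j as [|j IH]; intros s Hs.
    - simpl. rewrite Rmult_1_r. apply (HT u f M Hu HM Hz). exact Hs.
    - simpl Wn. unfold shifted_comp, weighted_comp. rewrite Cmod_mult.
      pose proof (phi_half_plane 1 s ltac:(lra) Hs) as Hs1.
      specialize (IH _ Hs1). specialize (HM1 s Hs). specialize (Hg1 s Hs).
      assert (HR : rpow_opp N (Re (phi s)) <= rpow_opp N (Re s) * rpow_opp N k1).
      { rewrite <- rpow_opp_plus. apply rpow_opp_antitone. exact Hg1. }
      assert (HP : 0 <= K0 * M * rho ^ j).
      { apply Rmult_le_pos; [nra|]. apply pow_le. lra. }
      pose proof (rpow_opp_pos N (Re s)) as HNs.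
      apply Rle_trans with (M1 * (K0 * M * rho ^ j * (rpow_opp N (Re s) * rpow_opp N k1))).
      + apply Rmult_le_compat; try apply Cmod_ge_0; [exact HM1|].
        eapply Rle_trans; [exact IH|]. apply Rmult_le_compat_l; assumption.
      + replace (M1 * (K0 * M * rho ^ j * (rpow_opp N (Re s) * rpow_opp N k1)))
          with (K0 * M * rho ^ j * rpow_opp N (Re s) * (M1 * rpow_opp N k1)) by ring.
        replace (K0 * M * rho ^ S j * rpow_opp N (Re s))
          with (K0 * M * rho ^ j * rpow_opp N (Re s) * rho) by (simpl; ring).
        apply Rmult_le_compat_l; [|exact Hsm]. apply Rmult_le_pos; lra. }
  exists N. split; [exact HN|]. intros eps He He1.
  destruct (phi_gap eps He) as [k [Hk Hg]].
  destruct (Hinf_plus_bounded D eps HD He) as [Me [HMe0 HMe]].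
  assert (G2 : forall i, exists K, 0 <= K /\
    forall f M, inV N f -> bounded_on f eps M ->
    forall j s, half_plane eps s -> 1 < Re s + INR i * k ->
    Cmod (Wn j f s) <= K * M * rho ^ j).
  { induction i as [|i [K [HK IH]]].
    - exists K0. split; [lra|]. intros f M Hf HM j s Hs Hs1.
      simpl in Hs1. rewrite Rmult_0_l, Rplus_0_r in Hs1.
      pose proof (bounded_on_ge_0 f eps M HM) as HM0.
      eapply Rle_trans; [apply (G1 f M Hf); [|exact Hs1]|].
      + intros w Hw. apply HM. apply (half_plane_weaken eps 1); assumption.
      + rewrite <- (Rmult_1_r (K0 * M * rho ^ j)) at 2.
        apply Rmult_le_compat_l; [|apply rpow_opp_le_1; lra].
        apply Rmult_le_pos; [nra|]. apply pow_le. lra.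
    - exists (1 + Me * K / rho).
      assert (HMK : 0 <= Me * K / rho).
      { apply Rmult_le_pos; [nra|]. left. apply Rinv_0_lt_compat. exact Hr. }
      split; [lra|]. intros f M Hf HM j s Hs Hs1.
      pose proof (bounded_on_ge_0 f eps M HM) as HM0.
      destruct j as [|j].
      + simpl. specialize (HM s Hs). nra.
      + simpl Wn. unfold shifted_comp, weighted_comp. rewrite Cmod_mult.
        pose proof (phi_half_plane eps s ltac:(lra) Hs) as Hs2.
        specialize (Hg s Hs). rewrite S_INR in Hs1.
        specialize (IH f M Hf HM j (phi s) Hs2 ltac:(lra)).
        specialize (HMe s Hs).
        assert (HP : 0 < rho ^ j) by (apply pow_lt; exact Hr).
        apply Rle_trans with (Me * (K * M * rho ^ j)).
        * apply Rmult_le_compat; try apply Cmod_ge_0; assumption.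
        * replace (Me * (K * M * rho ^ j)) with (Me * K / rho * M * rho ^ S j)
            by (simpl; field; lra).
          apply Rmult_le_compat_r; [apply pow_le; lra|].
          apply Rmult_le_compat_r; lra. }
  destruct (INR_unbounded (/ k)) as [i Hi].
  destruct (G2 i) as [K [HK HB]]. exists K. split; [exact HK|].
  intros f M Hf HM j s Hs. apply HB; [exact Hf|exact HM|exact Hs|].
  apply Rmult_lt_compat_r with (r := k) in Hi; [|exact Hk].
  rewrite Rinv_l in Hi by lra. unfold half_plane in Hs. lra.
Qed.

Definition neumann_term (g : C -> C) (s : C) (j : nat) : C :=
  Copp (Cmult (Cinv (Cpow lam (S j))) (Wn j g s)).

Lemma Cpow_lam_neq_0 (n : nat) : Cpow lam n <> RtoC 0.
Proof.
  intro E. apply (f_equal Cmod) in E. rewrite Cmod_pow, Cmod_0 in E.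
  apply Cmod_gt_0 in Hlam. pose proof (pow_lt _ n Hlam). lra.
Qed.

Lemma neumann_term_bound (g : C -> C) (s : C) (j : nat) (K : R) :
  Cmod (Wn j g s) <= K * rho ^ j -> Cmod (neumann_term g s j) <= K / Cmod lam * (/ 2) ^ j.
Proof.
  intros H. pose proof Hlam as Hl. apply Cmod_gt_0 in Hl.
  unfold neumann_term. rewrite Cmod_opp, Cmod_mult, Cmod_inv, Cmod_pow by apply Cpow_lam_neq_0.
  pose proof (pow_lt _ (S j) Hl) as HP.
  apply Rle_trans with (/ Cmod lam ^ S j * (K * rho ^ j)).
  - apply Rmult_le_compat_l; [left; apply Rinv_0_lt_compat; exact HP|exact H].
  - apply Req_le. unfold rho, Rdiv. rewrite Rpow_mult_distr. simpl pow. field.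
    repeat split; first [lra|apply Rgt_not_eq, pow_lt; exact Hl].
Qed.

Lemma neumann_W (g : C -> C) (s : C) (n : nat) :
  Cminus (Cmult (D s) (Csum (neumann_term g (phi s)) n))
         (Cmult lam (Csum (neumann_term g s) (S n))) = g s.
Proof.
  induction n as [|n IH].
  - simpl. unfold neumann_term. simpl. field. exact Hlam.
  - replace (Cminus (Cmult (D s) (Csum (neumann_term g (phi s)) (S n)))
      (Cmult lam (Csum (neumann_term g s) (S (S n)))))
    with (Cplus (Cminus (Cmult (D s) (Csum (neumann_term g (phi s)) n))
         (Cmult lam (Csum (neumann_term g s) (S n))))
       (Cminus (Cmult (D s) (neumann_term g (phi s) n)) (Cmult lam (neumann_term g s (S n)))))
      by (simpl; ring).
    rewrite IH.
    replace (Cminus (Cmult (D s) (neumann_term g (phi s) n)) (Cmult lam (neumann_term g s (S n))))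
      with (RtoC 0); [ring|].
    unfold neumann_term. simpl. unfold shifted_comp, weighted_comp. field.
    split; [apply Cpow_lam_neq_0|exact Hlam].
Qed.

Lemma neumann_inverse (f : C -> C) (s : C) (n : nat) :
  f s = Cplus (Cmult (Cinv (Cpow lam n)) (Wn n f s)) (Csum (neumann_term (T f) s) n).
Proof.
  induction n as [|n IH].
  - simpl. field.
  - rewrite IH at 1. simpl Csum. unfold neumann_term at 3. rewrite Wn_T.
    simpl Cpow. field. split; [apply Cpow_lam_neq_0|exact Hlam].
Qed.

Definition solvable_in (N : nat) : Prop :=
  forall g, inV N g -> exists f, Hinf_plus f /\ eq_C0 (T f) g.

Definition a_priori_in (N : nat) : Prop :=
  forall eps, 0 < eps -> eps <= 1 -> exists K, 0 <= K /\
  forall f M, inV N f -> bounded_on (T f) eps M -> bounded_on f eps (K * M).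

Lemma neumann_solves : exists N, (1 <= N)%nat /\ solvable_in N /\ a_priori_in N.
Proof.
  pose proof Hlam as Hl. apply Cmod_gt_0 in Hl.
  destruct Wn_bound as [N [HN HB]]. exists N. split; [exact HN|]. split.
  - intros g Hg.
    assert (HU : forall eps, 0 < eps -> eps <= 1 -> exists K, forall s, half_plane eps s ->
      forall j, Cmod (neumann_term g s j) <= K * (/ 2) ^ j).
    { intros eps He He1. destruct (HB eps He He1) as [K [HK HKB]].
      destruct (Hinf_plus_bounded g eps (proj1 Hg) He) as [M [HM0 HM]].
      exists (K * M / Cmod lam). intros s Hs j. apply neumann_term_bound.
      apply (HKB g M Hg HM). exact Hs. }
    assert (HL : forall s, exists l, half_plane 0 s -> Ccv (Csum (neumann_term g s)) l).
    { intros s. destruct (Rlt_dec 0 (Re s)) as [Hs|Hs].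
      - destruct (HU (Rmin 1 (Re s / 2))) as [K HK].
        + apply Rmin_pos; lra.
        + apply Rmin_l.
        + destruct (geom_series (neumann_term g s) K) as [l [Hl1 _]].
          * intros j. apply HK. unfold half_plane. pose proof (Rmin_r 1 (Re s / 2)). lra.
          * exists l. intros _. exact Hl1.
      - exists (RtoC 0). intros Hs'. contradiction. }
    destruct (functional_choice _ _ _ HL) as [f Hf].
    exists f. split.
    + apply Hinf_plus_closed. intros eps eta He Heta.
      set (e := Rmin 1 eps). assert (He0 : 0 < e) by (apply Rmin_pos; lra).
      destruct (HU e He0 (Rmin_l _ _)) as [K HK].
      assert (HK0 : 0 <= K).
      { specialize (HK (RtoC (e + 1)) ltac:(change (e < e + 1); lra) O). simpl in HK.
        pose proof (Cmod_ge_0 (neumann_term g (RtoC (e + 1)) 0)). lra. }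
      destruct (pow_small (/ 2) (2 * K) eta) as [n Hn]; try lra.
      specialize (Hn n (Nat.le_refl n)).
      exists (fun s => Csum (neumann_term g s) n). split.
      * apply (Hinf_plus_Csum (fun j s => neumann_term g s j)). intros j.
        apply (Hinf_plus_ext (fun s => Cmult (Copp (Cinv (Cpow lam (S j)))) (Wn j g s))).
        -- intros s _. unfold neumann_term. ring.
        -- apply Hinf_plus_scal, Wn_Hinf. exact (proj1 Hg).
      * intros s Hs.
        destruct (geom_series (neumann_term g s) K) as [l [Hl1 Hl2]].
        { apply HK. eapply half_plane_weaken; [apply Rmin_r|exact Hs]. }
        assert (Hs0 : half_plane 0 s) by (apply (half_plane_0 eps); assumption).
        rewrite (Ccv_unique _ _ _ (Hf s Hs0) Hl1).
        eapply Rle_trans; [apply Hl2|]. lra.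
    + intros s Hs. unfold shifted_comp, weighted_comp.
      apply (Ccv_unique (fun n => Cminus (Cmult (D s) (Csum (neumann_term g (phi s)) n))
         (Cmult lam (Csum (neumann_term g s) (S n))))).
      * apply Ccv_minus; apply Ccv_scal.
        -- apply Hf. apply phi_half_plane; [lra|exact Hs].
        -- intros eta He. destruct (Hf s Hs eta He) as [n0 Hn0]. exists n0.
           intros n Hn. apply Hn0. lia.
      * apply Ccv_ext with (fun _ => g s); [|apply Ccv_const].
        intros n. symmetry. apply neumann_W.
  - intros eps He He1. destruct (HB eps He He1) as [K [HK HKB]].
    exists (2 * (K / Cmod lam)).
    assert (Hil : 0 < / Cmod lam) by (apply Rinv_0_lt_compat; exact Hl).
    assert (HKl : 0 <= K / Cmod lam) by (apply Rmult_le_pos; lra).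
    split; [lra|]. intros f M Hf HM s Hs.
    pose proof (T_inV N f HN Hf) as HTf.
    destruct (Hinf_plus_bounded f eps (proj1 Hf) He) as [Mf [HMf0 HMf]].
    destruct (geom_series (neumann_term (T f) s) (K * M / Cmod lam)) as [l [Hl1 Hl2]].
    { intros j. apply neumann_term_bound. apply (HKB (T f) M HTf HM). exact Hs. }
    assert (E : l = f s).
    { apply (Ccv_unique (Csum (neumann_term (T f) s))); [exact Hl1|].
      intros eta Heta.
      destruct (pow_small (/ 2) (K * Mf) eta) as [n0 Hn0]; try nra.
      exists n0. intros n Hn. specialize (Hn0 n Hn).
      rewrite (neumann_inverse f s n) at 1.
      set (R_ := Csum (neumann_term (T f) s) n).
      replace (Cminus R_ (Cplus (Cmult (Cinv (Cpow lam n)) (Wn n f s)) R_))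
        with (Copp (Cmult (Cinv (Cpow lam n)) (Wn n f s))) by ring.
      rewrite Cmod_opp, Cmod_mult, Cmod_inv, Cmod_pow by apply Cpow_lam_neq_0.
      pose proof (HKB f Mf Hf HMf n s Hs) as HW.
      pose proof (pow_lt _ n Hl) as HPl.
      apply Rle_lt_trans with (/ Cmod lam ^ n * (K * Mf * rho ^ n)).
      - apply Rmult_le_compat_l; [left; apply Rinv_0_lt_compat; exact HPl|exact HW].
      - replace (/ Cmod lam ^ n * (K * Mf * rho ^ n)) with (K * Mf * (/ 2) ^ n).
        + exact Hn0.
        + unfold rho, Rdiv. rewrite Rpow_mult_distr. field. lra. }
    specialize (Hl2 O). simpl in Hl2. rewrite E in Hl2.
    replace (Cminus (RtoC 0) (f s)) with (Copp (f s)) in Hl2 by ring. rewrite Cmod_opp in Hl2.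
    eapply Rle_trans; [exact Hl2|]. apply Req_le. field. lra.
Qed.

Lemma diag_minus_neq_0 (N : nat) : (1 <= N)%nat -> Cminus (diag N) lam <> RtoC 0.
Proof.
  intros HN K. apply (Hdiag N HN).
  replace (diag N) with (Cplus (Cminus (diag N) lam) lam) by ring. rewrite K. ring.
Qed.

Lemma T_sub_npow (N : nat) (z : C) (f : C -> C) (s : C) :
  T (fun s => Cminus (f s) (Cmult z (npow_opp N s))) s
  = Cminus (T f s) (Cmult z (T (npow_opp N) s)).
Proof. unfold shifted_comp, weighted_comp. ring. Qed.

Lemma T_npow_coefs (N : nat) : (1 <= N)%nat -> exists b,
  dirichlet_rep b (T (npow_opp N)) /\ vanish_below N b /\ b N = Cminus (diag N) lam.
Proof.
  intros HN. pose proof (Hinf_plus_npow N HN) as Hn.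
  pose proof (T_Hinf _ Hn) as [_ [_ [b Hb]]]. exists b. split; [exact Hb|].
  destruct (T_lead N (npow_opp N) _ (delta_coef N) b HN Hn (dirichlet_rep_npow N HN)
    (vanish_below_delta N) (fun s _ => eq_refl) Hb) as [B1 B2].
  split; [exact B1|]. rewrite B2, delta_coef_diag. ring.
Qed.

Lemma solvable_descend (N : nat) : (1 <= N)%nat -> solvable_in (S N) -> solvable_in N.
Proof.
  intros HN HS g [Hg [b [Hb Hz]]].
  destruct (T_npow_coefs N HN) as [t [Ht [Htz HtN]]].
  pose proof (Hinf_plus_npow N HN) as Hn.
  pose proof (diag_minus_neq_0 N HN) as Hd.
  set (z := Cmult (b N) (Cinv (Cminus (diag N) lam))).
  destruct (HS (fun s => Cminus (g s) (Cmult z (T (npow_opp N) s)))) as [f [Hf HTf]].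
  { apply (inV_sub_lead N g (T (npow_opp N)) b t z HN Hg (T_Hinf _ Hn) Hb Ht Hz Htz).
    rewrite HtN. unfold z. rewrite <- Cmult_assoc, Cinv_l by exact Hd. ring. }
  exists (fun s => Cplus (f s) (Cmult z (npow_opp N s))). split.
  - apply Hinf_plus_plus; [exact Hf|apply Hinf_plus_scal; exact Hn].
  - intros s Hs. specialize (HTf s Hs). cbv beta in HTf.
    transitivity (Cplus (T f s) (Cmult z (T (npow_opp N) s))).
    + unfold shifted_comp, weighted_comp. ring.
    + rewrite HTf. ring.
Qed.

Lemma a_priori_descend (N : nat) : (1 <= N)%nat -> a_priori_in (S N) -> a_priori_in N.
Proof.
  intros HN HA eps He He1. destruct (HA eps He He1) as [K [HK HKB]].
  destruct (coef_bound 1 ltac:(lra)) as [K1 [HK1 HC]].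
  pose proof (Hinf_plus_npow N HN) as Hn.
  destruct (Hinf_plus_bounded _ eps (T_Hinf _ Hn) He) as [Mt [HMt0 HMt]].
  pose proof (diag_minus_neq_0 N HN) as Hd. apply Cmod_gt_0 in Hd.
  pose proof (rpow_opp_pos N (eps + 1)) as HP.
  set (q := / (Cmod (Cminus (diag N) lam) * rpow_opp N (eps + 1))).
  assert (Hq : 0 < q) by (apply Rinv_0_lt_compat; nra).
  exists (K * (1 + q * K1 * Mt) + q * K1).
  assert (HqK : 0 <= q * K1) by nra.
  assert (HqKM : 0 <= q * K1 * Mt) by nra.
  split; [nra|]. intros f M [Hf [u [Hu Hz]]] HM.
  pose proof (bounded_on_ge_0 _ _ _ HM) as HM0.
  pose proof (T_Hinf f Hf) as HTf. pose proof HTf as [_ [_ [b Hb]]].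
  destruct (T_lead N f (T f) u b HN Hf Hu Hz (fun s _ => eq_refl) Hb) as [_ B2].
  pose proof (HC b (T f) eps M Hb He HM N HN) as HCN.
  rewrite B2, Cmod_mult in HCN.
  assert (HuN : Cmod (u N) <= q * K1 * M).
  { unfold q.
    apply Rmult_le_reg_l with (Cmod (Cminus (diag N) lam) * rpow_opp N (eps + 1)); [nra|].
    replace (Cmod (Cminus (diag N) lam) * rpow_opp N (eps + 1)
      * (/ (Cmod (Cminus (diag N) lam) * rpow_opp N (eps + 1)) * K1 * M)) with (K1 * M)
      by (field; lra). lra. }
  assert (HB' : bounded_on (fun s => Cminus (f s) (Cmult (u N) (npow_opp N s))) eps
     (K * (M + q * K1 * M * Mt))).
  { apply HKB.
    - apply (inV_sub_lead N f (npow_opp N) u (delta_coef N) (u N) HN Hf Hn Hu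
        (dirichlet_rep_npow N HN) Hz (vanish_below_delta N)).
      rewrite delta_coef_diag. ring.
    - intros s Hs. rewrite T_sub_npow. eapply Rle_trans; [apply Cmod_minus_le|].
      apply Rplus_le_compat; [apply HM; exact Hs|]. rewrite Cmod_mult.
      apply Rmult_le_compat; try apply Cmod_ge_0; [exact HuN|apply HMt; exact Hs]. }
  intros s Hs. specialize (HB' s Hs). cbv beta in HB'.
  pose proof (Cmod_le_minus (f s) (Cmult (u N) (npow_opp N s))) as HF.
  rewrite Cmod_mult in HF.
  assert (Cmod (npow_opp N s) <= 1).
  { rewrite Cmod_npow_opp. apply rpow_opp_le_1. unfold half_plane in Hs. lra. }
  pose proof (Cmod_ge_0 (u N)). pose proof (Cmod_ge_0 (npow_opp N s)).
  assert (Cmod (u N) * Cmod (npow_opp N s) <= q * K1 * M * 1)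
    by (apply Rmult_le_compat; assumption).
  replace ((K * (1 + q * K1 * Mt) + q * K1) * M)
    with (K * (M + q * K1 * M * Mt) + q * K1 * M) by ring. lra.
Qed.

Lemma resolvent_estimates : solvable_in 1 /\ a_priori_in 1.
Proof.
  destruct neumann_solves as [N [HN [H1 H2]]].
  induction N as [|N IH]; [lia|].
  destruct (Nat.eq_dec N 0) as [->|HN0]; [split; assumption|].
  apply IH; [lia|apply solvable_descend|apply a_priori_descend]; (lia || assumption).
Qed.

Lemma T_injective (f g : C -> C) : Hinf_plus f -> Hinf_plus g ->
  eq_C0 (T f) (T g) -> eq_C0 f g.
Proof.
  intros Hf Hg E s Hs. unfold half_plane in Hs.
  set (e := Rmin 1 (Re s / 2)). assert (He : 0 < e) by (apply Rmin_pos; lra).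
  destruct (proj2 resolvent_estimates e He (Rmin_l _ _)) as [K [HK HB]].
  assert (H : Cmod (Cminus (f s) (g s)) <= K * 0).
  { apply (HB (fun s => Cminus (f s) (g s)) 0).
    - apply inV_1, Hinf_plus_minus; assumption.
    - intros w Hw.
      replace (T (fun s => Cminus (f s) (g s)) w) with (RtoC 0); [rewrite Cmod_0; lra|].
      assert (Hw0 : half_plane 0 w) by (apply (half_plane_0 e); assumption).
      transitivity (Cminus (T f w) (T g w)).
      + rewrite (E w Hw0). ring.
      + unfold shifted_comp, weighted_comp. ring.
    - unfold half_plane. pose proof (Rmin_r 1 (Re s / 2)). fold e in H. lra. }
  rewrite Rmult_0_r in H. pose proof (Cmod_ge_0 (Cminus (f s) (g s))).
  assert (E0 : Cminus (f s) (g s) = RtoC 0) by (apply Cmod_eq_0; lra).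
  replace (f s) with (Cplus (Cminus (f s) (g s)) (g s)) by ring. rewrite E0. ring.
Qed.

Lemma T_invertible : invertible_operator T.
Proof.
  split; [exact T_continuous|].
  destruct resolvent_estimates as [HS HA].
  assert (HU : forall g, exists f, Hinf_plus g -> Hinf_plus f /\ eq_C0 (T f) g).
  { intros g. destruct (classic (Hinf_plus g)) as [Hg|Hg].
    - destruct (HS g (inV_1 g Hg)) as [f Hf]. exists f. intros _. exact Hf.
    - exists g. intros Hg'. contradiction. }
  destruct (functional_choice _ _ _ HU) as [U HU']. clear HU.
  exists U. split.
  - apply continuous_operator_intro.
    + intros f Hf. apply HU'. exact Hf.
    + intros f g Hf Hg. destruct (HU' f Hf) as [F1 F2]. destruct (HU' g Hg) as [G1 G2].
      destruct (HU' _ (Hinf_plus_plus f g Hf Hg)) as [S1 S2].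
      apply T_injective; [exact S1|apply Hinf_plus_plus; assumption|].
      intros s Hs. rewrite (S2 s Hs), <- (F2 s Hs), <- (G2 s Hs). unfold shifted_comp, weighted_comp. ring.
    + intros k f Hf. destruct (HU' f Hf) as [F1 F2].
      destruct (HU' _ (Hinf_plus_scal k f Hf)) as [S1 S2].
      apply T_injective; [exact S1|apply Hinf_plus_scal; assumption|].
      intros s Hs. rewrite (S2 s Hs), <- (F2 s Hs). unfold shifted_comp, weighted_comp. ring.
    + intros eps He. set (e := Rmin 1 eps). assert (He0 : 0 < e) by (apply Rmin_pos; lra).
      destruct (HA e He0 (Rmin_l _ _)) as [K [HK HB]].
      exists e, K. split; [exact He0|]. split; [exact HK|].
      intros f g M Hf Hg HM s Hs. destruct (HU' f Hf) as [F1 F2]. destruct (HU' g Hg) as [G1 G2].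
      apply (HB (fsub (U g) (U f)) M).
      * apply inV_1, Hinf_plus_minus; assumption.
      * intros w Hw.
        assert (Hw0 : half_plane 0 w) by (apply (half_plane_0 e); assumption).
        replace (T (fsub (U g) (U f)) w) with (fsub g f w); [apply HM; exact Hw|].
        unfold fsub at 1. rewrite <- (F2 w Hw0), <- (G2 w Hw0).
        unfold shifted_comp, weighted_comp, fsub. ring.
      * eapply half_plane_weaken; [apply Rmin_r|exact Hs].
  - intros f Hf. destruct (HU' f Hf) as [F1 F2]. destruct (HU' _ (T_Hinf f Hf)) as [G1 G2].
    split; [apply T_injective; assumption|exact F2].
Qed.
End OffSpectrum.
End Resolvent.

(* An inverse [U] would send the bounded family [n^{-s}] to a bounded family whose
   leading coefficients [n^{c_1} / D(infty)] grow faster than Bohr's bound allows. *)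
Lemma spectrum_zero_c0_1 : c0 = 1%nat -> a 1%nat <> RtoC 0 -> spectrum W (RtoC 0).
Proof.
  intros E1 Ha [_ [U [[HU [_ [Hsc Hcont]]] HI]]].
  pose proof (Re_c1_pos c psi Hpsi Hc Hpos) as Hr. set (r := Re (c 1%nat)) in *.
  assert (Hd : forall n, diag n = Cmult (a 1%nat) (npow_opp n (c 1%nat))).
  { intros n. unfold diag. rewrite E1. reflexivity. }
  assert (Hd0 : forall n, diag n <> RtoC 0).
  { intros n K. rewrite Hd in K. apply (f_equal Cmod) in K.
    rewrite Cmod_mult, Cmod_npow_opp, Cmod_0 in K. apply Cmod_gt_0 in Ha.
    pose proof (rpow_opp_pos n (Re (c 1%nat))). nra. }
  pose proof (Hinf_plus_const (RtoC 0)) as Hz.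
  destruct (Hcont (fun _ => RtoC 0) Hz (r / 4) 1 ltac:(lra) ltac:(lra)) as [del [rho [Hdel [Hrho HB]]]].
  assert (HU0 : eq_C0 (U (fun _ => RtoC 0)) (fun _ => RtoC 0)).
  { intros s Hs. pose proof (Hsc (RtoC 0) (fun _ => RtoC 0) Hz s Hs) as K. cbv beta in K.
    rewrite !Cmult_0_l in K.
    exact K. }
  destruct (coef_bound (r / 4) ltac:(lra)) as [K [HK HC]].
  assert (Hn : forall n, (1 <= n)%nat ->
    rho / 2 * rpow_opp n (r / 2) <= K * Cmod (a 1%nat) * rpow_opp n r).
  { intros n Hn.
    set (g := fun s => Cmult (RtoC (rho / 2)) (npow_opp n s)).
    assert (Hg : Hinf_plus g) by (apply Hinf_plus_scal, Hinf_plus_npow; exact Hn).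
    pose proof (HU g Hg) as Hf. pose proof Hf as [_ [_ [u Hu]]].
    assert (HB1 : bounded_on (U g) (r / 4) 1).
    { intros s Hs.
      assert (Hlt : Rbar_lt (seminorm (r / 4) (fsub (U g) (U (fun _ => RtoC 0)))) 1).
      { apply HB; [exact Hg|]. apply bounded_seminorm_lt with (rho / 2); [|lra].
        intros w Hw. unfold fsub, g.
        replace (Cminus (Cmult (RtoC (rho / 2)) (npow_opp n w)) (RtoC 0))
          with (Cmult (RtoC (rho / 2)) (npow_opp n w)) by ring.
        rewrite Cmod_mult, Cmod_R, Rabs_right, Cmod_npow_opp by lra.
        pose proof (rpow_opp_le_1 n (Re w)). unfold half_plane in Hw. nra. }
      apply seminorm_lt_bounded in Hlt. specialize (Hlt s Hs). unfold fsub in Hlt.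
      rewrite (HU0 s) in Hlt by (apply (half_plane_weaken 0 (r / 4)); [lra|exact Hs]).
      replace (Cminus (U g s) (RtoC 0)) with (U g s) in Hlt by ring. exact Hlt. }
    destruct (T_preimage_npow (RtoC 0) n (RtoC (rho / 2)) (U g) u Hn) as [_ HL].
    - intros p _. apply Hd0.
    - exact Hf.
    - exact Hu.
    - apply (HI g Hg).
    - replace (Cminus (diag n) (RtoC 0)) with (diag n) in HL by ring.
      apply (f_equal Cmod) in HL. rewrite Hd, !Cmod_mult, Cmod_npow_opp, Cmod_R, Rabs_right in HL by lra.
      fold r in HL.
      pose proof (HC u (U g) (r / 4) 1 Hu ltac:(lra) HB1 n Hn) as HCn.
      replace (r / 4 + r / 4) with (r / 2) in HCn by field.
      rewrite <- HL.
      replace (Cmod (a 1%nat) * rpow_opp n r * Cmod (u n) * rpow_opp n (r / 2))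
        with (Cmod (a 1%nat) * rpow_opp n r * (Cmod (u n) * rpow_opp n (r / 2))) by ring.
      replace (K * Cmod (a 1%nat) * rpow_opp n r)
        with (Cmod (a 1%nat) * rpow_opp n r * (K * 1)) by ring.
      apply Rmult_le_compat_l; [|exact HCn].
      apply Rmult_le_pos; [apply Cmod_ge_0|left; apply rpow_opp_pos]. }
  apply Cmod_gt_0 in Ha.
  destruct (rpow_opp_small (r / 2) (K * Cmod (a 1%nat)) (rho / 2)) as [n [Hn1 Hn2]]; try nra.
  specialize (Hn2 n (Nat.le_refl n)).
  specialize (Hn n Hn1).
  replace r with (r / 2 + r / 2) in Hn at 2 by field. rewrite rpow_opp_plus in Hn.
  pose proof (rpow_opp_pos n (r / 2)). nra.
Qed.

Lemma Cmod_diag_c0_1 (m p : nat) : c0 = 1%nat -> a 1%nat <> RtoC 0 ->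
  (1 <= p < m)%nat -> diag p <> diag m.
Proof.
  intros E1 Ha Hpm K. unfold diag in K. rewrite E1 in K. simpl in K.
  apply (f_equal Cmod) in K. rewrite !Cmod_mult, !Cmod_npow_opp in K.
  apply Cmod_gt_0 in Ha. apply Rmult_eq_reg_l in K; [|lra].
  pose proof (Re_c1_pos c psi Hpsi Hc Hpos) as Hr.
  unfold rpow_opp in K. apply exp_inv in K.
  assert (ln (INR p) < ln (INR m)) by (apply ln_increasing; [apply lt_0_INR|apply lt_INR]; lia).
  nra.
Qed.

Lemma spectrum_eq (lam : C) :
  spectrum W lam <-> lam = RtoC 0 \/ exists m, (1 <= m)%nat /\ lam = diag m.
Proof.
  split.
  - intros H. apply NNPP. intros Hn. apply H. apply T_invertible.
    + intro E. apply Hn. left. exact E.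
    + intros p Hp E. apply Hn. right. exists p. split; [exact Hp|symmetry; exact E].
  - assert (Hz : spectrum W (RtoC 0)).
    { destruct (Ceq_dec (a 1%nat) (RtoC 0)) as [E|NE].
      - apply (spectrum_diag (RtoC 0) 1); [lia| |intros; lia].
        unfold diag. rewrite E. ring.
      - destruct (Nat.eq_dec c0 1) as [E1|NE1]; [apply spectrum_zero_c0_1; assumption|].
        apply Nat.eqb_neq in NE1.
        apply (spectrum_diag (RtoC 0) 2); [lia| |].
        + unfold diag. rewrite NE1. simpl. ring.
        + intros p Hp K. replace p with 1%nat in K by lia. unfold diag in K. rewrite NE1 in K.
          simpl in K. apply NE. rewrite <- K. ring. }
    intros [->|[m [Hm ->]]]; [exact Hz|].
    destruct (Ceq_dec (diag m) (RtoC 0)) as [E|NE]; [rewrite E; exact Hz|].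
    apply (spectrum_diag (diag m) m Hm eq_refl). intros p Hp.
    destruct (Nat.eq_dec c0 1) as [E1|NE1].
    + apply Cmod_diag_c0_1; [exact E1| |exact Hp].
      intro K. apply NE. unfold diag. rewrite K. ring.
    + exfalso. apply NE. unfold diag. apply Nat.eqb_neq in NE1. rewrite NE1.
      replace (m =? 1)%nat with false; [ring|]. symmetry. apply Nat.eqb_neq. lia.
Qed.
End WeightedComposition.

Lemma ex_derive_affine (f : C -> C) (k z : C) (s : C) :
  half_plane 0 s -> (forall w, half_plane 0 w -> f w = Cplus (Cmult k w) z) ->
  ex_derive (K := C_AbsRing) (V := C_NormedModule) f s.
Proof.
  intros Hs Hf. apply ex_derive_C_intro with k. intros eta He.
  exists (Re s). split; [exact Hs|]. intros h Hh.
  rewrite (Hf s Hs), (Hf (Cplus s h)).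
  - replace (Cminus (Cminus (Cplus (Cmult k (Cplus s h)) z) (Cplus (Cmult k s) z)) (Cmult k h))
      with (RtoC 0) by ring.
    rewrite Cmod_0. pose proof (Cmod_ge_0 h). nra.
  - unfold half_plane in *. change (0 < Re s + Re h). pose proof (re_ge_Cmod h). lra.
Qed.

Lemma automorphism_of_affine (phi : C -> C) (k tau : R) : 0 < k ->
  (forall s, half_plane 0 s -> phi s = Cplus (Cmult (RtoC k) s) (Cmult Ci (RtoC tau))) ->
  automorphism_C0 phi.
Proof.
  intros Hk Hphi.
  assert (Hk0 : RtoC k <> RtoC 0) by (intro E; apply (f_equal fst) in E; simpl in E; lra).
  assert (H1 : forall s, half_plane 0 s -> half_plane 0 (phi s)).
  { intros s Hs. rewrite (Hphi s Hs). unfold half_plane in *.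
    replace (Re (Cplus (Cmult (RtoC k) s) (Cmult Ci (RtoC tau)))) with (k * Re s)
      by re_im_ring. nra. }
  set (chi := fun s => Cplus (Cmult (RtoC (/ k)) s) (Cmult Ci (RtoC (- (tau / k))))).
  assert (H2 : forall s, half_plane 0 s -> half_plane 0 (chi s)).
  { intros s Hs. unfold half_plane, chi in *.
    replace (Re (Cplus (Cmult (RtoC (/ k)) s) (Cmult Ci (RtoC (- (tau / k)))))) with (/ k * Re s)
      by re_im_ring.
    assert (0 < / k) by (apply Rinv_0_lt_compat; exact Hk). nra. }
  split; [exact H1|]. split.
  { intros s Hs. apply (ex_derive_affine phi (RtoC k) (Cmult Ci (RtoC tau)) s Hs Hphi). }
  exists chi. split; [exact H2|]. split.
  { intros s Hs. apply (ex_derive_affine chi (RtoC (/ k)) (Cmult Ci (RtoC (- (tau / k)))) s Hs).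
    reflexivity. }
  intros s Hs. split.
  - rewrite (Hphi s Hs). unfold chi, Rdiv. rewrite RtoC_opp, RtoC_mult, RtoC_inv by lra.
    field. exact Hk0.
  - rewrite (Hphi _ (H2 s Hs)). unfold chi, Rdiv. rewrite RtoC_opp, RtoC_mult, RtoC_inv by lra.
    field. exact Hk0.
Qed.

Lemma dirichlet_unif_cv_rep (c : nat -> C) (psi : C -> C) :
  (forall eps, 0 < eps -> dirichlet_unif_cv c psi eps) -> dirichlet_rep c psi.
Proof.
  intros H s Hs. unfold half_plane in Hs. apply is_series_C. intros eta He.
  destruct (H (Re s / 2) ltac:(lra) eta He) as [N HN]. exists (S N). intros n Hn.
  destruct n as [|n]; [lia|]. rewrite <- sum_n_Csum. apply HN; [lia|].
  unfold half_plane. lra.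
Qed.

Lemma dirichlet_unif_cv_bounded (c : nat -> C) (psi : C -> C) (eps : R) :
  0 < eps -> dirichlet_unif_cv c psi eps -> exists M, bounded_on psi eps M.
Proof.
  intros He H. destruct (H 1 ltac:(lra)) as [N HN].
  exists (Rsum (fun k => Cmod (c (S k))) (S N) + 1). intros s Hs.
  specialize (HN N (Nat.le_refl N) s Hs). rewrite sum_n_Csum in HN.
  eapply Rle_trans; [apply (Cmod_le_minus _ (dsum c s (S N)))|].
  apply Rplus_le_compat; [|rewrite Cmod_minus_sym; lra].
  eapply Rle_trans; [apply Cmod_Csum|]. apply Rsum_le. intros k _.
  unfold dirichlet_term. rewrite Cmod_mult, Cmod_npow_opp.
  rewrite <- (Rmult_1_r (Cmod (c (S k)))) at 2.
  apply Rmult_le_compat_l; [apply Cmod_ge_0|]. apply rpow_opp_le_1. unfold half_plane in Hs. lra.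
Qed.

(* World: Stdlib reals with Coquelicot.  D(infty) is the coefficient a 1 of D. *)
Theorem theorem3p11 (a : nat -> C) (D : C -> C)
    (c0 : nat) (c : nat -> C) (phi : C -> C)
    (HD : Hinf_plus D) (HDa : dirichlet_rep a D)
    (HD0 : ~ eq_C0 D (fun _ : C => RtoC 0))
    (Hphi : G_pos c0 c phi) (Hnaut : ~ automorphism_C0 phi) :
  continuous_operator (weighted_comp D phi) /\
  ((2 <= c0)%nat -> a 1%nat <> RtoC 0 ->
     forall lambda : C,
       spectrum (weighted_comp D phi) lambda <->
       (lambda = RtoC 0 \/ lambda = a 1%nat)) /\
  (c0 = 1%nat -> a 1%nat <> RtoC 0 ->
     forall lambda : C,
       spectrum (weighted_comp D phi) lambda <->
       (lambda = RtoC 0 \/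
        exists m : nat, (1 <= m)%nat /\
          lambda = Cmult (a 1%nat) (npow_opp m (c 1%nat)))) /\
  (a 1%nat = RtoC 0 ->
     forall lambda : C,
       spectrum (weighted_comp D phi) lambda <-> lambda = RtoC 0).
Proof.
  destruct Hphi as [Hc0 [psi [Hp [Hu Hcase]]]].
  assert (Hpos : forall s, half_plane 0 s -> half_plane 0 (psi s)).
  { destruct Hcase as [[tau Ht]|H]; [|exact H]. exfalso. apply Hnaut.
    apply (automorphism_of_affine phi (INR c0) tau); [apply lt_0_INR; lia|].
    intros s Hs. rewrite (Hp s Hs), (Ht s Hs). reflexivity. }
  pose proof (dirichlet_unif_cv_rep c psi Hu) as Hc.
  assert (Hpsi : Hinf_plus psi).
  { apply (Hinf_plus_intro c psi Hc). intros eps He.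
    apply (dirichlet_unif_cv_bounded c psi eps He). apply Hu. exact He. }
  pose proof (spectrum_eq a D c0 c phi psi HD HDa Hc0 Hp Hpsi Hc Hpos) as HS.
  split; [apply (W_continuous D c0 phi psi HD Hc0 Hp Hpsi Hpos)|].
  split; [|split].
  - intros H2 Ha lambda. rewrite HS. unfold diag.
    replace (c0 =? 1)%nat with false by (symmetry; apply Nat.eqb_neq; lia).
    split.
    + intros [->|[m [Hm ->]]]; [now left|].
      destruct (m =? 1)%nat; [right|left]; ring.
    + intros [->| ->]; [now left|]. right. exists 1%nat. split; [lia|]. simpl. ring.
  - intros H1 Ha lambda. rewrite HS. unfold diag. subst c0. reflexivity.
  - intros Ha lambda. rewrite HS. unfold diag. rewrite Ha. split.
    + intros [->|[m [Hm ->]]]; [reflexivity|ring].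
    + intros ->. now left.
Qed.
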